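(* Let $n\ge2$. The Hausdorff distance in $(\mathcal M(\mathbb I^n),d_{\mathcal M})$ between the isometrically embedded copy $\{\sigma_x:x\in\mathbb I^n\}$ of $\mathbb I^n$ and $\mathcal M(\mathbb I^n)$ satisfies $$\sup_{\tau\in\mathcal M(\mathbb I^n)}\ \inf_{x\in\mathbb I^n} d_{\mathcal M}(\tau,\sigma_x)\ \le\ \sqrt{\pi}\,\frac{n-1}{2}\,\frac{\Gamma\left(\frac{n-1}{2}\right)}{\Gamma\left(\frac n2\right)}\int_0^{\operatorname{artanh}(2^{-1/(n-1)})}\cosh^{n-1}r\,dr .$$
   Context: On $\mathbb R^{n+1}$ put $\langle x,y\rangle=-x_0y_0+x_1y_1+\cdots+x_ny_n$. Let $\mathbb I^n=\{x:\langle x,x\rangle=-1,\ x_0>0\}$ (hyperboloid model of hyperbolic space), $o=(1,0,\dots,0)$, and $\mathrm{dS}^n=\{u:\langle u,u\rangle=1\}$. The map $(r,\omega)\mapsto(\sinh r,\cosh r\,\omega)$, $r\in\mathbb R$, $\omega\in S^{n-1}$, parametrizes $\mathrm{dS}^n$, and $d\mu_{\mathrm{dS}^n}=\cosh^{n-1}r\,dr\,d\omega$ with $d\omega$ the standard measure on $S^{n-1}$. For $u\in\mathrm{dS}^n$ let $H_u=\{x\in\mathbb I^n:\langle x,u\rangle>0\}$ (open half-space) and $H_u^c=\mathbb I^n\setminus H_u$ (closed half-space). Sections. A wall is a pair $\{H_u,H_u^c\}$. A section chooses one half-space of each wall; it is identified with the set of $u\in\mathrm{dS}^n$ such that $H_u$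 is chosen. It is admissible if, whenever a chosen half-space (open or closed) is contained in a half-space $k$, then $k$ is chosen. The point section of $x\in\mathbb I^n$ is $\sigma_x=\{u\in\mathrm{dS}^n:\langle x,u\rangle>0\}$. The medianization $\mathcal M(\mathbb I^n)$ is the set of measurable admissible sections $\tau\subset\mathrm{dS}^n$ with $\mu_{\mathrm{dS}^n}(\tau\triangle\sigma_o)<\infty$, with pseudo-metric $$d_{\mathcal M}(\tau,\tau')=\frac{n-1}{2\operatorname{vol}(S^{n-2})}\,\mu_{\mathrm{dS}^n}(\tau\triangle\tau'),$$ where $\operatorname{vol}(S^0)=2$; with this normalization $x\mapsto\sigma_x$ is an isometric embedding of $\mathbb I^n$ with the hyperbolic metric. *)

(* Defs.v *)
From HB Require Import structures.
From mathcomp Require Import all_boot all_order all_algebra.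
From mathcomp Require Import all_classical all_reals all_analysis.
From mathcomp Require Import measurable_realfun.

Set Implicit Arguments.
Unset Strict Implicit.
Unset Printing Implicit Defensive.

Import Order.TTheory GRing.Theory Num.Theory.
Import numFieldNormedType.Exports.

Local Open Scope classical_set_scope.
Local Open Scope ring_scope.

(* R^n is n.-tuple R, whose sigma-algebra in the library is the product one,
   i.e. the Borel sigma-algebra. *)

Section special_functions.
Context {R : realType}.

Definition cosh (x : R) : R := (expR x + expR (- x)) / 2.

Definition sinh (x : R) : R := (expR x - expR (- x)) / 2.

Definition artanh (x : R) : R := ln ((1 + x) / (1 - x)) / 2.

Definition Gamma (s : R) : R :=
  \int[lebesgue_measure]_(t in `]0, +oo[) (t `^ (s - 1) * expR (- t)).

Lemma cosh_ge0 (x : R) : 0 <= cosh x.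
Proof. by rewrite divr_ge0// addr_ge0// expR_ge0. Qed.

Lemma measurable_expRN : measurable_fun [set: R] (fun x : R => expR (- x)).
Proof. by apply: measurableT_comp => //; exact: measurable_expR. Qed.

Lemma measurable_cosh : measurable_fun [set: R] cosh.
Proof.
apply: measurable_funM => //; apply: measurable_funD;
  [exact: measurable_expR|exact: measurable_expRN].
Qed.

Lemma measurable_sinh : measurable_fun [set: R] sinh.
Proof.
apply: measurable_funM => //; apply: measurable_funB;
  [exact: measurable_expR|exact: measurable_expRN].
Qed.

Lemma measurable_invr : measurable_fun [set: R] (@GRing.inv R).
Proof.
rewrite -(setUv [set (0 : R)]) measurable_funU//; last exact: measurableC.
split; first exact: measurable_fun_set1.
apply: open_continuous_measurable_fun.
  exact/closed_openC/closed_eq.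
by move=> x; rewrite inE /= => /eqP x0; exact: inv_continuous.
Qed.

End special_functions.

Section lebesgue_measure_on_tuples.
Context {R : realType}.

Definition cons_pair n (p : measurableTypeR R * n.-tuple R) : n.+1.-tuple R :=
  [tuple of p.1 :: p.2].

Lemma measurable_cons_pair n : measurable_fun [set: _] (@cons_pair n).
Proof.
by apply: (@measurable_cons _ _ _ R fst n snd);
  [exact: measurable_fst|exact: measurable_snd].
Qed.

Definition uncons n (w : n.+1.-tuple R) : measurableTypeR R * n.-tuple R :=
  (thead w, [tuple of behead w]).

Lemma measurable_uncons n : measurable_fun [set: _] (@uncons n).
Proof.
apply/measurable_fun_pairP; split; first exact: measurable_tnth.
exact: measurable_behead.
Qed.

(* Lebesgue measure on R^(n+1), given that m is Lebesgue measure on R^n *)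
Definition lebesgue_cons n (m : set (n.-tuple R) -> \bar R) :
    set (n.+1.-tuple R) -> \bar R :=
  pushforward (lebesgue_measure \x m)%E (@cons_pair n).

Section lebesgue_cons_measure.
Context n (m : {sigma_finite_measure set (n.-tuple R) -> \bar R}).

HB.instance Definition _ := Measure.copy (lebesgue_cons m)
  (measure_function_pushforward__canonical__measure_function_Measure
    (lebesgue_measure \x m)%E (@measurable_cons_pair n)).

Let lebesgue_cons_sigma_finite : sigma_finite setT (lebesgue_cons m).
Proof.
have /sigma_finiteP[F [TF ndF Foo]] := sigma_finiteT (@lebesgue_measure R).
have /sigma_finiteP[G [TG ndG Goo]] := sigma_finiteT m.
exists (fun k => @uncons n @^-1` (F k `*` G k)).
  rewrite -preimage_bigcup; apply/esym; rewrite -[RHS](preimage_setT (@uncons n)).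
  congr (_ @^-1` _); apply/seteqP; split=> // -[x y] _.
  have [i _ Fx] : (\bigcup_k F k) x by rewrite -TF.
  have [j _ Gy] : (\bigcup_k G k) y by rewrite -TG.
  exists (maxn i j) => //; split => /=.
    by move: x Fx; exact/subsetPset/ndF/leq_maxl.
  by move: y Gy; exact/subsetPset/ndG/leq_maxr.
move=> k; have [mF Fk] := Foo k; have [mG Gk] := Goo k; split.
  rewrite -[X in measurable X]setTI.
  by apply: measurable_uncons => //; exact: measurableX.
rewrite /lebesgue_cons /pushforward.
rewrite (_ : _ @^-1` _ = F k `*` G k); last first.
  apply/funext => -[x y]; rewrite /preimage /= theadE; congr (_ /\ G k _).
  exact: val_inj.
by rewrite product_measure1E// lte_mul_pinfty// ge0_fin_numE.
Qed.

HB.instance Definition _ := Measure_isSigmaFinite.Build _ _ _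
  (lebesgue_cons m) lebesgue_cons_sigma_finite.

End lebesgue_cons_measure.

Fixpoint lebesgue_tuple n : {sigma_finite_measure set (n.-tuple R) -> \bar R} :=
  if n is n'.+1 then lebesgue_cons (lebesgue_tuple n') : sigma_finite_measure _ _
  else dirac [tuple] : sigma_finite_measure _ _.

End lebesgue_measure_on_tuples.

Section sphere_measure.
Context {R : realType}.

Definition enorm n (y : n.-tuple R) : R :=
  Num.sqrt (\sum_(i < n) tnth y i ^+ 2).

Definition scale_tuple n (c : R) (y : n.-tuple R) : n.-tuple R :=
  [tuple of [seq c * t | t <- y]].

Definition normalize n (y : n.-tuple R) : n.-tuple R :=
  scale_tuple (enorm y)^-1 y.

Definition punctured_ball n : set (n.-tuple R) := [set y | 0 < enorm y <= 1].

(* The standard measure on the unit sphere S^(n-1) of R^n, as a measure on R^n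
   supported by the sphere: the measure of A is n times the volume of the cone
   of the points t w with w in A and 0 < t <= 1. *)
Definition sphere_measure n (A : set (n.-tuple R)) : \bar R :=
  (n%:R%:E * lebesgue_tuple n (@normalize n @^-1` A `&` @punctured_ball n))%E.

(* vol(S^(n-1)); in particular vol(S^0) = sphere_volume 1 = 2. *)
Definition sphere_volume n : R := fine (sphere_measure [set: n.-tuple R]).

Lemma measurable_enorm n : measurable_fun [set: n.-tuple R] (@enorm n).
Proof.
have msqrt : measurable_fun [set: R] (@Num.sqrt R).
  apply: continuous_measurable_fun; exact: sqrt_continuous.
apply: (measurableT_comp msqrt).
by apply: measurable_sum => i; apply: measurable_funX; exact: measurable_tnth.
Qed.

Lemma measurable_normalize n : measurable_fun [set: n.-tuple R] (@normalize n).
Proof.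
apply/measurable_fun_tnthP => i.
rewrite (_ : _ \o _ = fun y => (enorm y)^-1 * tnth y i); last first.
  by apply/funext => y; rewrite /= tnth_map.
apply: measurable_funM; last exact: measurable_tnth.
by apply: measurableT_comp; [exact: measurable_invr|exact: measurable_enorm].
Qed.

Lemma measurable_punctured_ball n : measurable (@punctured_ball n).
Proof.
rewrite -[X in measurable X]setTI (_ : @punctured_ball n = @enorm n @^-1` `]0, 1]).
  by apply: measurable_enorm => //; exact: measurable_itv.
by apply/seteqP; split => y; rewrite /= in_itv.
Qed.

HB.instance Definition _ n := Measure.on
  (mrestr (@lebesgue_tuple R n) (@measurable_punctured_ball n)).

HB.instance Definition _ n := Measure.copy (@sphere_measure n)
  (mscale (n%:R%:nng : {nonneg R})
    (measure_function_pushforward__canonical__measure_function_Measure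
      (mrestr (@lebesgue_tuple R n) (@measurable_punctured_ball n))
      (@measurable_normalize n))).

End sphere_measure.

Section de_sitter_measure.
Context {R : realType}.

(* cosh^k r dr on the real line *)
Definition radial_measure k (A : set (measurableTypeR R)) : \bar R :=
  (\int[lebesgue_measure]_(r in A) (cosh r ^+ k)%:E)%E.

Section radial_measure_is_measure.
Variable k : nat.

Let radial0 : radial_measure k set0 = 0%E.
Proof. by rewrite /radial_measure integral_set0. Qed.

Let radial_ge0 A : (0 <= radial_measure k A)%E.
Proof.
by apply: integral_ge0 => r _; rewrite lee_fin exprn_ge0// cosh_ge0.
Qed.

Let measurable_density :
  measurable_fun [set: measurableTypeR R] (fun r => (cosh r ^+ k)%:E).
Proof.
by apply/measurable_EFinP; apply: measurable_funX; exact: measurable_cosh.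
Qed.

Let radial_sigma_additive : semi_sigma_additive (radial_measure k).
Proof.
move=> F mF tF mUF; rewrite /radial_measure ge0_integral_bigcup//=.
- by apply: is_cvg_ereal_nneg_natsum_cond => n _ _; exact: radial_ge0.
- exact: measurable_funTS.
- by move=> r _; rewrite lee_fin exprn_ge0// cosh_ge0.
Qed.

HB.instance Definition _ := isMeasure.Build _ _ _ (radial_measure k)
  radial0 radial_ge0 radial_sigma_additive.

Let radial_sigma_finite : sigma_finite setT (radial_measure k).
Proof.
exists (fun i : nat => `[- i%:R, i%:R]%classic).
  apply/seteqP; split => // r _.
  exists (Num.bound `|r|) => //=; rewrite in_itv /= -ler_norml.
  by apply/ltW/archi_boundP.
move=> i; split; first exact: measurable_itv.
suff : (radial_measure k `[(- i%:R)%R, i%:R%R]%classic <=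
    \int[lebesgue_measure]_(r in `[(- i%:R)%R, i%:R%R]%classic)
      (expR i%:R%R ^+ k)%:E)%E.
  move/le_lt_trans; apply.
  rewrite integral_cst//= lebesgue_measure_itv/=; case: ifPn => _.
    by rewrite -EFinB -EFinM ltry.
  by rewrite mule0 ltry.
apply: ge0_le_integral => //=.
- by move=> r _; rewrite lee_fin exprn_ge0// cosh_ge0.
- exact: measurable_funTS.
- move=> r; rewrite in_itv/= => /andP[ir ri].
  rewrite lee_fin lerXn2r ?nnegrE ?cosh_ge0 ?expR_ge0//.
  rewrite ler_pdivrMr// mulr_natr mulr2n lerD// ler_expR//.
  by rewrite lerNl.
Qed.

HB.instance Definition _ := Measure_isSigmaFinite.Build _ _ _
  (radial_measure k) radial_sigma_finite.

End radial_measure_is_measure.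

Definition dS_param n (p : measurableTypeR R * n.-tuple R) : n.+1.-tuple R :=
  [tuple of sinh p.1 :: scale_tuple (cosh p.1) p.2].

Lemma measurable_dS_param n : measurable_fun [set: _] (@dS_param n).
Proof.
apply: (@measurable_cons _ _ _ R (fun p => sinh p.1) n
    (fun p => scale_tuple (cosh p.1) p.2)).
  by apply: measurableT_comp; [exact: measurable_sinh|exact: measurable_fst].
apply/measurable_fun_tnthP => i.
rewrite (_ : _ \o _ = fun p => cosh p.1 * tnth p.2 i); last first.
  by apply/funext => p; rewrite /= tnth_map.
apply: measurable_funM.
  by apply: measurableT_comp; [exact: measurable_cosh|exact: measurable_fst].
exact: (measurableT_comp (measurable_tnth i) measurable_snd).
Qed.

(* The Borel measure cosh^(n-1) r dr dw on dS^n, as a measure on R^(n+1)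
   supported by dS^n. *)
Definition dS_borel_measure n : set (n.+1.-tuple R) -> \bar R :=
  pushforward (radial_measure n.-1 \x^ @sphere_measure R n)%E (@dS_param n).

HB.instance Definition _ n := Measure.copy (@dS_borel_measure n)
  (measure_function_pushforward__canonical__measure_function_Measure
    (radial_measure n.-1 \x^ @sphere_measure R n)%E (@measurable_dS_param n)).

(* mu_dS is the completion of the Borel measure: its measurable sets are the
   Caratheodory measurable ones, and it extends dS_borel_measure (lemma
   measurable_mu_extE). Every Borel set is measurable in this sense. *)
Definition dS_measurable n : set (set (n.+1.-tuple R)) :=
  ((@dS_borel_measure n)^*)%mu.-cara.-measurable.

Definition dS_measure n : set (n.+1.-tuple R) -> \bar R :=
  @completed_measure_extension _ _ _ (@dS_borel_measure n).

End de_sitter_measure.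

Section medianization.
Context {R : realType} {n : nat}.
Implicit Types (x y u : n.+1.-tuple R) (tau : set (n.+1.-tuple R)).

Definition minkowski x y : R :=
  - (tnth x ord0 * tnth y ord0) +
  \sum_(i < n) tnth x (lift ord0 i) * tnth y (lift ord0 i).

Definition hyperboloid : set (n.+1.-tuple R) :=
  [set x | minkowski x x = -1 /\ 0 < tnth x ord0].

Definition origin : n.+1.-tuple R := [tuple of 1 :: nseq n 0].

Definition dS : set (n.+1.-tuple R) := [set u | minkowski u u = 1].

Definition open_half u : set (n.+1.-tuple R) :=
  [set x | hyperboloid x /\ 0 < minkowski x u].

Definition closed_half u : set (n.+1.-tuple R) := hyperboloid `\` open_half u.

Definition half_space (h : set (n.+1.-tuple R)) : Prop :=
  exists2 u, dS u & h = open_half u \/ h = closed_half u.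

(* A section, i.e. the choice of one of the two half-spaces of each wall
   {open_half u, closed_half u} with u in dS, is encoded by the set tau of those
   u for which open_half u is chosen. *)
Definition chosen tau (h : set (n.+1.-tuple R)) : Prop :=
  (exists2 u, (dS `&` tau) u & h = open_half u) \/
  (exists2 u, (dS `\` tau) u & h = closed_half u).

Definition admissible tau : Prop :=
  forall h k, chosen tau h -> half_space k -> h `<=` k -> chosen tau k.

Definition point_section x : set (n.+1.-tuple R) :=
  [set u | dS u /\ 0 < minkowski x u].

Definition medianization : set (set (n.+1.-tuple R)) :=
  [set tau | [/\ tau `<=` dS, dS_measurable tau, admissible tau &
                 (dS_measure (tau `+` point_section origin) < +oo)%E]].

(* sphere_volume n.-1 is vol(S^(n-2)). *)
Definition dist_med tau tau' : \bar R :=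
  ((n.-1%:R / (2 * sphere_volume (R := R) n.-1))%:E *
   dS_measure (tau `+` tau'))%E.

End medianization.

(* The ambient distance is \bar R-valued so that no finiteness has to be assumed
   to form suprema and infima. *)
Definition hausdorff_dist (R : realType) (T : Type) (d : T -> T -> \bar R)
    (A B : set T) : \bar R :=
  maxe (ereal_sup [set ereal_inf [set d a b | b in B] | a in A])
       (ereal_sup [set ereal_inf [set d a b | a in A] | b in B]).

(* Main.v *)
From HB Require Import structures.
From mathcomp Require Import all_boot all_order all_algebra.
From mathcomp Require Import all_classical all_reals all_analysis.
From mathcomp Require Import measurable_realfun.
From mathcomp Require Import ring lra.
Require Import Defs.

(** For a section tau let F(x) be the measure of the symmetric difference of tau
    and sigma_x, and choose x almost minimizing F. Lorentz reflections preserve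
    the measure, so we may take x = o. If tau contains some u with u_0 > sinh r,
    where tanh(r)^(n-1) > 1/2, admissibility forces tau to contain all walls of a
    cone around the direction e_1 of u, and moving x from o slightly towards e_1
    decreases F: among the walls crossed, those in the cone are gained, those
    outside are at most lost, and the former make up a proportion > 1/2 of all of
    them. Near-minimality excludes this, so tau and sigma_o differ only in the
    band |u_0| <= sinh r. There, time reflection carries the part of the
    difference below the equator to a set disjoint from the part above it, so
    that F(o) is at most the measure of the half-band 0 <= u_0 <= sinh r. Now let
    r decrease to artanh(2^(-1/(n-1))).

    All measures on dS^n are computed through cones: the measure of A is n + 1
    times the Lebesgue measure of the set of w with 0 < <w,w> <= 1 whose
    normalization lies in A. *)

Set Implicit Arguments.
Unset Strict Implicit.
Unset Printing Implicit Defensive.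

Import Order.TTheory GRing.Theory Num.Theory.
Import numFieldNormedType.Exports.

Local Open Scope classical_set_scope.
Local Open Scope ring_scope.

(** * Lebesgue measure on tuples *)

(** Origin of 2^(-1/(n-1)): under an infinitesimal step towards e_1 the crossed walls sit on the
    equator, weighted by the cosine of their angle to e_1. Orthogonal projection along e_1 turns
    this weight into Lebesgue measure on a unit ball of dimension n - 1, so the walls whose angle
    has sine at most s have share s^(n-1). Admissibility forces those with s < tanh r.

    Nothing guarantees that the infimum of F is attained, so the gain of a step must be at least
    some c > 0 fixed before x is chosen. Lorentz maps bring x to o and the direction to a fixed
    axis, hence step and gain depend on r alone; the step is finite, and the room left by
    tanh(r)^(n-1) > 1/2 pays for the resulting errors.

    A section is measurable only for the completed measure, so [dS_measure] is used as an outer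
    measure, monotone and subadditive on all sets, and additive when cutting along a measurable one.

    Cones reduce Lorentz invariance to the invariance of Lebesgue measure under linear involutions,
    where no determinant occurs. The Gamma quotient comes from the ratio of the volumes of S^(n-1)
    and S^(n-2). *)

Lemma ge0_integral_pushforwardT d1 d2 (X : measurableType d1)
    (Y : measurableType d2) (R : realType) (phi : X -> Y)
    (m : {measure set X -> \bar R}) (f : Y -> \bar R) :
  measurable_fun [set: X] phi -> measurable_fun [set: Y] f ->
  (forall y, 0 <= f y)%E ->
  (\int[pushforward m phi]_y f y = \int[m]_x f (phi x))%E.
Proof.
by move=> mphi mf f0; rewrite (ge0_integral_pushforward mphi).
Qed.

(** The involution argument below only yields equality of the squares of two measures, which may be
    infinite. *)
Lemma mule_self_inj (R : realDomainType) (x y : \bar R) :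
  (x * x = y * y -> 0 <= x -> 0 <= y -> x = y)%E.
Proof.
case: x => [x| |]; case: y => [y| |] //=; rewrite ?mulyy -?EFinM//.
move=> [] /eqP; rewrite -!expr2 !lee_fin => + x0 y0.
by rewrite eqrXn2// => /eqP ->.
Qed.

Section lebesgue_line.
Context {R : realType}.
Local Notation leb := (@lebesgue_measure R).

Lemma measurable_subl (a : R) :
  measurable_fun [set: measurableTypeR R] (fun x : R => a - x : measurableTypeR R).
Proof. by apply: measurable_funB. Qed.

Lemma lebesgue_measure_subl (a : R) (A : set R) : measurable A ->
  leb ((fun x => a - x) @^-1` A) = leb A.
Proof.
move=> mA.
rewrite -[LHS]/(pushforward leb (fun x : R => a - x : measurableTypeR R) A).
apply/esym/(@lebesgue_measure_unique R
  (measure_function_pushforward__canonical__measure_function_Measure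
    leb (@measurable_subl a))) => //= _ [[b c]] _ <-.
rewrite /pushforward /=.
rewrite (_ : _ @^-1` _ = `[a - c, a - b[%classic); last first.
  by apply/seteqP; split => x /=; rewrite !in_itv /=; lra.
rewrite !lebesgue_measure_itv /= !lte_fin.
rewrite ltrD2l ltrN2; case: ifP => // _; rewrite -!EFinB; congr EFin; ring.
Qed.

Lemma lebesgue_measure_scale (c : R) (A : set R) : 0 < c -> measurable A ->
  (c%:E * leb ((fun x => (c * x)%R) @^-1` A))%E = leb A.
Proof.
move=> c0 mA.
have mc : measurable_fun [set: measurableTypeR R]
    (fun x : R => c * x : measurableTypeR R) by apply: measurable_funM.
pose nu := measure_function_pushforward__canonical__measure_function_Measure leb mc.
pose c' := NngNum (ltW c0).
transitivity (mscale c' nu A) => //.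
apply/esym/lebesgue_measure_unique => //= _ [[b d]] _ <-.
rewrite /mscale /= /pushforward /=.
rewrite (_ : _ @^-1` _ = `]b / c, d / c]%classic); last first.
  by apply/seteqP; split => x /=; rewrite !in_itv /= ltr_pdivrMr// ler_pdivlMr// mulrC.
rewrite !lebesgue_measure_itv /= !lte_fin.
rewrite ltr_pM2r ?invr_gt0//; case: ifP => // _; last by rewrite mule0.
rewrite -!EFinB -EFinM; congr EFin; field; exact: lt0r_neq0.
Qed.

End lebesgue_line.

Section lebesgue_tuple_invariance.
Context {R : realType}.
Local Notation leb := (@lebesgue_measure R).
Local Notation lebt := (@lebesgue_tuple R).

Lemma measurable_lebesgue_consP n (A : set (n.+1.-tuple R)) : measurable A ->
  measurable (@cons_pair R n @^-1` A).
Proof.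
by move=> mA; rewrite -[X in measurable X]setTI; exact: measurable_cons_pair.
Qed.

Lemma lebesgue_tupleS n (A : set (n.+1.-tuple R)) :
  lebt n.+1 A = (leb \x lebt n)%E (@cons_pair R n @^-1` A).
Proof. by []. Qed.

Lemma lebesgue_tupleS1 n (A : set (n.+1.-tuple R)) : measurable A ->
  lebt n.+1 A = (\int[leb]_x lebt n [set y | A (cons_pair (x, y))])%E.
Proof.
move=> mA; rewrite lebesgue_tupleS; apply: eq_integral => x _ /=.
by congr (lebt n _); apply/seteqP; split => y; rewrite /xsection/= inE.
Qed.

Lemma lebesgue_tupleS2 n (A : set (n.+1.-tuple R)) : measurable A ->
  lebt n.+1 A = (\int[lebt n]_y leb [set x | A (cons_pair (x, y))])%E.
Proof.
move=> mA; rewrite lebesgue_tupleS.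
transitivity ((leb \x^ lebt n)%E (@cons_pair R n @^-1` A)).
  apply: product_measure_unique => [A1 A2 mA1 mA2|].
    exact: product_measure2E.
  exact: measurable_lebesgue_consP.
apply: eq_integral => y _ /=.
by congr (lebesgue_measure _); apply/seteqP; split => x; rewrite /ysection/= inE.
Qed.

Lemma integral_lebesgue_tupleS n (f : n.+1.-tuple R -> \bar R) :
  measurable_fun [set: _] f -> (forall w, 0 <= f w)%E ->
  (\int[lebt n.+1]_w f w = \int[leb]_x \int[lebt n]_y f (cons_pair (x, y)))%E.
Proof.
move=> mf f0.
transitivity (\int[(leb \x lebt n)%E]_p (f \o @cons_pair R n) p)%E.
  exact: ge0_integral_pushforwardT (@measurable_cons_pair R n) _ _.
rewrite fubini_tonelli1//; last by move=> x; exact: f0.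
by apply: measurableT_comp => //; exact: measurable_cons_pair.
Qed.

Lemma integral_lebesgue_tupleS2 n (f : n.+1.-tuple R -> \bar R) :
  measurable_fun [set: _] f -> (forall w, 0 <= f w)%E ->
  (\int[lebt n.+1]_w f w = \int[lebt n]_y \int[leb]_x f (cons_pair (x, y)))%E.
Proof.
move=> mf f0.
transitivity (\int[(leb \x lebt n)%E]_p (f \o @cons_pair R n) p)%E.
  exact: ge0_integral_pushforwardT (@measurable_cons_pair R n) _ _.
rewrite fubini_tonelli2//; last by move=> x; exact: f0.
by apply: measurableT_comp => //; exact: measurable_cons_pair.
Qed.

Definition sub_tuple n (y z : n.-tuple R) : n.-tuple R :=
  [tuple tnth y i - tnth z i | i < n].

Lemma tnth_sub_tuple n (y z : n.-tuple R) i :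
  tnth (sub_tuple y z) i = tnth y i - tnth z i.
Proof. by rewrite tnth_mktuple. Qed.

Lemma tnth_scale_tuple n c (y : n.-tuple R) i :
  tnth (scale_tuple c y) i = c * tnth y i.
Proof. by rewrite tnth_map. Qed.

Lemma measurable_sub_tuple n d (T : measurableType d) (f g : T -> n.-tuple R) :
  measurable_fun [set: T] f -> measurable_fun [set: T] g ->
  measurable_fun [set: T] (fun x => sub_tuple (f x) (g x)).
Proof.
move=> mf mg; apply/measurable_fun_tnthP => i.
rewrite (_ : _ \o _ = fun x => tnth (f x) i - tnth (g x) i); last first.
  by apply/funext => x /=; rewrite tnth_sub_tuple.
by apply: measurable_funB; apply: (measurableT_comp (measurable_tnth i)).
Qed.

Lemma measurable_scale_tuple n c : measurable_fun [set: n.-tuple R] (scale_tuple c).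
Proof.
apply/measurable_fun_tnthP => i.
rewrite (_ : _ \o _ = fun x => c * tnth x i); last first.
  by apply/funext => x /=; rewrite tnth_scale_tuple.
by apply: measurable_funM => //; exact: measurable_tnth.
Qed.

Lemma tnth_cons_pair0 n x (y : n.-tuple R) : tnth (cons_pair (x, y)) ord0 = x.
Proof. by []. Qed.

Lemma tnth_cons_pairS n x (y : n.-tuple R) i :
  tnth (cons_pair (x, y)) (lift ord0 i) = tnth y i.
Proof. by rewrite tnthS. Qed.

Lemma cons_pairP n (P : n.+1.-tuple R -> Prop) :
  (forall x y, P (cons_pair (x, y))) -> forall w, P w.
Proof. by move=> H w; case/tupleP: w => x y; exact: H. Qed.

Lemma sub_tuple_cons n x (y : n.-tuple R) x' y' :
  sub_tuple (cons_pair (x, y)) (cons_pair (x', y')) =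
  cons_pair (x - x', sub_tuple y y').
Proof.
apply: eq_from_tnth => i; rewrite tnth_sub_tuple.
case: (unliftP ord0 i) => [j|] ->; last by rewrite !tnth_cons_pair0.
by rewrite !tnth_cons_pairS tnth_sub_tuple.
Qed.

Lemma scale_tuple_cons n c x (y : n.-tuple R) :
  scale_tuple c (cons_pair (x, y)) = cons_pair (c * x, scale_tuple c y).
Proof. exact: val_inj. Qed.

Lemma measurable_preimage d d' (T : measurableType d) (T' : measurableType d')
    (f : T -> T') (A : set T') : measurable_fun [set: T] f -> measurable A ->
  measurable (f @^-1` A).
Proof. by move=> mf mA; rewrite -[X in measurable X]setTI; exact: mf. Qed.

Lemma measurable_fun_slice n (A : set (n.+1.-tuple R)) : measurable A ->
  measurable_fun [set: measurableTypeR R]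
    (fun x => lebt n [set y | A (cons_pair (x, y))]).
Proof.
move=> mA; have := @measurable_fun_xsection _ _ (measurableTypeR R) _ _ (lebt n) _
  (measurable_lebesgue_consP mA).
congr measurable_fun; apply/funext => x /=.
by congr (lebt n _); apply/seteqP; split => y; rewrite /xsection/= inE.
Qed.

(** Point reflections are taken as the basic symmetry instead of translations: they exchange the two
    factors in the involution argument below, and two of them compose to a translation. *)
Lemma lebesgue_tuple_subl n (a : n.-tuple R) (A : set (n.-tuple R)) :
  measurable A -> lebt n (sub_tuple a @^-1` A) = lebt n A.
Proof.
elim: n a A => [|n IH] a A mA.
  by congr (lebt 0 _); apply/seteqP; split => y /=; rewrite [sub_tuple _ _]tuple0 [y]tuple0.
have msub : measurable_fun [set: _] (sub_tuple a) by exact: measurable_sub_tuple.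
elim/cons_pairP: a msub => a b msub.
rewrite lebesgue_tupleS1; last exact: measurable_preimage.
under eq_integral => x _.
  rewrite (_ : [set y | _] =
      sub_tuple b @^-1` [set y | A (cons_pair (a - x, y))]); last first.
    by apply/seteqP; split => y /=; rewrite sub_tuple_cons.
  rewrite IH; last first.
    apply: (@measurable_preimage _ _ _ _ (fun y => cons_pair (a - x, y))) => //.
    by apply: measurableT_comp; [exact: measurable_cons_pair|exact: measurable_pair1].
  over.
rewrite [RHS]lebesgue_tupleS1//.
pose g x := lebt n [set y | A (cons_pair (x, y))].
have mg : measurable_fun [set: measurableTypeR R] g by exact: measurable_fun_slice.
transitivity (\int[pushforward leb (fun x : R => (a - x)%R : measurableTypeR R)]_x g x)%E.
  by rewrite (ge0_integral_pushforwardT leb (measurable_subl a) mg).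
apply: eq_measure_integral => [|? B mB _]; first exact: measurable_subl.
by rewrite /pushforward /=; exact: lebesgue_measure_subl.
Qed.

Lemma sub_tuple_involutive n (a : n.-tuple R) : involutive (sub_tuple a).
Proof. by move=> y; apply: eq_from_tnth => i; rewrite !tnth_sub_tuple subKr. Qed.

(* Tonelli on [{(x, y) | A x /\ B (L y - x)}]: the substitution [x -> L y - x]
   exchanges [A] and [B], so that [|A| |L^-1 B| = |B| |L^-1 A|]; the claim is
   the case [B = L^-1 A]. *)
Lemma lebesgue_tuple_involution n (L : n.-tuple R -> n.-tuple R)
    (A : set (n.-tuple R)) :
  measurable_fun [set: _] L -> {morph L : y z / sub_tuple y z} -> involutive L ->
  measurable A -> lebt n (L @^-1` A) = lebt n A.
Proof.
move=> mL LB LK mA.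
have mLA B : measurable B -> measurable (L @^-1` B) by exact: measurable_preimage.
pose S (A B : set (n.-tuple R)) : set (n.-tuple R * n.-tuple R) :=
  fst @^-1` A `&` (fun p => sub_tuple (L p.2) p.1) @^-1` B.
have mS A' B' : measurable A' -> measurable B' -> measurable (S A' B').
  move=> mA' mB'; apply: measurableI; first exact: measurable_preimage.
  apply: measurable_preimage => //; apply: measurable_sub_tuple => //.
  exact: measurableT_comp.
have JE A' B' : measurable A' -> measurable B' ->
    (lebt n \x lebt n)%E (S A' B') = (lebt n A' * lebt n (L @^-1` B'))%E.
  move=> mA' mB'; rewrite /product_measure1.
  rewrite (eq_integral (fun x => (\1_A' x)%:E * lebt n (L @^-1` B'))%E); last first.
    move=> x _ /=; rewrite indicE; have [xA|xA] := boolP (x \in A'); last first.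
      rewrite mul0e (_ : xsection _ _ = set0) ?measure0//.
      apply/seteqP; split => y //; rewrite /xsection /S /= inE => -[/= xA' _].
      by move: xA; rewrite notin_setE.
    rewrite mul1e.
    rewrite -(@lebesgue_tuple_subl n (sub_tuple (L x) (L x)) (L @^-1` B')); last exact: mLA.
    rewrite -(@lebesgue_tuple_subl n (L x) (sub_tuple (sub_tuple (L x) (L x)) @^-1` (L @^-1` B'))); last first.
      by apply: measurable_preimage; [exact: measurable_sub_tuple|exact: mLA].
    congr (lebt n _); apply/seteqP; split => y; rewrite /xsection /S /= inE /=.
      move=> [_]; rewrite !LB !LK; congr (B' _).
      by apply: eq_from_tnth => i; rewrite !tnth_sub_tuple; ring.
    move: xA; rewrite inE => xA; rewrite !LB !LK => H; split => //; move: H; congr (B' _).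
    by apply: eq_from_tnth => i; rewrite !tnth_sub_tuple; ring.
  rewrite ge0_integralZr//; first by rewrite integral_indic// setIT.
  exact: measurableT_comp.
have JC A' B' : measurable A' -> measurable B' ->
    (lebt n \x lebt n)%E (S A' B') = (lebt n \x lebt n)%E (S B' A').
  move=> mA' mB'.
  have J2 U : measurable U -> (lebt n \x lebt n)%E U = (lebt n \x^ lebt n)%E U.
    by move=> mU; apply: product_measure_unique => // *; exact: product_measure2E.
  rewrite !J2; [|exact: mS..].
  apply: eq_integral => y _ /=.
  rewrite -(@lebesgue_tuple_subl n (L y) (ysection (S A' B') y)); last first.
    by apply: measurable_ysection; exact: mS.
  congr (lebt n _); apply/seteqP; split => x; rewrite /ysection /S /= !inE /=;
    by rewrite sub_tuple_involutive => -[].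
have := JC A (L @^-1` A) mA (mLA _ mA).
rewrite !JE//; try exact: mLA.
rewrite (_ : L @^-1` (L @^-1` A) = A); last first.
  by apply/seteqP; split => y /=; rewrite LK.
by move/mule_self_inj => <-.
Qed.

Lemma scale_tupleK n (c : R) : c != 0 ->
  cancel (@scale_tuple R n c) (scale_tuple c^-1).
Proof.
by move=> c0 y; apply: eq_from_tnth => i; rewrite !tnth_scale_tuple mulKf.
Qed.

Lemma lebesgue_tuple_scale n (c : R) (A : set (n.-tuple R)) : 0 < c ->
  measurable A -> ((c ^+ n)%:E * lebt n (scale_tuple c @^-1` A))%E = lebt n A.
Proof.
move=> c0; elim: n A => [|n IH] A mA.
  rewrite expr0 mul1e.
  by congr (lebt 0 _); apply/seteqP; split => y /=; rewrite [scale_tuple _ _]tuple0 [y]tuple0.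
have mg := measurable_fun_slice mA.
have mAx x : measurable [set y | A (cons_pair (x, y))].
  apply: (@measurable_preimage _ _ _ _ (fun y => cons_pair (x, y))) => //.
  by apply: measurableT_comp; [exact: measurable_cons_pair|exact: measurable_pair1].
have mc : measurable_fun [set: measurableTypeR R]
  (fun x : R => c * x : measurableTypeR R) by apply: measurable_funM.
rewrite lebesgue_tupleS1; last first.
  by apply: measurable_preimage => //; exact: measurable_scale_tuple.
rewrite exprS EFinM -muleA -ge0_integralZl//; last 2 first.
- by apply: measurable_fun_slice; apply: measurable_preimage => //; exact: measurable_scale_tuple.
- by rewrite lee_fin exprn_ge0// ltW.
under eq_integral => x _.
  rewrite (_ : [set y | _] =
    scale_tuple c @^-1` [set y | A (cons_pair (c * x, y))]); last first.
    by apply/seteqP; split => y /=; rewrite scale_tuple_cons.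
  rewrite IH//; over.
rewrite [RHS]lebesgue_tupleS1//.
rewrite -(ge0_integral_pushforwardT leb mc mg)//.
pose m := measure_function_pushforward__canonical__measure_function_Measure leb mc.
rewrite -[X in (X * _)%E]/((NngNum (ltW c0))%:num%:E).
rewrite -[X in (_ * X)%E]/(\int[m]_x lebt n [set y | A (cons_pair (x, y))])%E.
rewrite -(@ge0_integral_mscale _ _ _ m setT)//.
apply: eq_measure_integral => B mB _.
exact: lebesgue_measure_scale.
Qed.

End lebesgue_tuple_invariance.

(** * Hyperbolic functions *)

Section hyperbolic.
Context {R : realType}.
Implicit Types r t a b : R.

Lemma cosh_gt0 r : 0 < cosh r.
Proof. by rewrite divr_gt0// addr_gt0// expR_gt0. Qed.

Lemma cosh2_sinh2 r : cosh r ^+ 2 - sinh r ^+ 2 = 1.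
Proof.
have : expR r * expR (- r) = 1 by rewrite -expRD subrr expR0.
rewrite /cosh /sinh; move: (expR r) (expR (- r)) => x y xy.
by transitivity (x * y); [field|].
Qed.

Definition tanh r := sinh r / cosh r.

Lemma onem_tanh2 r : 1 - tanh r ^+ 2 = (cosh r ^+ 2)^-1.
Proof.
have c0 := lt0r_neq0 (cosh_gt0 r).
rewrite /tanh expr_div_n -[X in X - _](@mulfV _ (cosh r ^+ 2)) ?expf_neq0//.
by rewrite -mulrBl cosh2_sinh2 mul1r.
Qed.

Lemma tanh_lt1 r : tanh r < 1.
Proof.
rewrite ltr_pdivrMr ?cosh_gt0// mul1r /sinh /cosh.
by have := expR_gt0 (- r); lra.
Qed.

Lemma tanh_gtN1 r : -1 < tanh r.
Proof.
rewrite ltr_pdivlMr ?cosh_gt0// mulN1r /sinh /cosh.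
by have := expR_gt0 r; lra.
Qed.

Lemma artanhK t : -1 < t < 1 -> tanh (artanh t) = t.
Proof.
move=> /andP[t1 t2]; rewrite /tanh /sinh /cosh /artanh expRN.
set e := expR _.
have e0 : 0 < e by exact: expR_gt0.
have e2 : e ^+ 2 = (1 + t) / (1 - t).
  rewrite -expRM_natl mulrC -mulr_natr divfK ?pnatr_eq0//.
  by rewrite lnK// posrE divr_gt0//; lra.
have {}e2 : e ^+ 2 * (1 - t) = 1 + t by rewrite e2 divfK//; lra.
have {}e2 : (e ^+ 2 + 1) * t = e ^+ 2 - 1 by lra.
apply: (@mulfI _ (e ^+ 2 + 1)); first by rewrite lt0r_neq0// addr_gt0// exprn_gt0.
rewrite e2; field; rewrite ?lt0r_neq0//.
by rewrite -expr2 addr_gt0// exprn_gt0.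
Qed.

Lemma tanhK r : artanh (tanh r) = r.
Proof.
rewrite /artanh (_ : (1 + _) / _ = expR (r + r)).
  by rewrite expRK; field.
have c0 := lt0r_neq0 (cosh_gt0 r).
have -> : 1 + tanh r = expR r / cosh r.
  by apply: (mulIf c0); rewrite mulrDl !divfK// mul1r /cosh /sinh; field.
have -> : 1 - tanh r = expR (- r) / cosh r.
  by apply: (mulIf c0); rewrite mulrBl !divfK// mul1r /cosh /sinh; field.
have e0 := lt0r_neq0 (expR_gt0 r).
by rewrite expRD expRN; field; rewrite c0 e0.
Qed.

Lemma cosh_artanh t : -1 < t < 1 -> cosh (artanh t) = (Num.sqrt (1 - t ^+ 2))^-1.
Proof.
move=> t1; rewrite -{2}(artanhK t1) onem_tanh2 -exprVn sqrtr_sqr.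
by rewrite ger0_norm ?invrK// invr_ge0 cosh_ge0.
Qed.

Lemma sinhE r : sinh r = tanh r * cosh r.
Proof. by rewrite divfK// lt0r_neq0// cosh_gt0. Qed.

Lemma is_derive_expRN r : is_derive r 1 (fun x => expR (- x)) (- expR (- r)).
Proof.
have dN : is_derive r 1 (-%R : R -> R) (-1) := is_deriveN (is_derive_id r 1).
have := @is_derive1_comp R expR -%R r _ _ (is_derive_expR (- r)) dN.
by rewrite mulrN1.
Qed.

Lemma is_derive_cosh r : is_derive r 1 cosh (sinh r).
Proof.
have -> : cosh = 2^-1 \*: (expR + (fun x => expR (- x))) :> (R -> R).
  by apply/funext => x; rewrite /cosh mulrC.
have dN := is_derive_expRN r.
by apply: is_derive_eq; rewrite /sinh mulrC.
Qed.

Lemma is_derive_sinh r : is_derive r 1 sinh (cosh r).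
Proof.
have -> : sinh = 2^-1 \*: (expR - (fun x => expR (- x))) :> (R -> R).
  by apply/funext => x; rewrite /sinh mulrC.
have dN := is_derive_expRN r.
by apply: is_derive_eq; rewrite /cosh opprK mulrC.
Qed.

Lemma is_derive_tanh r : is_derive r 1 tanh ((cosh r ^+ 2)^-1).
Proof.
have c0 := lt0r_neq0 (cosh_gt0 r).
have ds := is_derive_sinh r; have dc := is_derive_cosh r.
have -> : tanh = sinh * (fun x => (cosh x)^-1) :> (R -> R) by [].
have dV := is_deriveV c0 dc.
apply: is_derive_eq.
rewrite /GRing.scale /=; have := cosh2_sinh2 r => H.
rewrite -[RHS]mul1r -[X in _ = X / _]H; field; exact: c0.
Qed.

Lemma derive1_tanh : (tanh : R -> R)^`()%classic = (fun r => (cosh r ^+ 2)^-1).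
Proof.
by apply/funext => r; rewrite derive1E; have [_ ->] := is_derive_tanh r.
Qed.

Lemma continuous_cosh : continuous (@cosh R).
Proof.
by move=> r; apply/differentiable_continuous/derivable1_diffP;
  have [] := is_derive_cosh r.
Qed.

Lemma continuous_tanh : continuous tanh.
Proof.
by move=> r; apply/differentiable_continuous/derivable1_diffP;
  have [] := is_derive_tanh r.
Qed.

Lemma ltr_artanh t t' : -1 < t -> t < t' -> t' < 1 -> artanh t < artanh t'.
Proof.
move=> t1 tt' t'1; rewrite ltr_pM2r ?invr_gt0// ltr_ln ?posrE ?divr_gt0//; [|lra..].
rewrite ltr_pdivrMr; last lra.
by rewrite mulrAC ltr_pdivlMr; nra.
Qed.

Lemma tanh_mono : {mono tanh : r r' / r < r'}.
Proof.
have h r r' : tanh r < tanh r' -> r < r'.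
  move=> h; rewrite -(tanhK r) -(tanhK r'); apply: ltr_artanh => //.
    exact: tanh_gtN1.
  exact: tanh_lt1.
move=> r r'; apply/idP/idP; first exact: h.
move=> rr'; rewrite ltNge le_eqVlt negb_or; apply/andP; split.
  by apply/eqP => /(congr1 artanh); rewrite !tanhK => /eqP; rewrite gt_eqF.
by apply/negP => /h; rewrite ltNge (ltW rr').
Qed.

End hyperbolic.

(** * The radial measure in the variable tanh r *)

Section radial.
Context {R : realType}.
Implicit Types r t a b : R.
Local Notation leb := (@lebesgue_measure R).

Lemma measurable_artanh : measurable_fun [set: R] (@artanh R).
Proof.
apply: measurable_funM => //; apply: measurableT_comp; first exact: measurable_ln.
apply: measurable_funM; first exact: measurable_funD.
by apply: measurableT_comp; [exact: measurable_invr|exact: measurable_funB].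
Qed.

Lemma measurable_sqrtr : measurable_fun [set: R] (@Num.sqrt R).
Proof. apply: continuous_measurable_fun; exact: sqrt_continuous. Qed.

(** The density of cosh^k r dr in the variable t = tanh r: cosh r is (1 - t^2)^(-1/2), and dr = dt /
    (1 - t^2) accounts for the extra 2 in the exponent. *)
Definition tanh_density k t : \bar R := ((Num.sqrt (1 - t ^+ 2)) ^- k.+2)%:E.

Lemma tanh_density_ge0 k t : (0 <= tanh_density k t)%E.
Proof. by rewrite lee_fin invr_ge0 exprn_ge0// sqrtr_ge0. Qed.

Lemma measurable_tanh_density k :
  measurable_fun [set: measurableTypeR R] (tanh_density k).
Proof.
apply/measurable_EFinP; apply: measurableT_comp; first exact: measurable_invr.
apply: measurable_funX; apply: measurableT_comp; first exact: measurable_sqrtr.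
by apply: measurable_funB => //; exact: measurable_funX.
Qed.

(** Written as a preimage under [artanh], so that measurability is immediate; the interval discards
    the meaningless values of [artanh] outside ]-1, 1[. *)
Definition tanh_image (A : set R) : set R := `]-1, 1[ `&` artanh @^-1` A.

Definition tanh_radial k (A : set (measurableTypeR R)) : \bar R :=
  (\int[leb]_(t in tanh_image A) tanh_density k t)%E.

Section tanh_radial_measure.
Variable k : nat.

Let tanh_radial0 : tanh_radial k set0 = 0%E.
Proof. by rewrite /tanh_radial /tanh_image preimage_set0 setI0 integral_set0. Qed.

Let tanh_radial_ge0 A : (0 <= tanh_radial k A)%E.
Proof. by apply: integral_ge0 => t _; exact: tanh_density_ge0. Qed.

Let tanh_radial_sigma_additive : semi_sigma_additive (tanh_radial k).
Proof.
move=> F mF tF mUF; rewrite /tanh_radial /tanh_image preimage_bigcup setI_bigcupr.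
rewrite ge0_integral_bigcup//=.
- by apply: is_cvg_ereal_nneg_natsum_cond => n _ _; exact: tanh_radial_ge0.
- move=> i; apply: measurableI => //.
  by apply: (@measurable_preimage _ _ (measurableTypeR R) (measurableTypeR R)
    artanh) => //; exact: measurable_artanh.
- by apply: measurable_funTS; exact: measurable_tanh_density.
- by move=> t _; exact: tanh_density_ge0.
- apply/trivIsetP => i j _ _ ij.
  move/trivIsetP : tF => /(_ i j Logic.I Logic.I ij) FF.
  apply/seteqP; split => // t /= [[_ Fi] [_ Fj]].
  suff : (F i `&` F j) (artanh t) by rewrite FF.
  by split.
Qed.

HB.instance Definition _ := isMeasure.Build _ _ _ (tanh_radial k)
  tanh_radial0 tanh_radial_ge0 tanh_radial_sigma_additive.

End tanh_radial_measure.

Lemma radial_measure_itv k a b : a < b ->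
  radial_measure k `[a, b]%classic =
  (\int[leb]_(t in `[tanh a, tanh b]) tanh_density k t)%E.
Proof.
move=> ab; rewrite /radial_measure.
pose G t : R := Num.sqrt (1 - t ^+ 2) ^- k.+2.
rewrite (_ : (fun t => tanh_density k t) = (fun t => (G t)%:E))//.
have cdt : continuous (fun r => (cosh r ^+ 2)^-1).
  move=> r; apply: cvgV; first by rewrite expf_neq0// lt0r_neq0// cosh_gt0.
  apply: (@cvg_comp _ _ _ cosh (fun x => x ^+ 2)); first exact: continuous_cosh.
  exact: exprn_continuous.
rewrite (@integration_by_substitution_increasing R tanh G a b (ltW ab)).
- apply: eq_integral => r _; rewrite /= derive1_tanh /G fctE/= onem_tanh2.
  have c0 := cosh_gt0 r.
  rewrite -[cosh r ^- 2]exprVn sqrtr_sqr ger0_norm ?invr_ge0 ?ltW// !exprVn invrK.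
  by rewrite -addn2 exprD mulfK// expf_neq0// lt0r_neq0.
- by move=> x y _ _ xy; rewrite tanh_mono.
- by move=> x _; rewrite derive1_tanh; exact: cdt.
- by rewrite derive1_tanh; apply/cvg_ex; exists ((cosh a ^+ 2)^-1);
    apply: cvg_at_right_filter; exact: cdt.
- by rewrite derive1_tanh; apply/cvg_ex; exists ((cosh b ^+ 2)^-1);
    apply: cvg_at_left_filter; exact: cdt.
- split.
  + by move=> x _; have [] := is_derive_tanh x.
  + by apply: cvg_at_right_filter; exact: continuous_tanh.
  + by apply: cvg_at_left_filter; exact: continuous_tanh.
- apply/continuous_in_subspaceT => t /[!inE] /=; rewrite in_itv /= => /andP[t1 t2].
  have t20 : 0 < 1 - t ^+ 2.
    have := tanh_gtN1 a; have := tanh_lt1 b; nra.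
  rewrite /G; apply: cvgV; first by rewrite expf_neq0// lt0r_neq0// sqrtr_gt0.
  apply: (cvg_comp (fun x => Num.sqrt (1 - x ^+ 2)) (fun x => x ^+ k.+2)); last first.
    exact: exprn_continuous.
  apply: (cvg_comp (fun x => 1 - x ^+ 2) Num.sqrt); last exact: sqrt_continuous.
  by apply: cvgB; [exact: cvg_cst|exact: exprn_continuous].
Qed.

(** The substitution t = tanh r is available on compact intervals. Both sides are measures, so
    agreement on half-open intervals, with finite mass on an exhausting sequence of them, extends it
    to every measurable set. *)
Lemma radial_measureE k A : measurable A -> radial_measure k A = tanh_radial k A.
Proof.
move=> mA.
have [g gE] : exists g : nat -> set (measurableTypeR R),
    forall i, g i = `] - i%:R, i%:R]%classic by exists (fun i : nat => `] - i%:R, i%:R]%classic).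
have oc a b : a < b -> radial_measure k `]a, b]%classic = radial_measure k `[a, b]%classic.
  move=> ab; rewrite /radial_measure integral_itv_obnd_cbnd//.
  by apply: measurable_funTS; apply/measurable_EFinP; apply: measurable_funX; exact: measurable_cosh.
apply: (@measure_unique _ R (measurableTypeR R) (@ocitv R) g _ _ _ _ (radial_measure k) (tanh_radial k)) => //.
- move=> X Y; exact: measurableI.
- by move=> i; rewrite gE; exact: is_ocitv.
- apply/seteqP; split => // r _.
  exists (Num.bound `|r|).+1 => //=; rewrite gE /= in_itv /=.
  have /archi_boundP : 0 <= `|r| by [].
  rewrite -addn1 natrD; have := ler_norm r; have := ler_norm (- r); rewrite normrN; lra.
- move=> _ [[a b]] _ <- /=.
  have [ba|ab] := leP b a.
    rewrite set_itv_ge -?leNgt ?bnd_simp//.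
    by rewrite !measure0.
  rewrite oc// radial_measure_itv// -integral_itv_obnd_cbnd; last first.
    by apply: measurable_funTS; exact: measurable_tanh_density.
  rewrite /tanh_radial /tanh_image; congr (integral _ _ _).
  apply/seteqP; split => t /=; rewrite !in_itv /=.
    move=> /andP[at_ tb]; have := tanh_gtN1 a; have := tanh_lt1 b => b1 a1.
    have t1 : -1 < t < 1 by apply/andP; split; lra.
    rewrite t1; split => //.
    by rewrite -tanh_mono leNgt -(tanh_mono b) -leNgt artanhK// at_ tb.
  by move=> [t1]; rewrite -tanh_mono leNgt -(tanh_mono b) -leNgt artanhK.
- move=> i; rewrite gE.
  have [->|i0] := eqVneq i 0%N.
    by rewrite set_itv_ge -?leNgt ?bnd_simp ?oppr0// measure0.
  rewrite -[X in (X < _)%E]/(radial_measure k `]- i%:R, i%:R]%classic).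
  rewrite oc; last by rewrite -subr_gt0 opprK addr_gt0// ltr0n lt0n.
  apply: (@le_lt_trans _ _ (\int[leb]_(r in `[(- i%:R)%R, i%:R%R]%classic)
      (expR i%:R%R ^+ k)%:E)%E).
    apply: ge0_le_integral => //=.
    + by move=> r _; rewrite lee_fin exprn_ge0// cosh_ge0.
    + apply: measurable_funTS; apply/measurable_EFinP; apply: measurable_funX; exact: measurable_cosh.
    + move=> r; rewrite in_itv/= => /andP[ir ri].
      rewrite lee_fin lerXn2r ?nnegrE ?cosh_ge0 ?expR_ge0//.
      rewrite ler_pdivrMr// mulr_natr mulr2n lerD// ler_expR//.
      by rewrite lerNl.
  rewrite integral_cst//= lebesgue_measure_itv/=; case: ifPn => _.
    by rewrite -EFinB -EFinM ltry.
  by rewrite mule0 ltry.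
Qed.

End radial.

(** * Cones *)

Section cones.
Context {R : realType}.
Implicit Types c : R.
Local Notation leb := (@lebesgue_measure R).
Local Notation lebt := (@lebesgue_tuple R).

Lemma enorm_ge0 n (y : n.-tuple R) : 0 <= enorm y.
Proof. exact: sqrtr_ge0. Qed.

Lemma sqr_enorm n (y : n.-tuple R) : enorm y ^+ 2 = \sum_(i < n) tnth y i ^+ 2.
Proof. by rewrite sqr_sqrtr// sumr_ge0// => i _; rewrite sqr_ge0. Qed.

Lemma enorm_scale n c (y : n.-tuple R) : enorm (scale_tuple c y) = `|c| * enorm y.
Proof.
rewrite /enorm; under eq_bigr do rewrite tnth_scale_tuple exprMn.
by rewrite -mulr_sumr sqrtrM ?sqr_ge0// sqrtr_sqr.
Qed.

Lemma normalize_scale n c (y : n.-tuple R) : 0 < c ->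
  normalize (scale_tuple c y) = normalize y.
Proof.
move=> c0; apply: eq_from_tnth => i.
rewrite !tnth_scale_tuple enorm_scale gtr0_norm// invfM mulrACA mulrA.
by rewrite mulVf ?mul1r ?mulrA ?lt0r_neq0// mulrAC.
Qed.

Definition cone n (E : set (n.-tuple R)) (c : R) : set (n.-tuple R) :=
  [set y | 0 < enorm y <= c /\ E (normalize y)].

Lemma cone_le0 n (E : set (n.-tuple R)) c : c <= 0 -> cone E c = set0.
Proof.
move=> c0; apply/seteqP; split => y //= -[/andP[y0 yc] _].
by have := lt_le_trans y0 (le_trans yc c0); rewrite ltxx.
Qed.

Lemma measurable_cone n (E : set (n.-tuple R)) c :
  measurable E -> measurable (cone E c).
Proof.
move=> mE.
rewrite (_ : cone E c = (@enorm R n @^-1` `]0, c]) `&` (@normalize R n @^-1` E)).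
  apply: measurableI; first by apply: measurable_preimage => //; exact: measurable_enorm.
  by apply: measurable_preimage => //; exact: measurable_normalize.
by apply/seteqP; split => y /=; rewrite in_itv /=.
Qed.

Lemma sphere_measureE n (E : set (n.-tuple R)) :
  sphere_measure E = (n%:R%:E * lebt n (cone E 1))%E.
Proof.
by congr (_ * lebt n _)%E; apply/seteqP; split => y [].
Qed.

Lemma lebesgue_cone n (E : set (n.-tuple R)) c : (0 < n)%N -> 0 <= c ->
  measurable E -> lebt n (cone E c) = ((c ^+ n)%:E * lebt n (cone E 1))%E.
Proof.
move=> n0; rewrite le_eqVlt => /predU1P[<- _|c0 mE].
  by rewrite expr0n gtn_eqF//= mul0e cone_le0 ?measure0.
rewrite -(lebesgue_tuple_scale c0); last exact: measurable_cone.
congr (_ * lebt n _)%E; apply/seteqP; split => y /=.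
  rewrite /cone /= enorm_scale gtr0_norm// normalize_scale// pmulr_rgt0//.
  by rewrite ger_pMr.
by rewrite /cone /= enorm_scale gtr0_norm// normalize_scale// pmulr_rgt0// ger_pMr.
Qed.

Lemma measurable_cube n c : measurable [set y : n.-tuple R | forall i, `|tnth y i| <= c].
Proof.
rewrite (_ : [set _ | _] = \bigcap_(i in [set` index_enum 'I_n])
    ((@tnth n R)^~ i @^-1` `[- c, c])).
  rewrite bigcap_seq; apply: bigsetI_measurable => i _.
  by apply: measurable_preimage => //; exact: measurable_tnth.
apply/seteqP; split => y /= H i; first by move=> _; rewrite /= in_itv /= -ler_norml.
by have := H i (mem_index_enum i); rewrite /= in_itv /= -ler_norml.
Qed.

Lemma lebesgue_cube n c : 0 <= c ->
  lebt n [set y | forall i, `|tnth y i| <= c] = ((c *+ 2) ^+ n)%:E.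
Proof.
move=> c0; elim: n => [|n IH].
  rewrite expr0 /= diracE mem_set//= => -[]//.
have mcube := @measurable_cube n c.
rewrite lebesgue_tupleS.
rewrite (_ : _ @^-1` _ = `[- c, c] `*` [set y | forall i, `|tnth y i| <= c]); last first.
  apply/seteqP; split => -[x y] /=.
    move=> H; split => [|i]; first by rewrite in_itv /= -ler_norml; exact: H ord0.
    by have := H (lift ord0 i); rewrite tnth_cons_pairS.
  rewrite in_itv /= -ler_norml => -[xc H] i.
  by case: (unliftP ord0 i) => [j|] ->//; rewrite tnth_cons_pairS.
transitivity (leb `[(- c)%R, c]%classic * lebt n [set y | forall i, (`|tnth y i| <= c)%R])%E.
  by apply: product_measure1E => //; exact: measurable_itv.
rewrite [X in (_ * X)%E]IH lebesgue_measure_itv /= lte_fin.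
case: ifPn => [_|]; first by rewrite -EFinB -EFinM exprS opprK mulr2n.
rewrite -leNgt => cN; have -> : c = 0 by lra.
by rewrite mul0e mul0rn expr0n.
Qed.

Lemma lebesgue_cone_lty n (E : set (n.-tuple R)) c : measurable E ->
  (lebt n (cone E c) < +oo)%E.
Proof.
move=> mE; have [c0|c0] := ltP c 0.
  by rewrite cone_le0 ?measure0// ltW.
apply: (@le_lt_trans _ _ (lebt n [set y | forall i, `|tnth y i| <= c])); last first.
  by rewrite lebesgue_cube// ltry.
apply: le_measure; rewrite ?inE; [exact: measurable_cone|exact: measurable_cube|].
move=> y /= -[/andP[_ yc] _] i.
apply: le_trans yc; rewrite -sqrtr_sqr ler_wsqrtr// (bigD1 i)//= lerDl.
by rewrite sumr_ge0// => j _; rewrite sqr_ge0.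
Qed.

End cones.

Lemma tonelli_slices d1 d2 (X : measurableType d1) (Y : measurableType d2)
    (R : realType) (m1 : {sigma_finite_measure set X -> \bar R})
    (m2 : {sigma_finite_measure set Y -> \bar R}) (S : set (X * Y)) :
  measurable S ->
  (\int[m1]_x m2 [set y | S (x, y)] = \int[m2]_y m1 [set x | S (x, y)])%E.
Proof.
move=> mS.
transitivity ((m1 \x m2)%E S).
  apply: eq_integral => x _; congr (m2 _).
  by apply/seteqP; split => y; rewrite /xsection/= inE.
transitivity ((m1 \x^ m2)%E S).
  by apply: product_measure_unique => // *; exact: product_measure2E.
apply: eq_integral => y _; congr (m1 _).
by apply/seteqP; split => x; rewrite /ysection/= inE.
Qed.

(** * The integral of the norm over a cone *)

Section cone_integral.
Context {R : realType}.
Implicit Types a b c : R.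
Local Notation leb := (@lebesgue_measure R).
Local Notation lebt := (@lebesgue_tuple R).

Lemma integral_exprn k a b : a <= b ->
  (\int[leb]_(x in `[a, b]) (x ^+ k)%:E = ((b ^+ k.+1 - a ^+ k.+1) / k.+1%:R)%:E)%E.
Proof.
rewrite le_eqVlt => /predU1P[->|ab].
  by rewrite set_itv1 integral_set1 subrr mul0r.
pose F (x : R) := k.+1%:R^-1 * x ^+ k.+1.
have dF (x : R) : is_derive x 1 F (x ^+ k).
  have -> : F = k.+1%:R^-1 \*: ((id : R -> R) ^+ k.+1).
    by apply/funext => y; rewrite /F /= exprfctE.
  apply: is_derive_eq; rewrite /GRing.scale /= mulr1.
  by rewrite mulrA mulVf ?mul1r// pnatr_eq0.
have cF : continuous F.
  by move=> x; apply/differentiable_continuous/derivable1_diffP; have [] := dF x.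
rewrite (@continuous_FTC2 R (fun x => x ^+ k) F a b ab).
- by rewrite -EFinB /F -mulrBr mulrC.
- by apply: continuous_subspaceT => x; exact: exprn_continuous.
- split.
  + by move=> x _; have [] := dF x.
  + exact/cvg_at_right_filter/cF.
  + exact/cvg_at_left_filter/cF.
- by move=> x _; rewrite derive1E; have [_ ->] := dF x.
Qed.

(** Layer cake: the part of the cone with norm above s has volume (c^n - s^n) v, where v is the
    volume of the unit cone, and integrating over 0 <= s <= c gives c^(n+1) n / (n + 1) v. *)
Lemma integral_enorm_cone n (E : set (n.-tuple R)) c :
  (0 < n)%N -> 0 <= c -> measurable E ->
  (\int[lebt n]_(y in cone E c) (enorm y)%:E =
   (c ^+ n.+1 * (n%:R / n.+1%:R))%:E * lebt n (cone E 1))%E.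
Proof.
move=> n0 c0 mE.
pose S : set (measurableTypeR R * n.-tuple R) :=
  [set p | cone E c p.2 /\ (0 <= p.1 < enorm p.2)].
have mS : measurable S.
  rewrite (_ : S = (snd @^-1` cone E c) `&`
     ((fst @^-1` [set` `[0, +oo[]) `&` ((fun p => enorm p.2 - p.1) @^-1` [set` `]0, +oo[]))).
    apply: measurableI.
      by apply: measurable_preimage => //; exact: measurable_cone.
    apply: measurableI.
      by apply: measurable_preimage => //; exact: measurable_itv.
    apply: (@measurable_preimage _ _ _ (measurableTypeR R)
      (fun p : measurableTypeR R * n.-tuple R => enorm p.2 - p.1 : measurableTypeR R));
      last exact: measurable_itv.
    apply: measurable_funB => //.
    by apply: measurableT_comp; [exact: measurable_enorm|exact: measurable_snd].
  apply/seteqP; split => -[s y] /=; rewrite !in_itv /= !andbT subr_gt0.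
    by move=> [? /andP[]].
  by rewrite /S /= => -[? [-> ->]].
have vfin : lebt n (cone E 1) \is a fin_num.
  by rewrite ge0_fin_numE ?lebesgue_cone_lty.
pose v := fine (lebt n (cone E 1)).
have vE : lebt n (cone E 1) = v%:E by rewrite /v fineK.
have /= := @tonelli_slices _ _ (measurableTypeR R) _ _ leb (lebt n) S mS.
rewrite (_ : (\int[_]_x _)%E = (\int[leb]_(s in `[0%R, c]) ((c ^+ n - s ^+ n) * v)%:E)%E); last first.
  rewrite [RHS]integral_mkcond/=; apply: eq_integral => s _.
  rewrite patchE; case: ifPn => [|].
    rewrite inE /= in_itv /= => /andP[s0 sc].
    rewrite (_ : [set y | _] = cone E c `\` cone E s); last first.
      apply/seteqP; split => y; rewrite /S /cone /= s0 /=.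
        by move=> [H sy]; split => // -[/andP[_]]; rewrite leNgt sy.
      move=> [[/andP[y0 yc] Ey] ys]; rewrite y0 yc; split => //.
      by rewrite ltNge; apply/negP => ys'; apply: ys; rewrite y0.
    rewrite measureD; [|exact: measurable_cone..|exact: lebesgue_cone_lty].
    rewrite (_ : _ `&` _ = cone E s); last first.
      apply/seteqP; split => y; first by case.
      by rewrite /cone /= => -[/andP[y0 ys] Ey]; rewrite y0 ys (le_trans ys sc).
    rewrite -[LHS]/(lebt n (cone E c) - lebt n (cone E s))%E.
    rewrite (lebesgue_cone n0 c0 mE) (lebesgue_cone n0 s0 mE) vE.
    by rewrite -!EFinM -EFinB mulrBl.
  rewrite notin_setE /= in_itv /= => /negP sc.
  rewrite (_ : [set y | _] = set0) ?measure0//.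
  apply/seteqP; split => y //; rewrite /S /cone /= => -[[/andP[_ yc] _] /andP[s0 sy]].
  by move: sc; rewrite s0 (le_trans (ltW sy) yc).
move=> H.
transitivity (\int[lebt n]_y leb [set x | S (x, y)])%E.
  rewrite integral_mkcond/=; apply: eq_integral => y _.
  rewrite patchE; case: ifPn => [|].
    rewrite inE => yE.
    rewrite (_ : [set x | _] = [set` `[0, enorm y[]); last first.
      apply/seteqP; split => s; rewrite /S /= in_itv /=; first by case.
      by [].
    rewrite -[RHS]/(leb [set` `[0, enorm y[]) lebesgue_measure_itv /= lte_fin.
    case: ifPn; first by rewrite sube0.
    by rewrite -leNgt => y0; have := enorm_ge0 y => y1; congr EFin; lra.
  rewrite notin_setE /= => yE.
  rewrite (_ : [set x | _] = set0) ?measure0//.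
  by apply/seteqP; split => s //= -[].
rewrite -H.
under eq_integral do rewrite EFinM.
have ms : measurable_fun `[0%R, c] (fun s : R => (s ^+ n)%:E).
  by apply/measurable_funTS/measurable_EFinP; exact: measurable_funX.
have v0 : 0 <= v by rewrite fine_ge0.
rewrite ge0_integralZr//; last 2 first.
- by apply/measurable_funTS/measurable_EFinP; apply: measurable_funB.
- move=> s; rewrite /= in_itv /= => /andP[s0 sc]; rewrite lee_fin subr_ge0.
  by rewrite lerXn2r// nnegrE.
rewrite vE; congr (_ * _)%E.
have is_ : leb.-integrable `[0%R, c] (fun s : R => (s ^+ n)%:E).
  apply/integrableP; split => //.
  under eq_integral => s /[!inE] /= /[!in_itv] /= /andP[s0 sc].
    rewrite ger0_norm ?exprn_ge0//; over.
  by rewrite integral_exprn// ltry.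
under eq_integral do rewrite EFinB.
rewrite integralB//; last first.
  apply/integrableP; split => //; rewrite integral_cst//= lebesgue_measure_itv /=.
  by case: ifP => _; rewrite -?EFinB -?EFinM ?mule0 ltry.
rewrite integral_exprn// integral_cst//= lebesgue_measure_itv /= lte_fin.
rewrite expr0n /= subr0.
case: ifPn => [_|]; last first.
  rewrite -leNgt => c1; have c00 : c = 0 by apply/eqP; rewrite eq_le c1 c0.
  rewrite c00 mule0 add0e exprS !mul0r.
  by rewrite oppr0.
rewrite oppr0 adde0.
transitivity ((c ^+ n * c - c ^+ n.+1 / n.+1%:R)%:E); first by rewrite EFinB EFinM.
rewrite -exprSr; congr EFin.
by rewrite -[in RHS](natr1 n); field; rewrite natr1 pnatr_eq0.
Qed.

End cone_integral.

(** * The measure on de Sitter space *)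

Section dS_cone.
Context {R : realType}.
Local Notation leb := (@lebesgue_measure R).
Local Notation lebt := (@lebesgue_tuple R).

Lemma minkowski_cons n x (y : n.-tuple R) x' y' :
  minkowski (cons_pair (x, y)) (cons_pair (x', y')) =
  - (x * x') + \sum_(i < n) tnth y i * tnth y' i.
Proof.
rewrite /minkowski !tnth_cons_pair0; congr (_ + _).
by apply: eq_bigr => i _; rewrite !tnth_cons_pairS.
Qed.

Lemma minkowski_cons_sqr n x (y : n.-tuple R) :
  minkowski (cons_pair (x, y)) (cons_pair (x, y)) = enorm y ^+ 2 - x ^+ 2.
Proof. by rewrite minkowski_cons sqr_enorm addrC expr2. Qed.

Lemma measurable_minkowski n d (T : measurableType d) (f g : T -> n.+1.-tuple R) :
  measurable_fun [set: T] f -> measurable_fun [set: T] g ->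
  measurable_fun [set: T] (fun p => minkowski (f p) (g p)).
Proof.
move=> mf mg.
have mt i (h : T -> n.+1.-tuple R) : measurable_fun [set: T] h ->
    measurable_fun [set: T] (fun p => tnth (h p) i).
  by move=> mh; exact: (measurableT_comp (measurable_tnth i)).
apply: measurable_funD.
  by apply: measurableT_comp => //; apply: measurable_funM; exact: mt.
by apply: measurable_sum => i; apply: measurable_funM; exact: mt.
Qed.

Definition spacelike n : set (n.+1.-tuple R) := [set w | 0 < minkowski w w <= 1].

Lemma measurable_spacelike n : measurable (@spacelike n).
Proof.
rewrite (_ : @spacelike n = (fun w => minkowski w w) @^-1` `]0, 1]).
  by apply: measurable_preimage => //; exact: measurable_minkowski.
by apply/seteqP; split => w; rewrite /= in_itv.
Qed.

(** The inverse of [dS_param], extended to spacelike vectors by being constant along rays: for w =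
    (x, y) the quotient x / |y| is tanh r. *)
Definition dS_coord n (w : n.+1.-tuple R) : measurableTypeR R * n.-tuple R :=
  let p := uncons w in (artanh (p.1 / enorm p.2), normalize p.2).

Lemma measurable_dS_coord n : measurable_fun [set: _] (@dS_coord n).
Proof.
have m1 : measurable_fun [set: n.+1.-tuple R] (fun w => (uncons w).1).
  exact: measurableT_comp (@measurable_uncons R n).
have m2 : measurable_fun [set: n.+1.-tuple R] (fun w => (uncons w).2).
  exact: measurableT_comp (@measurable_uncons R n).
apply/measurable_fun_pairP; split; last first.
  by apply: measurableT_comp m2; exact: measurable_normalize.
apply: (@measurableT_comp _ _ _ _ _ _ (@artanh R)); first exact: measurable_artanh.
apply: measurable_funM => //; apply: measurableT_comp; first exact: measurable_invr.
by apply: measurableT_comp m2; exact: measurable_enorm.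
Qed.

Arguments dS_coord : simpl never.
Arguments cons_pair : simpl never.

Lemma uncons_cons n x (y : n.-tuple R) : uncons (cons_pair (x, y)) = (x, y).
Proof. by rewrite /uncons; congr (_, _); exact: val_inj. Qed.

Lemma dS_coord_cons n x (y : n.-tuple R) :
  dS_coord (cons_pair (x, y)) = (artanh (x / enorm y), normalize y).
Proof. by rewrite /dS_coord uncons_cons. Qed.

Lemma le_invsqrt (a e : R) : 0 < a -> 0 <= e ->
  (e <= (Num.sqrt a)^-1) = (e ^+ 2 * a <= 1).
Proof.
move=> a0 e0; have s0 : 0 < Num.sqrt a by rewrite sqrtr_gt0.
rewrite -[X in e <= X]mul1r ler_pdivlMr// -(@ler_pXn2r _ 2 isT) ?nnegrE ?mulr_ge0 ?(ltW s0)//.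
by rewrite expr1n exprMn sqr_sqrtr// ltW.
Qed.

Lemma dS_coord_slice n (A : set R) (E : set (n.-tuple R)) x y :
  (@dS_coord n @^-1` (A `*` E) `&` @spacelike n) (cons_pair (x, y)) <->
  [/\ A (artanh (x / enorm y)), E (normalize y) & 0 < enorm y ^+ 2 - x ^+ 2 <= 1].
Proof.
rewrite /setI /preimage /mkset dS_coord_cons /spacelike /mkset minkowski_cons_sqr.
by split => [[[]]|[]].
Qed.

Lemma dS_param_coord n (w : n.+1.-tuple R) : 0 < minkowski w w ->
  dS_param (dS_coord w) = scale_tuple (Num.sqrt (minkowski w w))^-1 w.
Proof.
move: w; apply: cons_pairP => x y; rewrite minkowski_cons_sqr => q0.
rewrite dS_coord_cons.
have y0 : 0 < enorm y.
  rewrite lt_neqAle enorm_ge0 andbT eq_sym; apply/eqP => y0.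
  by move: q0; rewrite y0; nra.
set t := x / enorm y.
have xE : x = enorm y * t by rewrite mulrC divfK// lt0r_neq0.
have t1 : -1 < t < 1.
  have t2 : 0 < 1 - t ^+ 2.
    move: q0; rewrite xE exprMn -[X in X - _]mulr1 -mulrBr.
    by rewrite pmulr_rgt0// exprn_gt0.
  by apply/andP; split; nra.
have qE : Num.sqrt (enorm y ^+ 2 - x ^+ 2) = enorm y * Num.sqrt (1 - t ^+ 2).
  rewrite xE exprMn -[X in X - _]mulr1 -mulrBr sqrtrM ?sqr_ge0//.
  by rewrite sqrtr_sqr ger0_norm// enorm_ge0.
rewrite scale_tuple_cons qE; apply: val_inj => /=.
rewrite -/t sinhE artanhK// cosh_artanh//; congr cons.
  by rewrite [in RHS]xE invfM mulrACA mulVf ?mul1r ?lt0r_neq0// mulrC.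
rewrite -map_comp; apply: eq_map => u /=.
by rewrite invfM mulrA [X in X * _]mulrC.
Qed.

Section uniqueness.
Variable n : nat.

Definition coord_measure (B : set (measurableTypeR R * n.-tuple R)) : \bar R :=
  (n.+1%:R%:E * lebt n.+1 (@dS_coord n @^-1` B `&` @spacelike n))%E.

HB.instance Definition _ := Measure.copy coord_measure
  (mscale (n.+1%:R%:nng : {nonneg R})
    (measure_function_pushforward__canonical__measure_function_Measure
      (mrestr (lebt n.+1) (@measurable_spacelike n)) (@measurable_dS_coord n))).

(** Put x = |y| t. The condition 0 < |y|^2 - x^2 <= 1 says that y lies in the cone of radius (1 -
    t^2)^(-1/2), and the Jacobian is |y|. Integrating |y| over that cone gives (1 - t^2)^(-(n+1)/2),
    which is exactly [tanh_density n.-1], and the factor n / (n + 1) turns the normalization n + 1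
    into that of the sphere. *)
Lemma coord_measureX (A : set (measurableTypeR R)) (E : set (n.-tuple R)) :
  (0 < n)%N -> measurable A -> measurable E ->
  coord_measure (A `*` E) = (radial_measure n.-1 A * sphere_measure E)%E.
Proof.
move=> n0 mA mE; rewrite /coord_measure radial_measureE// sphere_measureE.
have mT : measurable (tanh_image A).
  apply: measurableI => //.
  by apply: (@measurable_preimage _ _ (measurableTypeR R) (measurableTypeR R)
    artanh) => //; exact: measurable_artanh.
pose S : set (measurableTypeR R * n.-tuple R) :=
  [set p | tanh_image A p.1 /\ cone E (Num.sqrt (1 - p.1 ^+ 2))^-1 p.2].
have sq0 (t : R) : tanh_image A t -> 0 < Num.sqrt (1 - t ^+ 2).
  by move=> [/=]; rewrite in_itv /= sqrtr_gt0 => /andP[]; nra.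
have mS : measurable S.
  rewrite (_ : S = (fst @^-1` tanh_image A) `&`
      ((fun p => normalize p.2) @^-1` E `&` ((fun p => enorm p.2) @^-1` [set` `]0, +oo[]
       `&` (fun p => Num.sqrt (1 - p.1 ^+ 2) * enorm p.2) @^-1` [set` `]-oo, 1]]))).
    have me : measurable_fun [set: measurableTypeR R * n.-tuple R] (fun p => enorm p.2).
      by apply: measurableT_comp; [exact: measurable_enorm|exact: measurable_snd].
    apply: measurableI; first exact: measurable_preimage.
    apply: measurableI.
      apply: measurable_preimage => //.
      by apply: measurableT_comp; [exact: measurable_normalize|exact: measurable_snd].
    apply: measurableI; first by apply: measurable_preimage => //; exact: measurable_itv.
    apply: (@measurable_preimage _ _ _ (measurableTypeR R)); last exact: measurable_itv.
    apply: measurable_funM => //.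
    apply: measurableT_comp; first exact: measurable_sqrtr.
    by apply: measurable_funB => //; apply: measurable_funX; exact: measurable_fst.
  apply/seteqP; split => -[t y] /=; rewrite /S /cone /= !in_itv /= andbT.
    move=> [tA [/andP[y0 ys] Ey]]; split => //; split => //; split => //.
    by rewrite -ler_pdivlMl ?sq0// mulr1.
  move=> [tA [Ey [y0 ys]]]; split => //; split => //; rewrite y0.
  by rewrite -[leRHS]mulr1 ler_pdivlMl ?sq0.
have S2 := lebesgue_tupleS2 (measurableI _ _ (measurable_preimage (@measurable_dS_coord n) (measurableX mA mE)) (@measurable_spacelike n)).
rewrite S2.
pose f p : \bar R := ((\1_S p * enorm p.2)%:E).
transitivity (n.+1%:R%:E * \int[lebt n]_y \int[leb]_t f (t, y))%E.
  congr (_ * _)%E; apply: eq_integral => y _.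
  have [y0|y0] := eqVneq (enorm y) 0.
    rewrite (_ : [set x | _] = set0).
      by rewrite measure0 integral0_eq// => t _; rewrite /f y0 mulr0.
    apply/seteqP; split => // x /= -[_]; rewrite /spacelike /= minkowski_cons_sqr y0.
    by move=> /andP[]; nra.
  have {}y0 : 0 < enorm y by rewrite lt_neqAle enorm_ge0 andbT eq_sym.
  (* The substitution x = |y| t on the line over a fixed y; the Jacobian is the factor [enorm] in
     [f]. *)
  rewrite -[LHS](lebesgue_measure_scale y0); last first.
    apply: (@measurable_preimage _ _ (measurableTypeR R) _
      (fun x => cons_pair (x, y))); last first.
      apply: measurableI; last exact: measurable_spacelike.
      by apply: measurable_preimage; [exact: measurable_dS_coord|exact: measurableX].
    by apply: measurableT_comp; [exact: measurable_cons_pair|exact: measurable_pair2].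
  have mSy : measurable [set t | S (t, y)].
    apply: (@measurable_preimage _ _ (measurableTypeR R) _ (fun t => (t, y))) => //.
  transitivity ((enorm y)%:E * leb [set t | S (t, y)])%E.
    have nt t : enorm y * t / enorm y = t by rewrite mulrAC mulfV ?mul1r// lt0r_neq0.
    congr (_ * leb _)%E; apply/seteqP; split => t.
      move=> /dS_coord_slice; rewrite nt exprMn => -[At Ey /andP[q0 q1]].
      have t2 : 0 < 1 - t ^+ 2.
        by move: q0; rewrite -[X in X - _]mulr1 -mulrBr pmulr_rgt0// exprn_gt0.
      have t1 : -1 < t < 1 by apply/andP; split; nra.
      split; first by split => //; rewrite /= in_itv.
      split => //=; rewrite y0 /=.
      by rewrite le_invsqrt ?enorm_ge0// mulrBr mulr1.
    move=> [[/=]]; rewrite in_itv /= => /andP[t1 t1'] At [/= /andP[_ yt] Ey].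
    have t2 : 0 < 1 - t ^+ 2 by nra.
    apply/dS_coord_slice; rewrite nt exprMn.
    split => //; rewrite -[X in 0 < X - _]mulr1 -mulrBr mulr_gt0 ?exprn_gt0//=.
    by move: yt; rewrite le_invsqrt ?enorm_ge0// mulrBr mulr1.
  transitivity (\int[leb]_t ((\1_[set t | S (t, y)] t)%:E * (enorm y)%:E))%E.
    rewrite ge0_integralZr//; first by rewrite integral_indic// setIT muleC.
      by apply/measurable_EFinP.
    by rewrite lee_fin ltW.
  apply: eq_integral => t _; rewrite /f EFinM !indicE.
  by congr ((_ : bool)%:R%:E * _)%E; apply/idP/idP; rewrite !inE.
have mf : measurable_fun [set: measurableTypeR R * n.-tuple R] f.
  apply/measurable_EFinP; apply: measurable_funM => //.
  by apply: measurableT_comp; [exact: measurable_enorm|exact: measurable_snd].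
have f0 p : (0 <= f p)%E by rewrite lee_fin mulr_ge0// enorm_ge0.
rewrite -[X in (_ * X)%E](@fubini_tonelli _ _ (measurableTypeR R) _ _ leb (lebt n))//.
rewrite /fubini_F.
transitivity (n.+1%:R%:E * \int[leb]_(t in tanh_image A)
   (tanh_density n.-1 t * ((n%:R / n.+1%:R)%:E * lebt n (cone E 1))))%E.
  congr (_ * _)%E; rewrite [RHS]integral_mkcond/=; apply: eq_integral => t _.
  rewrite patchE; case: ifPn => [|]; last first.
    rewrite notin_setE => tA; apply: integral0_eq => y _.
    by rewrite /f indicE memNset ?mul0r// => -[].
  rewrite inE => tA.
  transitivity (\int[lebt n]_(y in cone E (Num.sqrt (1 - t ^+ 2))^-1) (enorm y)%:E)%E.
    rewrite [RHS]integral_mkcond/=; apply: eq_integral => y _.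
    rewrite patchE /f indicE; case: ifPn => [|].
      by rewrite inE => yE; rewrite mem_set ?mul1r.
    by rewrite notin_setE => yE; rewrite memNset ?mul0r// => -[].
  rewrite integral_enorm_cone//.
  by rewrite /tanh_density prednK// exprVn EFinM muleA.
rewrite ge0_integralZr//; last 3 first.
- by apply: measurable_funTS; exact: measurable_tanh_density.
- by move=> t _; exact: tanh_density_ge0.
- by rewrite mule_ge0// lee_fin divr_ge0.
rewrite /tanh_radial muleCA; congr (_ * _)%E.
by rewrite muleA -EFinM mulrC divfK// pnatr_eq0.
Qed.

End uniqueness.

Lemma sphere_measure_lty n (E : set (n.-tuple R)) : measurable E ->
  (sphere_measure E < +oo)%E.
Proof.
move=> mE; rewrite sphere_measureE; have := lebesgue_cone_lty 1 mE.
rewrite -ge0_fin_numE// => /fineK <-.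
by rewrite -EFinM ltry.
Qed.

End dS_cone.

Section dS_borel_measure.
Context {R : realType}.
Local Notation lebt := (@lebesgue_tuple R).

Let sphere_measure_fin n : fin_num_fun (@sphere_measure R n).
Proof. by move=> E mE; rewrite ge0_fin_numE ?sphere_measure_lty. Qed.

HB.instance Definition _ n :=
  @Measure_isFinite.Build _ _ _ (@sphere_measure R n) (@sphere_measure_fin n).

Definition dS_cone n (A : set (n.+1.-tuple R)) : set (n.+1.-tuple R) :=
  [set w | spacelike w /\ A (scale_tuple (Num.sqrt (minkowski w w))^-1 w)].

(** In the coordinates (r, w) both sides are measures that agree on rectangles, and the product
    measure is unique. The right-hand side mentions only Lebesgue measure and the Minkowski form, so
    its symmetries are visible. *)
Lemma dS_borel_measureE n (A : set (n.+1.-tuple R)) : (0 < n)%N -> measurable A ->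
  dS_borel_measure A = (n.+1%:R%:E * lebt n.+1 (dS_cone A))%E.
Proof.
move=> n0 mA.
have mB := measurable_preimage (@measurable_dS_param R n) mA.
transitivity ((radial_measure n.-1 \x @sphere_measure R n)%E (@dS_param R n @^-1` A)).
  rewrite /dS_borel_measure /pushforward; apply/esym.
  by apply: product_measure_unique => // *; exact: product_measure2E.
transitivity (coord_measure (@dS_param R n @^-1` A)).
  by apply: product_measure_unique => // *; exact: coord_measureX.
congr (_ * lebt n.+1 _)%E; apply/seteqP; split => w; rewrite /dS_cone /spacelike /=.
  by move=> [Aw q]; split => //; rewrite -dS_param_coord//; case/andP: q.
by move=> [q Aw]; split => //; rewrite dS_param_coord//; case/andP: q.
Qed.

End dS_borel_measure.

(** * The completed measure and its invariance *)

Section dS_measure.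
Context {R : realType}.
Local Notation lebt := (@lebesgue_tuple R).

Lemma dS_measure_ge0 n (A : set (n.+1.-tuple R)) : (0 <= dS_measure A)%E.
Proof. exact: mu_ext_ge0. Qed.

Lemma le_dS_measure n (A B : set (n.+1.-tuple R)) : A `<=` B ->
  (dS_measure A <= dS_measure B)%E.
Proof. exact: le_mu_ext. Qed.

Lemma dS_measureU n (A B : set (n.+1.-tuple R)) :
  (dS_measure (A `|` B) <= dS_measure A + dS_measure B)%E.
Proof. exact: (outer_measureU2 (mu_ext (@dS_borel_measure R n))). Qed.

Lemma dS_measureE n (A : set (n.+1.-tuple R)) : measurable A ->
  dS_measure A = dS_borel_measure A.
Proof. exact: measurable_mu_extE. Qed.

Lemma measurable_dS_measurable n (A : set (n.+1.-tuple R)) :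
  measurable A -> dS_measurable A.
Proof. exact: caratheodory_measurable_mu_ext. Qed.

Lemma dS_measurableP n (B : set (n.+1.-tuple R)) : dS_measurable B <->
  forall A, dS_measure A = (dS_measure (A `&` B) + dS_measure (A `&` ~` B))%E.
Proof. exact. Qed.

(** The Caratheodory criterion: an arbitrary set [A], for instance a symmetric difference with a
    section, may be cut along [B]. *)
Lemma dS_measure_split n (B A : set (n.+1.-tuple R)) : dS_measurable B ->
  dS_measure A = (dS_measure (A `&` B) + dS_measure (A `\` B))%E.
Proof. exact. Qed.

Variables (n : nat) (L : n.+1.-tuple R -> n.+1.-tuple R).
Hypotheses (n0 : (0 < n)%N) (mL : measurable_fun [set: _] L).
Hypotheses (LB : {morph L : y z / sub_tuple y z}) (LK : involutive L).
Hypothesis LZ : forall c y, L (scale_tuple c y) = scale_tuple c (L y).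
Hypothesis LM : forall y, minkowski (L y) (L y) = minkowski y y.

Let LLK (A : set (n.+1.-tuple R)) : L @^-1` (L @^-1` A) = A.
Proof. by apply/seteqP; split => y /=; rewrite LK. Qed.

Lemma measurable_dS_cone (A : set (n.+1.-tuple R)) : measurable A ->
  measurable (dS_cone A).
Proof.
move=> mA; apply: measurableI; first exact: measurable_spacelike.
apply: (@measurable_preimage _ _ _ _
  (fun w => scale_tuple (Num.sqrt (minkowski w w))^-1 w)) => //.
apply/measurable_fun_tnthP => i.
rewrite (_ : _ \o _ = fun w => (Num.sqrt (minkowski w w))^-1 * tnth w i); last first.
  by apply/funext => w /=; rewrite tnth_scale_tuple.
apply: measurable_funM; last exact: measurable_tnth.
apply: measurableT_comp; first exact: measurable_invr.
apply: measurableT_comp; first exact: measurable_sqrtr.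
exact: measurable_minkowski.
Qed.

Lemma dS_borel_measure_involution A : measurable A ->
  dS_borel_measure (L @^-1` A) = dS_borel_measure A.
Proof.
move=> mA; have mLA : measurable (L @^-1` A) by exact: measurable_preimage.
rewrite !dS_borel_measureE//; congr (_ * _)%E.
rewrite -[RHS](lebesgue_tuple_involution mL LB LK); last exact: measurable_dS_cone.
by congr (lebt n.+1 _); apply/seteqP; split => w; rewrite /dS_cone /spacelike /=;
  rewrite LM LZ.
Qed.

(** The measure is an infimum over countable Borel covers, and [L] transports covers without
    changing their total measure. One inequality suffices since [L] is its own inverse. *)
Lemma dS_measure_involution A : dS_measure (L @^-1` A) = dS_measure A.
Proof.
suff le B : (dS_measure (L @^-1` B) <= dS_measure B)%E.
  by apply/eqP; rewrite eq_le le/= -{1}(LLK A) le.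
apply: le_ereal_inf_tmp => _ [F [mF BF] <-].
apply: ereal_inf_lbound; exists (fun k => L @^-1` F k).
  split => [k|y /BF [k _ Fk]]; first exact: measurable_preimage.
  by exists k.
by apply: eq_eseriesr => k _; exact: dS_borel_measure_involution.
Qed.

Lemma dS_measurable_involution A : dS_measurable A -> dS_measurable (L @^-1` A).
Proof.
move=> mA; apply/dS_measurableP => X.
rewrite -[LHS]dS_measure_involution (dS_measure_split _ mA).
rewrite -(dS_measure_involution (X `&` L @^-1` A)) -(dS_measure_involution (X `&` ~` (L @^-1` A))).
have -> : L @^-1` (X `&` L @^-1` A) = L @^-1` X `&` A.
  by rewrite preimage_setI LLK.
have -> : L @^-1` (X `&` ~` (L @^-1` A)) = L @^-1` X `\` A.
  by rewrite preimage_setI preimage_setC LLK.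
by [].
Qed.

End dS_measure.

(** * Volumes of spheres *)

Section gamma.
Context {R : realType}.
Local Notation leb := (@lebesgue_measure R).
Local Notation lebt := (@lebesgue_tuple R).
Implicit Types a s t w : R.

Lemma powR_sqrt n s : 0 <= s -> s `^ (n%:R / 2) = Num.sqrt s ^+ n.
Proof.
by move=> s0; rewrite mulrC powRrM powR12_sqrt// powR_mulrn// sqrtr_ge0.
Qed.

Lemma integral_expRN a :
  (\int[leb]_(s in `[a, +oo[) (expR (- s))%:E = (expR (- a))%:E)%E.
Proof.
have dF s : is_derive s 1 (\- (fun s : R => expR (- s))) (expR (- s)).
  by have dN := is_derive_expRN s; apply: is_derive_eq; rewrite opprK.
have ce : continuous (fun s : R => expR (- s)).
  move=> s; apply: (@cvg_comp _ _ _ -%R expR); last exact: continuous_expR.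
  exact: oppr_continuous.
rewrite (@ge0_continuous_FTC2y R _ (\- (fun s : R => expR (- s))) a 0) /=.
- by rewrite opprK add0e.
- by move=> s _; exact: expR_ge0.
- exact: continuous_subspaceT.
- rewrite -oppr0; apply: cvgN; exact: cvgr_expR.
- by move=> s _; have [] := dF s.
- by apply: cvgN; apply: cvg_at_right_filter; exact: ce.
- by move=> s _; rewrite derive1E; have [_ ->] := dF s.
Qed.

Lemma integral_powR a w : 0 < a -> 0 < w ->
  (\int[leb]_(t in `]0%R, w]) (a * t `^ (a - 1))%:E = (w `^ a)%:E)%E.
Proof.
move=> a0 w0.
(* The integrand may be unbounded at 0, so the primitive is used on [e k, w] and [k] tends to
   infinity; the shift by 2 gives [e k < w] already for k = 0. *)
pose e (k : nat) := w / k.+2%:R.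
have e0 k : 0 < e k by rewrite divr_gt0.
have ew k : e k < w by rewrite ltr_pdivrMr// ltr_pMr// ltr1n.
pose F (k : nat) : set (measurableTypeR R) := `[e k, w]%classic.
have UF : \bigcup_k F k = `]0, w]%classic.
  apply/seteqP; split => t.
    move=> [k _]; rewrite /F /= !in_itv /= => /andP[et ->].
    by rewrite (lt_le_trans (e0 k) et).
  rewrite /= in_itv /= => /andP[t0 tw].
  exists (Num.bound (w / t)) => //; rewrite /F /= in_itv /= tw andbT.
  rewrite ler_pdivrMr// mulrC -ler_pdivrMr// ltW//.
  have : 0 <= w / t by rewrite divr_ge0// ltW.
  move/archi_boundP => /lt_trans; apply; rewrite ltr_nat; exact: leqnSn.
have cpow b t : 0 < t -> {for t, continuous (@powR R ^~ b)}.
  move=> t0; have [/derivable1_diffP d _] := @is_derive1_powR R b t t0.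
  exact: differentiable_continuous d.
have FE k : (\int[leb]_(t in F k) (a * t `^ (a - 1))%:E = (w `^ a - e k `^ a)%:E)%E.
  rewrite (@continuous_FTC2 R (fun t => a * t `^ (a - 1)) (@powR R ^~ a) _ _ (ew k)).
  - by rewrite EFinB.
  - apply/continuous_in_subspaceT => t /[!inE] /=; rewrite in_itv /= => /andP[et tw].
    have t0 := lt_le_trans (e0 k) et.
    apply: cvgM; first exact: cvg_cst.
    exact: cpow.
  - split.
    + move=> t; rewrite in_itv /= => /andP[et tw].
      by have [] := @is_derive1_powR R a t (lt_trans (e0 k) et).
    + apply: cvg_at_right_filter; exact: cpow.
    + apply: cvg_at_left_filter; exact: cpow.
  - move=> t; rewrite in_itv /= => /andP[et tw]; rewrite derive1E.
    by have [_ ->] := @is_derive1_powR R a t (lt_trans (e0 k) et).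
have mf : measurable_fun `]0%R, w] (fun t => (a * t `^ (a - 1))%:E).
  apply/measurable_funTS/measurable_EFinP; exact: measurable_funM.
have c1 : (\int[leb]_(t in F k) (a * t `^ (a - 1))%:E)%E @[k --> \oo] -->
    (\int[leb]_(t in `]0%R, w]) (a * t `^ (a - 1))%:E)%E.
  rewrite -UF; apply: ge0_nondecreasing_set_cvg_integral => //.
  - move=> k l kl; apply/subsetPset => t; rewrite /F /= !in_itv /= => /andP[et ->].
    rewrite andbT; apply: le_trans et; rewrite ler_pM2l// lef_pV2 ?posrE//.
    by rewrite ler_nat !ltnS.
  - by move=> k; exact: measurable_itv.
  - by move=> k; apply/measurable_funTS/measurable_EFinP; exact: measurable_funM.
  - by move=> k t _; rewrite lee_fin mulr_ge0 ?powR_ge0// ltW.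
have c2 : ((w `^ a - e k `^ a)%:E)%E @[k --> \oo] --> ((w `^ a)%:E)%E.
  apply: cvg_EFin; first by near=> k.
  rewrite -[X in _ --> X]subr0; apply: cvgB; first exact: cvg_cst.
  have ce : e k @[k --> \oo] --> 0^'+.
    have ce0 : e k @[k --> \oo] --> 0.
      rewrite -(mulr0 w); apply: cvgM; first exact: cvg_cst.
      by move: (@cvg_harmonic R); rewrite -cvg_shiftS.
    move=> P H; have H' : nbhs (0 : R) (fun x => 0 < x -> P x) := H.
    by have [N _ NP] := ce0 _ H'; exists N => // k /NP; apply; exact: e0.
  exact: (cvg_comp _ _ ce (powR_cvg0 a0)).
rewrite -(cvg_lim _ c1)//; under eq_fun do rewrite FE.
exact: cvg_lim c2.
Unshelve. all: by end_near.
Qed.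

(** The Gamma integral before truncation to a real number, so that Tonelli applies; its finiteness
    is derived later. *)
Definition egamma s : \bar R :=
  (\int[leb]_(t in `]0%R, +oo[) (t `^ (s - 1) * expR (- t))%:E)%E.

Lemma measurable_egamma s : measurable_fun [set: measurableTypeR R]
  (fun t => (t `^ (s - 1) * expR (- t))%:E).
Proof.
apply/measurable_EFinP; apply: measurable_funM; last exact: measurable_expRN.
exact: measurable_powR.
Qed.

Lemma tonelli_triangle (g h : R -> R) :
  measurable_fun [set: R] g -> measurable_fun [set: R] h ->
  (forall t, 0 <= g t) -> (forall w, 0 <= h w) ->
  (\int[leb]_(w in `]0%R, +oo[) (\int[leb]_(t in `]0%R, w]) (g t)%:E * (h w)%:E) =
   \int[leb]_(t in `]0%R, +oo[) ((g t)%:E * \int[leb]_(w in `[t, +oo[) (h w)%:E))%E.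
Proof.
move=> mg mh g0 h0.
pose S : set (measurableTypeR R * measurableTypeR R) := [set p | 0 < p.2 <= p.1].
pose f p : \bar R := (\1_S p * (g p.2 * h p.1))%:E.
have mS : measurable S.
  rewrite (_ : S = (snd @^-1` [set` `]0, +oo[]) `&`
    ((fun p => p.1 - p.2) @^-1` [set` `[0, +oo[])).
    apply: measurableI.
      by apply: measurable_preimage => //; exact: measurable_itv.
    apply: (@measurable_preimage _ _ _ (measurableTypeR R)
      (fun p : measurableTypeR R * measurableTypeR R => p.1 - p.2 : measurableTypeR R));
      last exact: measurable_itv.
    by apply: measurable_funB; [exact: measurable_fst|exact: measurable_snd].
  apply/seteqP; split => -[w t] /=; rewrite /S /= !in_itv /= !andbT subr_ge0.
    by move=> /andP[].
  by move=> [-> ->].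
have mf : measurable_fun [set: measurableTypeR R * measurableTypeR R] f.
  apply/measurable_EFinP; apply: measurable_funM => //.
  apply: measurable_funM.
    by apply: (measurableT_comp mg); exact: measurable_snd.
  by apply: (measurableT_comp mh); exact: measurable_fst.
have f0 p : (0 <= f p)%E by rewrite lee_fin !mulr_ge0.
have {mf f0} H := @fubini_tonelli _ _ (measurableTypeR R) (measurableTypeR R) _ leb leb f mf f0.
transitivity (\int[leb]_w \int[leb]_t f (w, t))%E.
  rewrite integral_mkcond/=; apply: eq_integral => w _.
  rewrite patchE; case: ifPn => [|].
    rewrite inE /= in_itv /= andbT => w0.
    transitivity (\int[leb]_(t in `]0%R, w]) ((g t)%:E * (h w)%:E))%E.
      apply/esym/ge0_integralZr; first exact: measurable_itv.
      - by apply/measurable_funTS/measurable_EFinP.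
      - by move=> t _; rewrite lee_fin.
      - by rewrite lee_fin.
    rewrite integral_mkcond/=; apply: eq_integral => t _.
    rewrite patchE /f indicE; case: ifPn => [|].
      by rewrite inE /= in_itv /= => tw; rewrite mem_set// mul1r EFinM.
    rewrite notin_setE /= in_itv /= => tw.
    by rewrite memNset ?mul0r.
  rewrite notin_setE /= in_itv /= andbT => w0.
  apply/esym/integral0_eq => t _; rewrite /f indicE memNset ?mul0r//= => /andP[t0 tw].
  by apply: w0; exact: lt_le_trans tw.
transitivity (\int[leb]_t \int[leb]_w f (w, t))%E; first exact: H.
rewrite [RHS]integral_mkcond/=; apply: eq_integral => t _.
rewrite patchE; case: ifPn => [|].
  rewrite inE /= in_itv /= andbT => t0.
  transitivity (\int[leb]_(w in `[t, +oo[) ((g t)%:E * (h w)%:E))%E; last first.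
    apply: ge0_integralZl; first exact: measurable_itv.
    - by apply/measurable_funTS/measurable_EFinP.
    - by move=> w _; rewrite lee_fin.
    - by rewrite lee_fin.
  rewrite [RHS]integral_mkcond/=; apply: eq_integral => w _.
  rewrite patchE /f indicE; case: ifPn => [|].
    rewrite inE /= in_itv /= andbT => tw.
    by rewrite mem_set ?mul1r ?EFinM// /S /= t0.
  rewrite notin_setE /= in_itv /= andbT => tw.
  by rewrite memNset ?mul0r// /S /= => /andP[_].
rewrite notin_setE /= in_itv /= andbT => t0.
by apply: integral0_eq => w _; rewrite /f indicE memNset ?mul0r//= => /andP[].
Qed.

(** Integration by parts in the form of Tonelli: write w^a as the integral of a t^(a-1) over 0 < t
    <= w and exchange the order; the integral of e^(-w) over w >= t is e^(-t). *)
Lemma egammaD1 a : 0 < a -> egamma (a + 1) = (a%:E * egamma a)%E.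
Proof.
move=> a0.
have := @tonelli_triangle (fun t => a * t `^ (a - 1)) (fun w => expR (- w)).
have mp : measurable_fun [set: R] (fun t : R => a * t `^ (a - 1)).
  by apply: measurable_funM => //; exact: measurable_powR.
move=> /(_ mp measurable_expRN) H.
have g0 t : 0 <= a * t `^ (a - 1) by exact: mulr_ge0 (ltW a0) (powR_ge0 _ _).
have {}H := H g0 (fun w => expR_ge0 (- w)).
transitivity (\int[leb]_(w in `]0%R, +oo[)
   (\int[leb]_(t in `]0%R, w]) (a * t `^ (a - 1))%:E * (expR (- w))%:E))%E.
  apply: eq_integral => w; rewrite inE /= in_itv /= andbT => w0.
  by rewrite (integral_powR a0 w0) -EFinM (_ : a + 1 - 1 = a)//; ring.
rewrite H.
transitivity (\int[leb]_(t in `]0%R, +oo[) (a%:E * (t `^ (a - 1) * expR (- t))%:E))%E.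
  by apply: eq_integral => t _; rewrite integral_expRN -!EFinM mulrA.
apply: ge0_integralZl.
- exact: measurable_itv.
- by apply: measurable_funTS; exact: measurable_egamma.
- by move=> t _; rewrite lee_fin; exact: mulr_ge0 (powR_ge0 _ _) (expR_ge0 _).
- by rewrite lee_fin ltW.
Qed.

Lemma integral_gauss_tuple n :
  (\int[lebt n]_y (expR (- enorm y ^+ 2))%:E = (Num.sqrt pi ^+ n)%:E)%E.
Proof.
have me k : measurable_fun [set: k.-tuple R] (fun y => (expR (- enorm y ^+ 2))%:E).
  apply/measurable_EFinP; apply: (measurableT_comp measurable_expRN).
  by apply: measurable_funX; exact: measurable_enorm.
elim: n => [|n IH].
  transitivity (\int[\d_[tuple]]_y (expR (- @enorm R 0 y ^+ 2))%:E)%E; first by [].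
  transitivity (@dirac _ (0.-tuple R) [tuple] R setT * (expR (- @enorm R 0 [tuple] ^+ 2))%:E)%E.
    exact: (integral_dirac [tuple] measurableT (me 0%N)).
  by rewrite diracT mul1e sqr_enorm big_ord0 oppr0 expR0 expr0.
rewrite integral_lebesgue_tupleS//.
transitivity (\int[leb]_x ((gauss_fun x)%:E * (Num.sqrt pi ^+ n)%:E))%E.
  apply: eq_integral => x _.
  transitivity (\int[lebt n]_y ((gauss_fun x)%:E * (expR (- enorm y ^+ 2))%:E))%E.
    apply: eq_integral => y _; rewrite -EFinM /gauss_fun -expRD -opprD.
    rewrite !sqr_enorm big_ord_recl tnth_cons_pair0.
    by under eq_bigr do rewrite tnth_cons_pairS.
  rewrite -IH; apply: ge0_integralZl; [exact: measurableT|exact: me|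
      by move=> y _; rewrite lee_fin; exact: expR_ge0|
      by rewrite lee_fin; exact: gauss_fun_ge0].
rewrite ge0_integralZr//.
- by rewrite integralT_gauss -EFinM -exprS.
- by apply/measurable_EFinP; exact: measurable_gauss_fun.
- by move=> x _; rewrite lee_fin gauss_fun_ge0.
Qed.

(** Integrate e^(-s) over 0 < |y| <= sqrt s in both orders: y first gives the volume of the ball
    times s^(n/2) e^(-s), s first gives the Gaussian e^(-|y|^2). *)
Lemma lebesgue_cone_egamma n : (0 < n)%N ->
  (lebt n (cone setT 1) * egamma (n%:R / 2 + 1) = (Num.sqrt pi ^+ n)%:E)%E.
Proof.
move=> n0; rewrite -integral_gauss_tuple.
pose S : set (measurableTypeR R * n.-tuple R) :=
  [set p | cone setT (Num.sqrt p.1) p.2].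
have mS : measurable S.
  rewrite (_ : S = ((fun p => enorm p.2) @^-1` [set` `]0, +oo[]
     `&` (fun p => Num.sqrt p.1 - enorm p.2) @^-1` [set` `[0, +oo[])).
    have me : measurable_fun [set: measurableTypeR R * n.-tuple R] (fun p => enorm p.2).
      by apply: measurableT_comp; [exact: measurable_enorm|exact: measurable_snd].
    apply: measurableI; first by apply: measurable_preimage => //; exact: measurable_itv.
    apply: (@measurable_preimage _ _ _ (measurableTypeR R)); last exact: measurable_itv.
    apply: measurable_funB => //.
    apply: (@measurableT_comp _ _ _ _ _ _ (@Num.sqrt R)); last exact: measurable_fst.
    by apply: continuous_measurable_fun; exact: sqrt_continuous.
  apply/seteqP; split => -[s y] /=; rewrite /S /cone /= !in_itv /= !andbT subr_ge0.
    by move=> [/andP[]].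
  by move=> [-> ->].
pose f p : \bar R := (\1_S p * expR (- p.1))%:E.
have mf : measurable_fun [set: measurableTypeR R * n.-tuple R] f.
  apply/measurable_EFinP; apply: measurable_funM => //.
  by apply: (measurableT_comp measurable_expRN); exact: measurable_fst.
have f0 p : (0 <= f p)%E by rewrite lee_fin mulr_ge0 ?expR_ge0.
have H := @fubini_tonelli _ _ (measurableTypeR R) _ _ leb (lebt n) f mf f0.
transitivity (\int[leb]_s \int[lebt n]_y f (s, y))%E.
  rewrite muleC /egamma -ge0_integralZr//; last 2 first.
  - by apply: measurable_funTS; exact: measurable_egamma.
  - by move=> t _; rewrite lee_fin mulr_ge0 ?powR_ge0 ?expR_ge0.
  rewrite integral_mkcond/=; apply: eq_integral => s _.
  rewrite patchE; case: ifPn => [|].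
    rewrite inE /= in_itv /= andbT => s0.
    transitivity (\int[lebt n]_y ((\1_(cone setT (Num.sqrt s)) y)%:E * (expR (- s))%:E))%E.
      rewrite ge0_integralZr//; last first.
        by apply/measurable_EFinP; apply: measurable_indic; exact: measurable_cone.
      rewrite integral_indic//; last exact: measurable_cone.
      have -> : n%:R / 2 + 1 - 1 = n%:R / 2 :> R by ring.
      have V := @lebesgue_cone R n setT (Num.sqrt s) n0 (sqrtr_ge0 s) measurableT.
      rewrite setIT [X in _ = (X * _)%E]V powR_sqrt ?ltW//.
      by rewrite EFinM -muleA [X in (_ * X)%E]muleC muleA.
    by apply: eq_integral => y _; rewrite /f EFinM !indicE; congr ((_ : bool)%:R%:E * _)%E;
      apply/idP/idP; rewrite !inE.
  rewrite notin_setE /= in_itv /= andbT => /negP; rewrite -leNgt => s0.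
  apply/esym/integral0_eq => y _; rewrite /f indicE memNset ?mul0r//.
  by rewrite /S /= ler0_sqrtr// cone_le0.
transitivity (\int[lebt n]_y \int[leb]_s f (s, y))%E; first exact: H.
(* Cones are punctured, so the slice of [S] over y = 0 is empty and the Gaussian is only obtained
   almost everywhere. *)
have null : lebt n [set y | enorm y = 0] = 0%E.
  apply/eqP; rewrite eq_le measure_ge0 andbT.
  apply: (@le_trans _ _ (lebt n [set y | forall i, (`|tnth y i| <= 0)%R])); last first.
    by rewrite lebesgue_cube// mul0rn expr0n gtn_eqF.
  apply: le_measure; rewrite ?inE.
  - rewrite (_ : [set y | _] = @enorm R n @^-1` [set 0])//.
    by apply: measurable_preimage => //; exact: measurable_enorm.
  - exact: measurable_cube.
  - move=> y /= y0 i; rewrite -y0 -sqrtr_sqr ler_wsqrtr// (bigD1 i)//= lerDl.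
    by rewrite sumr_ge0// => j _; rewrite sqr_ge0.
apply: ge0_ae_eq_integral => //.
- exact: measurable_fun_fubini_tonelli_G.
- apply/measurable_EFinP; apply: (measurableT_comp measurable_expRN).
  by apply: measurable_funX; exact: measurable_enorm.
- by move=> y _; apply: integral_ge0.
- exists [set y | enorm y = 0]; split => //.
    rewrite (_ : [set y | _] = @enorm R n @^-1` [set 0])//.
    by apply: measurable_preimage => //; exact: measurable_enorm.
  move=> y /=; apply: contra_notP => /eqP y0 _.
  have {}y0 : 0 < enorm y by rewrite lt_neqAle enorm_ge0 andbT eq_sym.
  rewrite -integral_expRN [RHS]integral_mkcond/=; apply: eq_integral => s _.
  rewrite patchE /f indicE; case: ifPn => [|].
    rewrite inE /= in_itv /= andbT => ys; rewrite mem_set ?mul1r//.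
    rewrite /S /cone /= y0; split => //=.
    by rewrite -(ger0_norm (enorm_ge0 y)) -sqrtr_sqr ler_wsqrtr.
  rewrite notin_setE /= in_itv /= andbT => ys; rewrite memNset ?mul0r//.
  rewrite /S /cone /= y0 => -[/= ysq _]; apply: ys.
  have s0 : 0 <= s by rewrite leNgt; apply/negP => s0; move: ysq; rewrite ltr0_sqrtr// leNgt y0.
  by rewrite -(sqr_sqrtr s0) lerXn2r// nnegrE ?enorm_ge0 ?sqrtr_ge0.
Qed.

Lemma sphere_volume_gt0 n : (0 < n)%N -> 0 < sphere_volume (R := R) n.
Proof.
move=> n0; rewrite /sphere_volume sphere_measureE.
have := lebesgue_cone_egamma n0; have := @lebesgue_cone_lty R n setT 1 measurableT.
rewrite -ge0_fin_numE// => /fineK <- H.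
rewrite -EFinM /= mulr_gt0 ?ltr0n// lt_neqAle fine_ge0// andbT eq_sym.
apply/eqP => v0; move: H; rewrite v0 mul0e => -[] /eqP.
by rewrite eq_sym expf_eq0 n0 sqrtr_eq0 leNgt pi_gt0.
Qed.

Lemma sphere_volume_Gamma n : (0 < n)%N ->
  sphere_volume n * Gamma (n%:R / 2) = 2 * Num.sqrt pi ^+ n :> R.
Proof.
move=> n0; have n2 : 0 < n%:R / 2 :> R by rewrite divr_gt0// ltr0n.
have := sphere_volume_gt0 n0; rewrite /sphere_volume sphere_measureE.
have := lebesgue_cone_egamma n0; have := @lebesgue_cone_lty R n setT 1 measurableT.
rewrite -ge0_fin_numE// => /fineK <-; rewrite egammaD1// -EFinM /=.
set v := fine _ => H nv.
have v0 : 0 < v by move: nv; rewrite pmulr_rgt0// ltr0n.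
(* Finiteness of the Gamma integral follows from the identity itself: times a positive factor it
   equals a power of sqrt pi. *)
have gfin : egamma (n%:R / 2) \is a fin_num.
  rewrite ge0_fin_numE; last first.
    by apply: integral_ge0 => t _; rewrite lee_fin mulr_ge0 ?powR_ge0 ?expR_ge0.
  rewrite ltNge leye_eq; apply/eqP => g; move: H; rewrite g muleA.
  rewrite -EFinM gt0_muley//.
  by rewrite lte_fin mulr_gt0.
rewrite -[Gamma _]/(fine (egamma (n%:R / 2))).
move: H; rewrite -(fineK gfin) -!EFinM => -[] <-.
by rewrite mulrA; field.
Qed.

End gamma.

(** * Half-spaces and admissible sections *)

Section minkowski_algebra.
Context {R : realType} {n : nat}.
Implicit Types (x y z u v w : n.+1.-tuple R) (a b c e : R).

Definition comb a x b y : n.+1.-tuple R := [tuple a * tnth x i + b * tnth y i | i < n.+1].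

Lemma tnth_comb a x b y i : tnth (comb a x b y) i = a * tnth x i + b * tnth y i.
Proof. by rewrite tnth_mktuple. Qed.

Lemma minkowskiC x y : minkowski x y = minkowski y x.
Proof.
rewrite /minkowski mulrC; congr (_ + _); apply: eq_bigr => i _; exact: mulrC.
Qed.

Lemma minkowski_combl a x b y z :
  minkowski (comb a x b y) z = a * minkowski x z + b * minkowski y z.
Proof.
rewrite /minkowski !tnth_comb.
under eq_bigr do rewrite tnth_comb mulrDl -!mulrA.
by rewrite big_split/= -!mulr_sumr; ring.
Qed.

Lemma minkowski_combr a x b y z :
  minkowski z (comb a x b y) = a * minkowski z x + b * minkowski z y.
Proof. by rewrite minkowskiC minkowski_combl ![minkowski _ z]minkowskiC. Qed.

Lemma scale_comb c y : scale_tuple c y = comb c y 0 y.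
Proof.
by apply: eq_from_tnth => i; rewrite tnth_comb tnth_scale_tuple mul0r addr0.
Qed.

Lemma minkowski_scalel c y z : minkowski (scale_tuple c y) z = c * minkowski y z.
Proof. by rewrite scale_comb minkowski_combl mul0r addr0. Qed.

Lemma minkowski_scaler c y z : minkowski z (scale_tuple c y) = c * minkowski z y.
Proof. by rewrite minkowskiC minkowski_scalel minkowskiC. Qed.

Lemma sub_comb y z : sub_tuple y z = comb 1 y (-1) z.
Proof.
by apply: eq_from_tnth => i; rewrite tnth_comb tnth_sub_tuple mul1r mulN1r.
Qed.

Lemma minkowski_delta (i : 'I_n.+1) v :
  minkowski [tuple (j == i)%:R | j < n.+1] v = (if i == ord0 then -1 else 1) * tnth v i.
Proof.
rewrite /minkowski tnth_mktuple eq_sym; under eq_bigr do rewrite tnth_mktuple.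
case: (unliftP ord0 i) => [j|] ->.
  rewrite mul0r oppr0 add0r (bigD1 j)//= eqxx big1 ?addr0// => k kj.
  by rewrite (inj_eq lift_inj) (negbTE kj) mul0r.
by rewrite eqxx big1 ?addr0 ?mulN1r ?mul1r// => k _; rewrite mul0r.
Qed.

Lemma tnth_origin0 : tnth (origin : n.+1.-tuple R) ord0 = 1.
Proof. by []. Qed.

Lemma minkowski_origin y : minkowski y origin = - tnth y ord0.
Proof.
rewrite /minkowski big1 ?addr0 => [|i _].
  by rewrite tnth_origin0 mulr1.
by rewrite [tnth origin _](tnth_nth 0) /= nth_nseq; case: ifP; rewrite mulr0.
Qed.

Lemma cauchy_schwarz m (p q : 'I_m -> R) :
  (\sum_i p i * q i) ^+ 2 <= (\sum_i p i ^+ 2) * (\sum_i q i ^+ 2).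
Proof.
set A := \sum_i p i ^+ 2; set B := \sum_i q i ^+ 2; set C := \sum_i p i * q i.
have A0 : 0 <= A by apply: sumr_ge0 => i _; exact: sqr_ge0.
have : 0 <= \sum_i (A * q i - C * p i) ^+ 2 by apply: sumr_ge0 => i _; exact: sqr_ge0.
have -> : \sum_i (A * q i - C * p i) ^+ 2 = A * (A * B - C ^+ 2).
  transitivity (\sum_i (A ^+ 2 * q i ^+ 2 + (- (2 * A * C)) * (p i * q i) + C ^+ 2 * p i ^+ 2)).
    by apply: eq_bigr => i _; ring.
  by rewrite !big_split/= -!mulr_sumr -/A -/B -/C; ring.
have [Agt|] := ltP 0 A; first by rewrite pmulr_rge0// subr_ge0.
move=> Ale _; have {Ale} A00 : A = 0 by apply/eqP; rewrite eq_le Ale A0.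
have p0 i : p i = 0.
  apply/eqP; rewrite -sqrf_eq0; apply/eqP; move/eqP: A00.
  by rewrite psumr_eq0 => [/allP /(_ i (mem_index_enum i)) /= /eqP//|j _]; exact: sqr_ge0.
by rewrite A00 mul0r /C big1 ?expr0n// => i _; rewrite p0 mul0r.
Qed.

Definition future : set (n.+1.-tuple R) := [set y | minkowski y y < 0 /\ 0 < tnth y ord0].

Lemma hyperboloid_future x : hyperboloid x -> future x.
Proof. by move=> [xx x0]; split; rewrite ?xx ?oppr_lt0. Qed.

Lemma future_hyperboloid y : future y ->
  hyperboloid (scale_tuple (Num.sqrt (- minkowski y y))^-1 y).
Proof.
move=> [yy y0]; have s0 : 0 < Num.sqrt (- minkowski y y) by rewrite sqrtr_gt0 oppr_gt0.
split; last by rewrite tnth_scale_tuple mulr_gt0// invr_gt0.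
rewrite minkowski_scalel minkowski_scaler mulrA -expr2 exprVn sqr_sqrtr ?oppr_ge0 ?ltW//.
by rewrite invrN mulNr mulVf// lt_eqF.
Qed.

Lemma minkowski_future x y : future x -> future y -> minkowski x y < 0.
Proof.
move=> [xx x0] [yy y0]; rewrite /minkowski addrC subr_lt0.
have := cauchy_schwarz (fun i => tnth x (lift ord0 i)) (fun i => tnth y (lift ord0 i)).
move: xx yy; rewrite /minkowski.
rewrite [X in _ + X < 0 -> _](eq_bigr (fun i => tnth x (lift ord0 i) ^+ 2)); last by move=> i _; rewrite expr2.
rewrite [X in _ -> _ + X < 0 -> _](eq_bigr (fun i => tnth y (lift ord0 i) ^+ 2)); last by move=> i _; rewrite expr2.
set A := \sum_(i < n) _ ^+ 2; set B := \sum_(i < n) _ ^+ 2; set C := \sum_(i < n) _.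
move: x0 y0; set p := tnth x ord0; set q := tnth y ord0 => p0 q0 Ap Bq CAB.
have A0 : 0 <= A by apply: sumr_ge0 => i _; exact: sqr_ge0.
have B0 : 0 <= B by apply: sumr_ge0 => i _; exact: sqr_ge0.
have [C0|C0] := leP C 0; first by apply: le_lt_trans C0 _; exact: mulr_gt0.
rewrite -(@ltr_pXn2r _ 2)// ?nnegrE ?(ltW C0) ?mulr_ge0 ?ltW//.
apply: le_lt_trans CAB _; rewrite exprMn.
by apply: ltr_pM => //; rewrite expr2 -subr_lt0 addrC.
Qed.

Lemma quadratic_gt0 a b c : 0 < a ->
  exists2 d, 0 < d & forall e, 0 <= e <= d -> 0 < a + e * b + e ^+ 2 * c.
Proof.
move=> a0; set m := `|b| + `|c| + 1.
have m0 : 0 < m by rewrite /m; have := normr_ge0 b; have := normr_ge0 c; lra.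
exists (Num.min 1 (a / (2 * m))); first by rewrite lt_min ltr01 divr_gt0// mulr_gt0.
move=> e /andP[e0]; rewrite le_min => /andP[e1].
rewrite ler_pdivlMr ?mulr_gt0// => eam.
have hb : - `|b| <= b by rewrite lerNnormlW.
have hc : - `|c| <= c by rewrite lerNnormlW.
have b0 := normr_ge0 b; have c0 := normr_ge0 c.
have h1 : - (e * `|b|) <= e * b by rewrite -mulrN ler_wpM2l.
have h2 : - (e * `|c|) <= e ^+ 2 * c.
  apply: (@le_trans _ _ (- (e ^+ 2 * `|c|))); last by rewrite -mulrN ler_wpM2l// sqr_ge0.
  by rewrite lerN2 ler_wpM2r// expr2 ler_piMl.
move: eam; rewrite /m; nra.
Qed.

(** The future cone and the condition [0 < a] are open; a single step [e] along [z] respects both.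
    This is the tool for pushing vectors off a wall. *)
Lemma future_pert y z a c : future y -> 0 < a ->
  exists e, [/\ 0 < e, future (comb 1 y e z) & 0 < a + e * c].
Proof.
move=> [yy y0] a0.
have yy' : 0 < - minkowski y y by rewrite oppr_gt0.
have [d1 d10 h1] := quadratic_gt0 (- 2 * minkowski y z) (- minkowski z z) yy'.
have [d2 d20 h2] := quadratic_gt0 (tnth z ord0) 0 y0.
have [d3 d30 h3] := quadratic_gt0 c 0 a0.
set e := Num.min d1 (Num.min d2 d3).
have e0 : 0 < e by rewrite !lt_min d10 d20.
exists e; split => //.
- split.
    have := h1 e; rewrite ltW// ge_min lexx => /(_ isT).
    rewrite !(minkowski_combl, minkowski_combr) (minkowskiC z y); nra.
  by rewrite tnth_comb mul1r; have := h2 e; rewrite ltW// !ge_min lexx orbT => /(_ isT); rewrite mulr0 addr0.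
- by have := h3 e; rewrite ltW// !ge_min lexx !orbT => /(_ isT); rewrite mulr0 addr0.
Qed.

Lemma open_half_future u v : open_half u `<=` open_half v ->
  forall y, future y -> 0 < minkowski y u -> 0 < minkowski y v.
Proof.
move=> uv y Fy yu; have Iy := future_hyperboloid Fy.
have [yy _] := Fy; have s0 : 0 < (Num.sqrt (- minkowski y y))^-1.
  by rewrite invr_gt0 sqrtr_gt0 oppr_gt0.
have [|_] := uv (scale_tuple (Num.sqrt (- minkowski y y))^-1 y).
  by split => //; rewrite minkowski_scalel mulr_gt0.
by rewrite minkowski_scalel pmulr_rgt0.
Qed.

(** The orthogonal projection of [origin] to the hyperplane normal to a unit vector [u], as the
    product of [origin] and [u] is minus the time coordinate of [u]: a future vector on the wall
    itself. *)
Definition touching u := comb 1 origin (tnth u ord0) u.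

Lemma touchingP u : dS u -> future (touching u) /\ minkowski (touching u) u = 0.
Proof.
move=> uu; have ou : minkowski origin u = - tnth u ord0 by rewrite minkowskiC minkowski_origin.
split; last by rewrite minkowski_combl ou uu; ring.
split; last by rewrite tnth_comb tnth_origin0 mul1r -expr2 ltr_pwDl// sqr_ge0.
rewrite !(minkowski_combl, minkowski_combr) ou (minkowskiC u) ou uu minkowski_origin tnth_origin0.
by have := sqr_ge0 (tnth u ord0); rewrite expr2; lra.
Qed.

(** A future vector orthogonal to [u] is orthogonal to [v], since otherwise a small move along [u]
    or its opposite separates the two half-spaces. Perturbing one such vector by any [z] orthogonal
    to [u] shows that [v] vanishes there too. Hence [v] is a multiple of [u], the norm leaves a
    sign, and a point on the positive side fixes it. *)
Lemma open_half_inj u v : dS u -> dS v -> open_half u = open_half v -> u = v.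
Proof.
move=> uu vv uv.
have Huv y : future y -> 0 < minkowski y u -> 0 < minkowski y v.
  by apply: open_half_future; rewrite uv.
have Hvu y : future y -> 0 < minkowski y v -> 0 < minkowski y u.
  by apply: open_half_future; rewrite uv.
have zero y : future y -> minkowski y u = 0 -> minkowski y v = 0.
  move=> Fy yu; apply/eqP; rewrite eq_le; apply/andP; split; rewrite leNgt; apply/negP => yv.
    have [e [e0 Fe]] := future_pert (scale_tuple (-1) u) (- minkowski u v) Fy yv.
    have := Hvu _ Fe; rewrite !minkowski_combl !minkowski_scalel yu uu; nra.
  have yv' : 0 < - minkowski y v by rewrite oppr_gt0.
  have [e [e0 Fe]] := future_pert u (- minkowski u v) Fy yv'.
  have := Huv _ Fe; rewrite !minkowski_combl yu uu; nra.
have [p [Fp pu]] : exists p, future p /\ minkowski p u = 0.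
  by exists (touching u); exact: touchingP.
have pv := zero _ Fp pu.
have perp z : minkowski z u = 0 -> minkowski z v = 0.
  move=> zu; have [e [e0 Fe _]] := future_pert z 0 Fp ltr01.
  have := zero _ Fe; rewrite !minkowski_combl pu pv zu !mulr0 addr0 add0r => /(_ erefl) /eqP.
  by rewrite mulf_eq0 gt_eqF//= => /eqP.
have vE : v = scale_tuple (minkowski u v) u.
  apply: eq_from_tnth => i; set d : n.+1.-tuple R := [tuple (j == i)%:R | j < n.+1].
  have := perp (comb 1 d (- minkowski d u) u).
  rewrite !minkowski_combl uu !mulr1 !mul1r subrr => /(_ erefl) /eqP.
  rewrite mulNr subr_eq0 !minkowski_delta tnth_scale_tuple => /eqP.
  by case: ifP => _; lra.
have [e [e0 Fe _]] := future_pert u 0 Fp ltr01.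
have := Huv _ Fe; rewrite !minkowski_combl pu pv uu !mulr0 !add0r mulr1 => /(_ e0).
rewrite pmulr_rgt0// => uv0.
have : minkowski u v = 1.
  have := vv; rewrite /dS /= {1 2}vE minkowski_scalel minkowski_scaler uu mulr1 -expr2 => /eqP.
  by rewrite sqrf_eq1 => /orP[/eqP//|/eqP h]; move: uv0; rewrite h; lra.
by move=> c1; rewrite vE c1; apply: eq_from_tnth => i; rewrite tnth_scale_tuple mul1r.
Qed.

Lemma closed_halfP v y : future y ->
  closed_half v (scale_tuple (Num.sqrt (- minkowski y y))^-1 y) <-> minkowski y v <= 0.
Proof.
move=> Fy; have Iy := future_hyperboloid Fy.
have [yy _] := Fy; have s0 : 0 < (Num.sqrt (- minkowski y y))^-1.
  by rewrite invr_gt0 sqrtr_gt0 oppr_gt0.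
split.
  move=> [_ yv]; rewrite leNgt; apply/negP => yv'; apply: yv; split => //.
  by rewrite minkowski_scalel mulr_gt0.
by move=> yv; split => // -[_]; rewrite minkowski_scalel pmulr_rgt0// ltNge yv.
Qed.

(** A point on the wall of [v] belongs to the closed half-space; a small move towards [v] leaves it
    but cannot leave the open half-space of [u]. *)
Lemma open_neq_closed u v : dS u -> dS v -> open_half u <> closed_half v.
Proof.
move=> uu vv uv; have [p [Fp pv]] : exists p, future p /\ minkowski p v = 0.
  by exists (touching v); exact: touchingP.
have H y : future y -> 0 < minkowski y u <-> minkowski y v <= 0.
  move=> Fy; rewrite -closed_halfP// -uv; have [yy _] := Fy.
  have s0 : 0 < (Num.sqrt (- minkowski y y))^-1 by rewrite invr_gt0 sqrtr_gt0 oppr_gt0.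
  split.
    by move=> yu; split; [exact: future_hyperboloid|rewrite minkowski_scalel mulr_gt0].
  by move=> [_]; rewrite minkowski_scalel pmulr_rgt0.
have pu : 0 < minkowski p u by apply/H => //; rewrite pv.
have [e [e0 Fe pe]] := future_pert v (minkowski v u) Fp pu.
have := H _ Fe; rewrite !minkowski_combl pv vv mul1r mulr0 add0r mulr1 => -[/(_ pe)].
by rewrite leNgt e0.
Qed.

(* Admissibility in terms of normal vectors; half-spaces are compared on the open
   future cone, where small linear perturbations stay inside. *)
Definition coherent (tau : set (n.+1.-tuple R)) : Prop :=
  [/\ tau `<=` dS,
      forall u v, tau u -> dS v ->
        (forall y, future y -> 0 < minkowski y u -> 0 < minkowski y v) -> tau v,
      forall u, tau u -> ~ tau (scale_tuple (-1) u) &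
      forall u v, dS u -> ~ tau u -> dS v ->
        (forall y, future y -> minkowski y u <= 0 -> 0 < minkowski y v) -> tau v].

Lemma dS_opp u : dS u -> dS (scale_tuple (-1) u).
Proof. by move=> uu; rewrite /dS /= minkowski_scalel minkowski_scaler uu; ring. Qed.

Lemma chosen_open tau u : tau `<=` dS -> dS u -> chosen tau (open_half u) -> tau u.
Proof.
move=> tS uu [[v [vv tv] uv]|[v [vv tv] uv]]; last by case: (open_neq_closed uu vv uv).
by rewrite (open_half_inj uu vv uv).
Qed.

Lemma admissible_coherent tau : tau `<=` dS -> admissible tau -> coherent tau.
Proof.
move=> tS adm; split => //.
- move=> u v tu vv H; apply: chosen_open => //; apply: (adm (open_half u)).
  + by left; exists u => //; split => //; exact: tS.
  + by exists v => //; left.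
  + by move=> x [Ix xu]; split => //; apply: H => //; exact: hyperboloid_future.
(* The open half-space of [u] lies in the closed half-space of its opposite, so the latter is chosen
   and the open one on the same wall is not. *)
- move=> u tu tNu; have uu := tS _ tu; have uN := dS_opp uu.
  have : chosen tau (closed_half (scale_tuple (-1) u)).
    apply: (adm (open_half u)).
    + by left; exists u.
    + by exists (scale_tuple (-1) u) => //; right.
    + move=> x [Ix xu]; split => // -[_].
      by rewrite minkowski_scaler mulN1r oppr_gt0 ltNge ltW.
  move=> [[v [vv tv] uv]|[v [vv tv] uv]]; first by case: (open_neq_closed vv uN (esym uv)).
  apply: tv; rewrite -(@open_half_inj (scale_tuple (-1) u) v)//.
  have sub w x : open_half w x <-> hyperboloid x /\ ~ closed_half w x.
    split; first by move=> wx; split; [case: wx|case].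
    by move=> [Ix nc]; apply: contrapT => nw; apply: nc.
  by apply/seteqP; split => x /sub [Ix nc]; apply/sub; split => //; [rewrite -uv|rewrite uv].
- move=> u v uu tu vv H; apply: chosen_open => //; apply: (adm (closed_half u)).
  + by right; exists u.
  + by exists v => //; left.
  + move=> x [Ix xu]; split => //; apply: H; first exact: hyperboloid_future.
    by rewrite leNgt; apply/negP => xu'; apply: xu.
Qed.

End minkowski_algebra.

(** * Lorentz reflections *)

Section lorentz.
Context {R : realType} {n : nat}.
Implicit Types (x y z u v w : n.+1.-tuple R) (a b c e : R) (tau : set (n.+1.-tuple R)).

(** Linearity is stated through [sub_tuple] and [scale_tuple], the form used by
    [lebesgue_tuple_involution] and by cones. Reflections and the identity suffice below; composites
    are applied one factor at a time. *)
Definition lorentz_involution (L : n.+1.-tuple R -> n.+1.-tuple R) : Prop :=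
  [/\ measurable_fun [set: n.+1.-tuple R] L, {morph L : y z / sub_tuple y z}, involutive L,
      forall c y, L (scale_tuple c y) = scale_tuple c (L y) &
      forall y z, minkowski (L y) (L z) = minkowski y z].

Definition reflection w y := comb 1 y (- (2 * minkowski y w / minkowski w w)) w.

Lemma reflection_lorentz w : minkowski w w != 0 -> lorentz_involution (reflection w).
Proof.
move=> ww; split.
- apply/measurable_fun_tnthP => i.
  rewrite (_ : _ \o _ = fun y => tnth y i - 2 * minkowski y w / minkowski w w * tnth w i); last first.
    by apply/funext => y /=; rewrite tnth_comb mul1r mulNr.
  apply: measurable_funB; first exact: measurable_tnth.
  apply: measurable_funM => //; apply: measurable_funM => //; apply: measurable_funM => //.
  exact: measurable_minkowski.
- move=> y z; apply: eq_from_tnth => i.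
  rewrite tnth_sub_tuple !tnth_comb tnth_sub_tuple sub_comb minkowski_combl.
  by field.
- move=> y; apply: eq_from_tnth => i.
  rewrite /reflection !tnth_comb minkowski_combl.
  by field.
- move=> c y; apply: eq_from_tnth => i.
  rewrite /reflection tnth_scale_tuple !tnth_comb tnth_scale_tuple minkowski_scalel.
  by field.
- move=> y z; rewrite /reflection !(minkowski_combl, minkowski_combr) (minkowskiC w z).
  by field.
Qed.

Lemma id_lorentz : lorentz_involution id.
Proof. by split. Qed.

Lemma minkowski_sub x y : minkowski (sub_tuple x y) (sub_tuple x y) =
  minkowski x x + minkowski y y - 2 * minkowski x y.
Proof.
by rewrite sub_comb !(minkowski_combl, minkowski_combr) (minkowskiC y x); ring.
Qed.

Lemma reflection_swap x y : minkowski x x = minkowski y y ->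
  minkowski (sub_tuple x y) (sub_tuple x y) != 0 ->
  reflection (sub_tuple x y) x = y.
Proof.
move=> xy ww; apply: eq_from_tnth => i.
have xw : 2 * minkowski x (sub_tuple x y) = minkowski (sub_tuple x y) (sub_tuple x y).
  by rewrite minkowski_sub -xy sub_comb minkowski_combr; ring.
by rewrite tnth_comb xw mulfV// tnth_sub_tuple; ring.
Qed.

Lemma reflection_perp w y : minkowski y w = 0 -> reflection w y = y.
Proof.
move=> yw; apply: eq_from_tnth => i.
by rewrite tnth_comb yw mulr0 mul0r oppr0 mul0r mul1r addr0.
Qed.

Lemma minkowski_originl y : minkowski origin y = - tnth y ord0.
Proof. by rewrite minkowskiC minkowski_origin. Qed.

Lemma origin_hyperboloid : hyperboloid (origin : n.+1.-tuple R).
Proof. by split; rewrite ?minkowski_origin tnth_origin0. Qed.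

Lemma hyperboloid_gt1 x : hyperboloid x -> x != origin -> 1 < tnth x ord0.
Proof.
move=> [xx x0]; apply: contraNT; rewrite -leNgt => x1.
set S := \sum_(i < n) tnth x (lift ord0 i) ^+ 2.
have S0 : 0 <= S by apply: sumr_ge0 => i _; exact: sqr_ge0.
have SE : S = tnth x ord0 ^+ 2 - 1.
  move: xx; rewrite /minkowski (eq_bigr (fun i => tnth x (lift ord0 i) ^+ 2)) -/S.
    by move=> /eqP; rewrite addrC subr_eq addrC => /eqP ->; rewrite -expr2.
  by move=> i _; rewrite expr2.
have x01 : tnth x ord0 = 1 by apply/eqP; rewrite eq_le x1; nra.
have {}SE : S = 0 by rewrite SE x01 expr1n subrr.
apply/eqP/eq_from_tnth => i; case: (unliftP ord0 i) => [j|] ->; last by rewrite x01.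
rewrite [RHS](tnth_nth 0) /= nth_nseq if_same.
apply/eqP; rewrite -sqrf_eq0; move/eqP: SE.
by rewrite psumr_eq0 => [/allP /(_ j (mem_index_enum j))|k _]; last exact: sqr_ge0.
Qed.

(** The reflection along [origin - x], which is spacelike because the time coordinate of [x] exceeds
    1 when the two differ. It preserves the future because the product of [L y] with [origin] is
    that of [y] with [x], hence negative. *)
Lemma exists_lorentz_origin x : hyperboloid x ->
  exists L, [/\ lorentz_involution L, L origin = x &
    forall y, future y -> future (L y)].
Proof.
move=> Ix; have [->|xo] := eqVneq x origin; first by exists id; split => //; exact: id_lorentz.
have x1 := hyperboloid_gt1 Ix xo; have [xx _] := Ix; have [oo _] := origin_hyperboloid.
have ww : minkowski (sub_tuple origin x) (sub_tuple origin x) != 0.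
  by rewrite minkowski_sub xx oo minkowski_originl; lra.
have Lx : reflection (sub_tuple origin x) origin = x by rewrite reflection_swap// xx oo.
have LL := reflection_lorentz ww.
exists (reflection (sub_tuple origin x)); split => // y Fy.
have [mL LB LK LZ LM] := LL; split; first by rewrite LM; case: Fy.
have := LM (reflection (sub_tuple origin x) y) origin.
rewrite LK Lx minkowski_origin => yx.
by rewrite -oppr_lt0 -yx; apply: minkowski_future => //; exact: hyperboloid_future.
Qed.

(** The vector [v - u] has time coordinate 0, so the reflection along it fixes [origin], and it is
    spacelike unless it vanishes. *)
Lemma exists_lorentz_spacelike u v : minkowski u u = minkowski v v ->
  tnth u ord0 = tnth v ord0 ->
  exists L, [/\ lorentz_involution L, L v = u, L origin = origin &
    forall y, future y -> future (L y)].
Proof.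
move=> uv u0; have [->|vu] := eqVneq u v; first by exists id; split => //; exact: id_lorentz.
set w := sub_tuple v u.
have w0 : tnth w ord0 = 0 by rewrite tnth_sub_tuple u0 subrr.
have ww : minkowski w w != 0.
  apply: contra vu; rewrite /minkowski w0 mul0r oppr0 add0r psumr_eq0; last first.
    by move=> i _; rewrite -expr2 sqr_ge0.
  move=> /allP H; apply/eqP/eq_from_tnth => i; apply/esym/eqP.
  case: (unliftP ord0 i) => [j|] ->; last by rewrite u0.
  have := H j (mem_index_enum j); rewrite /= mulf_eq0 orbb.
  by rewrite tnth_sub_tuple subr_eq0.
have [mL LB LK LZ LM] := reflection_lorentz ww.
have Lo : reflection w origin = origin.
  by apply: reflection_perp; rewrite minkowski_originl w0 oppr0.
exists (reflection w); split => //.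
- by apply: reflection_swap; rewrite ?uv.
- move=> y Fy; split; first by rewrite LM; case: Fy.
  have := LM y origin; rewrite Lo !minkowski_origin => /oppr_inj ->.
  by case: Fy.
Qed.

Lemma lorentz_dS L u : lorentz_involution L -> dS (L u) <-> dS u.
Proof. by move=> [_ _ _ _ LM]; rewrite /dS /= LM. Qed.

Lemma lorentz_hyperboloid L x : lorentz_involution L ->
  (forall y, future y -> future (L y)) -> hyperboloid x -> hyperboloid (L x).
Proof.
move=> [_ _ _ _ LM] LF Ix; split; first by rewrite LM; case: Ix.
by have [] := LF _ (hyperboloid_future Ix).
Qed.

Lemma coherent_preimage L tau : lorentz_involution L ->
  (forall y, future y -> future (L y)) -> coherent tau -> coherent (L @^-1` tau).
Proof.
move=> LL LF [t0 t1 t2 t3]; have [mL LB LK LZ LM] := LL.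
have LMl y z : minkowski y (L z) = minkowski (L y) z by rewrite -{1}(LK y) LM.
split.
- by move=> u /t0 /(lorentz_dS _ LL).
- move=> u v tu vv H; apply: (t1 (L u)) => //; first exact/lorentz_dS.
  by move=> y Fy; rewrite !LMl; apply: H; exact: LF.
- by move=> u tu; rewrite /= LZ; exact: t2.
- move=> u v uu tu vv H; apply: (t3 (L u)) => //; try exact/lorentz_dS.
  by move=> y Fy; rewrite !LMl; apply: H; exact: LF.
Qed.

Lemma point_section_preimage L x : lorentz_involution L ->
  L @^-1` point_section x = point_section (L x).
Proof.
move=> LL; have [mL LB LK LZ LM] := LL.
have LMl z : minkowski x (L z) = minkowski (L x) z by rewrite -{1}(LK x) LM.
by apply/seteqP; split => u; rewrite /point_section /= LMl lorentz_dS.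
Qed.

Lemma dS_measure_lorentz L A : (0 < n)%N -> lorentz_involution L ->
  dS_measure (L @^-1` A) = dS_measure A.
Proof. by move=> n0 [mL LB LK LZ LM]; exact: dS_measure_involution. Qed.

Lemma dS_measurable_lorentz L A : (0 < n)%N -> lorentz_involution L ->
  dS_measurable A -> dS_measurable (L @^-1` A).
Proof. by move=> n0 [mL LB LK LZ LM]; exact: dS_measurable_involution. Qed.

Lemma preimage_setY (T T' : Type) (f : T -> T') (A B : set T') :
  f @^-1` (A `+` B) = f @^-1` A `+` f @^-1` B.
Proof. by []. Qed.

Lemma dS_measure_section L tau x : (0 < n)%N -> lorentz_involution L ->
  dS_measure (L @^-1` tau `+` point_section x) =
  dS_measure (tau `+` point_section (L x)).
Proof.
move=> n0 LL; have [_ _ LK _ _] := LL.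
by rewrite -[in LHS](LK x) -point_section_preimage// -preimage_setY dS_measure_lorentz.
Qed.

End lorentz.

(** * Moving a point towards a chosen half-space *)

Section wedge.
Context {R : realType}.
Local Notation leb := (@lebesgue_measure R).
Local Notation lebt := (@lebesgue_tuple R).

Lemma integral_lebesgue_scale n (c : R) (f : n.-tuple R -> \bar R) : 0 < c ->
  measurable_fun [set: _] f -> (forall y, 0 <= f y)%E ->
  ((c ^+ n)%:E * \int[lebt n]_y f (scale_tuple c y) = \int[lebt n]_y f y)%E.
Proof.
move=> c0 mf f0; have mc := @measurable_scale_tuple R n c.
rewrite -(ge0_integral_pushforwardT (lebt n) mc mf f0).
pose m := measure_function_pushforward__canonical__measure_function_Measure (lebt n) mc.
rewrite -[X in (X * _)%E]/((NngNum (exprn_ge0 n (ltW c0)))%:num%:E).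
rewrite -[X in (_ * X)%E]/(\int[m]_x f x)%E.
rewrite -(@ge0_integral_mscale _ _ _ m setT)//.
apply: eq_measure_integral => B mB _.
exact: lebesgue_tuple_scale.
Qed.

Variable m : nat.
Implicit Types (b : bool) (T s r : R) (w : m.+2.-tuple R) (z : m.-tuple R).

(* Moving from [origin] towards [planar 1 T] crosses exactly the walls with
   [0 <= w_0 < T w_1] and the opposites of those with [0 < w_0 <= T w_1]. *)
Definition half_open b (x y : R) : bool := if b then 0 <= x < y else 0 < x <= y.

Lemma half_open_gt0 b x y : half_open b x y -> 0 <= x /\ 0 < y.
Proof. by case: b => /andP[x0 xy]; split; lra. Qed.

Lemma half_openM b r x y : 0 < r -> half_open b (r * x) (r * y) = half_open b x y.
Proof.
by move=> r0; case: b; rewrite /half_open !(ltr_pM2l, ler_pM2l, pmulr_rge0, pmulr_rgt0).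
Qed.

(** Here [s] is the sine of the angle between the spatial part and e_1. The truncation is by the
    Euclidean norm of the spatial part, not by the Minkowski form: this makes the volume exactly
    computable, and the two truncations are compared later through [r]. *)
Definition wedge b T s r : set (m.+2.-tuple R) :=
  [set w | [/\ half_open b (tnth w ord0) (T * tnth w (lift ord0 ord0)),
    \sum_(i < m) tnth w (lift ord0 (lift ord0 i)) ^+ 2 <=
      s ^+ 2 * (\sum_(i < m.+1) tnth w (lift ord0 i) ^+ 2) &
    \sum_(i < m.+1) tnth w (lift ord0 i) ^+ 2 <= r ^+ 2]].

Lemma wedge_cons b T s r x y z : wedge b T s r (cons_pair (x, cons_pair (y, z))) <->
  [/\ half_open b x (T * y), enorm z ^+ 2 <= s ^+ 2 * (y ^+ 2 + enorm z ^+ 2) &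
      y ^+ 2 + enorm z ^+ 2 <= r ^+ 2].
Proof.
rewrite /wedge /= big_ord_recl tnth_cons_pair0 tnth_cons_pairS tnth_cons_pair0 sqr_enorm.
have E i : tnth (cons_pair (x, cons_pair (y, z))) (lift ord0 (lift ord0 i)) = tnth z i.
  by rewrite !tnth_cons_pairS.
by under eq_bigr do rewrite E.
Qed.

Lemma measurable_le (d : measure_display) (X : measurableType d) (f g : X -> R) :
  measurable_fun [set: X] f -> measurable_fun [set: X] g ->
  measurable [set x | f x <= g x].
Proof.
move=> mf mg; rewrite (_ : [set _ | _] = (fun x => g x - f x) @^-1` `[0, +oo[).
  apply: (@measurable_preimage _ _ _ (measurableTypeR R) (fun x => g x - f x : measurableTypeR R)) => //.
  exact: measurable_funB.
by apply/seteqP; split => x /=; rewrite in_itv /= andbT subr_ge0.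
Qed.

Lemma measurable_lt (d : measure_display) (X : measurableType d) (f g : X -> R) :
  measurable_fun [set: X] f -> measurable_fun [set: X] g ->
  measurable [set x | f x < g x].
Proof.
move=> mf mg; rewrite (_ : [set _ | _] = ~` [set x | g x <= f x]).
  by apply: measurableC; exact: measurable_le.
by apply/seteqP; split => x /=; rewrite ltNge; move/negP.
Qed.

Lemma measurable_wedge b T s r : measurable (wedge b T s r).
Proof.
have mt (i : 'I_m.+2) : measurable_fun [set: _] (fun w => tnth w i) by exact: measurable_tnth.
rewrite (_ : wedge b T s r = [set w | half_open b (tnth w ord0) (T * tnth w (lift ord0 ord0))] `&`
  [set w | \sum_(i < m) tnth w (lift ord0 (lift ord0 i)) ^+ 2 <=
      s ^+ 2 * (\sum_(i < m.+1) tnth w (lift ord0 i) ^+ 2)] `&`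
  [set w | \sum_(i < m.+1) tnth w (lift ord0 i) ^+ 2 <= r ^+ 2]).
  apply: measurableI; [apply: measurableI|].
  - have mT : measurable_fun [set: _] (fun w => T * tnth w (lift ord0 ord0)).
      exact: measurable_funM.
    have m0 : measurable_fun [set: m.+2.-tuple R] (fun=> (0 : R)) by [].
    case: b.
      rewrite (_ : [set _ | _] = [set w | 0 <= tnth w ord0] `&`
          [set w | tnth w ord0 < T * tnth w (lift ord0 ord0)]).
        by apply: measurableI; [exact: measurable_le|exact: measurable_lt].
      by apply/seteqP; split => w /=; [move/andP|move=> ?; apply/andP].
    rewrite (_ : [set _ | _] = [set w | 0 < tnth w ord0] `&`
        [set w | tnth w ord0 <= T * tnth w (lift ord0 ord0)]).
      by apply: measurableI; [exact: measurable_lt|exact: measurable_le].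
    by apply/seteqP; split => w /=; [move/andP|move=> ?; apply/andP].
  - apply: measurable_le.
      by apply: measurable_sum => i; apply: measurable_funX.
    by apply: measurable_funM => //; apply: measurable_sum => i; apply: measurable_funX.
  - by apply: measurable_le => //; apply: measurable_sum => i; apply: measurable_funX.
apply/seteqP; split => w; first by move=> [? ? ?].
by move=> [[? ?] ?].
Qed.

(** The integral of y over the part of the half-ball y >= 0, y^2 + |z|^2 <= 1 lying over z. *)
Definition paraboloid z : \bar R := (Num.max 0 ((1 - enorm z ^+ 2) / 2))%:E.

Lemma paraboloid_ge0 z : (0 <= paraboloid z)%E.
Proof. by rewrite lee_fin le_max lexx. Qed.

Lemma measurable_paraboloid : measurable_fun [set: m.-tuple R] paraboloid.
Proof.
apply/measurable_EFinP; apply: measurable_maxr => //.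
apply: measurable_funM => //; apply: measurable_funB => //.
by apply: measurable_funX; exact: measurable_enorm.
Qed.

Lemma lebesgue_wedge_slice b T s y z : 0 < T -> 0 < s <= 1 ->
  leb [set x | wedge b T s 1 (cons_pair (x, cons_pair (y, z)))] =
  if (0 <= y) && (enorm z ^+ 2 <= s ^+ 2 * (y ^+ 2 + enorm z ^+ 2)) &&
     (y ^+ 2 + enorm z ^+ 2 <= 1) then (T * y)%:E else 0%E.
Proof.
move=> T0 s01; case: ifP => [/andP[/andP[y0 zy] yz]|H].
  rewrite (_ : [set x | _] = [set` Interval (BSide b 0) (BSide b (T * y))]); last first.
    apply/seteqP; split => x /=; rewrite wedge_cons expr1n /half_open in_itv /=.
      by move=> []; case: b.
    by case: b => H; split.
  rewrite lebesgue_measure_itv /= lte_fin; case: ifPn; first by rewrite oppr0 adde0.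
  by rewrite -leNgt => Ty; congr EFin; apply/eqP; rewrite eq_le Ty andbT mulr_ge0// ltW.
rewrite (_ : [set x | _] = set0) ?measure0//; apply/seteqP; split => x //=.
rewrite wedge_cons expr1n => -[/half_open_gt0[_]]; rewrite pmulr_rgt0// => y0 zy yz.
by move/negP: H; apply; rewrite zy yz ltW.
Qed.

Lemma lebesgue_wedge b T s : 0 < T -> 0 < s <= 1 ->
  lebt m.+2 (wedge b T s 1) = ((T * s ^+ m)%:E * \int[lebt m]_z paraboloid z)%E.
Proof.
move=> T0 /andP[s0 s1].
rewrite lebesgue_tupleS2; last exact: measurable_wedge.
rewrite integral_lebesgue_tupleS2; last 2 first.
- have := @measurable_wedge b T s 1.
  move=> /measurable_lebesgue_consP mW.
  rewrite (_ : (fun _ => _) = leb \o ysection (@cons_pair R m.+1 @^-1` wedge b T s 1)).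
    exact: measurable_fun_ysection.
  apply/funext => w /=; congr (leb _); apply/seteqP; split => x; rewrite /ysection /= inE//.
- by move=> y; exact: measure_ge0.
have mP := measurable_paraboloid.
have mPs : measurable_fun [set: m.-tuple R] (paraboloid \o scale_tuple s^-1).
  by apply: measurableT_comp => //; exact: measurable_scale_tuple.
have sK z : scale_tuple s^-1 (scale_tuple s z) = z by rewrite scale_tupleK ?gt_eqF.
have : ((s ^+ m)%:E * \int[lebt m]_z paraboloid z =
    \int[lebt m]_z paraboloid (scale_tuple s^-1 z))%E.
  rewrite -(@integral_lebesgue_scale m s (paraboloid \o scale_tuple s^-1))//.
    by congr (_ * _)%E; apply: eq_integral => z _ /=; rewrite sK.
  by move=> z; exact: paraboloid_ge0.
rewrite EFinM -muleA => ->.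
rewrite -ge0_integralZl//; last 2 first.
- by move=> z _; exact: paraboloid_ge0.
- by rewrite lee_fin ltW.
apply: eq_integral => z _.
under eq_integral do rewrite lebesgue_wedge_slice ?s0//.
rewrite /paraboloid enorm_scale exprMn real_normK ?num_real// exprVn -EFinM.
set q := enorm z ^+ 2; have q0 : 0 <= q by exact: sqr_ge0.
have ss : 0 < s ^+ 2 by rewrite exprn_gt0.
have [qs|qs] := leP q (s ^+ 2); last first.
  rewrite max_l; last first.
    by rewrite ler_pdivrMr// mul0r subr_le0 mulrC ler_pdivlMr// mul1r ltW.
  rewrite mulr0 integral0_eq// => y _; case: ifP => // /andP[/andP[_ h1] h2].
  have := le_trans h1 (ler_wpM2l (ltW ss) h2); rewrite mulr1 leNgt qs//.
rewrite max_r; last first.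
  by rewrite divr_ge0// subr_ge0 mulrC ler_pdivrMr// mul1r.
have ss1 : s ^+ 2 <= 1 by rewrite expr_le1// ltW.
(* The ends of the range of y: the angular condition reads y >= a, the ball condition y <= d. *)
set a := Num.sqrt (q * (s ^- 2 - 1)); set d := Num.sqrt (1 - q).
have aE : a ^+ 2 = q * (s ^- 2 - 1) by rewrite sqr_sqrtr// mulr_ge0// subr_ge0 invf_ge1.
have dE : d ^+ 2 = 1 - q by rewrite sqr_sqrtr// subr_ge0 (le_trans qs).
have a0 : 0 <= a by exact: sqrtr_ge0.
have d0 : 0 <= d by exact: sqrtr_ge0.
have ad : a <= d.
  rewrite -(@ler_pXn2r _ 2)// ?nnegrE// aE dE mulrBr mulr1 lerD2r.
  by rewrite ler_pdivrMr// mul1r.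
transitivity (\int[leb]_(y in `[a, d]) (T%:E * (y ^+ 1)%:E))%E.
  rewrite [RHS]integral_mkcond; apply: eq_integral => y _; rewrite patchE.
  rewrite -EFinM expr1; congr (if _ then _ else _); rewrite mem_setE in_itv /=.
  apply/andP/andP => [[/andP[y0]]|[ay yd]].
    rewrite -lerBrDr => h1 h2.
    split; rewrite -(@ler_pXn2r _ 2)// ?nnegrE// ?aE ?dE; last by lra.
    by rewrite mulrBr mulr1 lerBlDr ler_pdivrMr// [leRHS]mulrC.
  have y0 := le_trans a0 ay.
  move: ay yd; rewrite -(@ler_pXn2r _ 2)// ?nnegrE// aE => h1.
  rewrite -(@ler_pXn2r _ 2)// ?nnegrE// dE => h2.
  rewrite y0 /=; split; last by lra.
  by rewrite [leRHS]mulrC -ler_pdivrMr// -lerBlDr; move: h1; rewrite mulrBr mulr1.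
rewrite ge0_integralZl//; last 3 first.
- by apply/measurable_funTS/measurable_EFinP.
- by move=> y; rewrite /= in_itv /= => /andP[ay _]; rewrite lee_fin expr1 (le_trans a0).
- by rewrite lee_fin ltW.
rewrite integral_exprn// -EFinM aE dE; congr EFin.
by field; rewrite gt_eqF.
Qed.

Lemma lebesgue_wedge_scale b T s r : 0 < T -> 0 < s <= 1 -> 0 < r ->
  lebt m.+2 (wedge b T s r) =
  ((r ^+ m.+2 * (T * s ^+ m))%:E * \int[lebt m]_z paraboloid z)%E.
Proof.
move=> T0 s01 r0; rewrite -(@lebesgue_tuple_scale _ _ r)//; last exact: measurable_wedge.
transitivity ((r ^+ m.+2)%:E * lebt m.+2 (wedge b T s 1))%E; last first.
  by rewrite lebesgue_wedge// muleA -EFinM.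
congr (_ * lebt m.+2 _)%E.
have r2 : 0 < r ^+ 2 by rewrite exprn_gt0.
apply/seteqP; split; apply: cons_pairP => x; apply: cons_pairP => y z;
  rewrite /= !scale_tuple_cons !wedge_cons enorm_scale !exprMn real_normK ?num_real// expr1n;
  rewrite -mulrDr [T * (r * y)]mulrCA [s ^+ 2 * (r ^+ 2 * _)]mulrCA
    !ler_pM2l// ger_pMr// half_openM//.
Qed.

Lemma tnth_le_enorm z i : `|tnth z i| <= enorm z.
Proof.
rewrite -(@ler_pXn2r _ 2)// ?nnegrE// ?enorm_ge0// sqr_enorm real_normK ?num_real//.
by rewrite (bigD1 i)//= lerDl sumr_ge0// => j _; exact: sqr_ge0.
Qed.

Lemma integral_paraboloid_lty : (\int[lebt m]_z paraboloid z < +oo)%E.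
Proof.
set C := [set z : m.-tuple R | forall i, `|tnth z i| <= 1].
have mC : measurable C by exact: measurable_cube.
apply: (@le_lt_trans _ _ (\int[lebt m]_z (\1_C z)%:E)%E); last first.
  have vC : lebt m C = ((1 *+ 2) ^+ m)%:E by exact: lebesgue_cube.
  have -> : (\int[lebt m]_z (\1_C z)%:E = lebt m C)%E by rewrite integral_indic// setIT.
  by rewrite vC ltry.
apply: ge0_le_integral => //.
- by move=> z _; exact: paraboloid_ge0.
- exact: measurable_paraboloid.
- by apply/measurable_EFinP; exact: measurable_indic.
- move=> z _; rewrite lee_fin indicE; case: (boolP (z \in C)) => zC.
    by rewrite ge_max ler01/=; have := sqr_ge0 (enorm z); lra.
  rewrite ge_max lexx ler_pdivrMr// mul0r subr_le0.
  rewrite leNgt; apply: contra zC => z1; rewrite inE => i.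
  apply: le_trans (tnth_le_enorm z i) _.
  by rewrite -(@ler_pXn2r _ 2)// ?nnegrE// ?enorm_ge0// expr1n ltW.
Qed.

Lemma integral_paraboloid_gt0 : (0 < \int[lebt m]_z paraboloid z)%E.
Proof.
(* On the cube of half-side 1 / (m + 1) the squared norm is at most 1/2, so the paraboloid is at
   least 1/4 there. *)
set c : R := m.+1%:R^-1.
have c0 : 0 < c by rewrite invr_gt0.
set C := [set z : m.-tuple R | forall i, `|tnth z i| <= c].
have mC : measurable C by exact: measurable_cube.
apply: (@lt_le_trans _ _ (\int[lebt m]_z ((1 / 4)%:E * (\1_C z)%:E))%E).
  rewrite ge0_integralZl//; last first.
    by apply/measurable_EFinP; exact: measurable_indic.
  have vC : lebt m C = ((c *+ 2) ^+ m)%:E by apply: lebesgue_cube; exact: ltW.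
  have -> : (\int[lebt m]_z (\1_C z)%:E = lebt m C)%E by rewrite integral_indic// setIT.
  rewrite vC -EFinM lte_fin.
  by rewrite mulr_gt0// exprn_gt0// mulrn_wgt0.
apply: ge0_le_integral => //.
- by apply: emeasurable_funM => //; apply/measurable_EFinP; exact: measurable_indic.
- exact: measurable_paraboloid.
- move=> z _; rewrite -EFinM lee_fin indicE; case: (boolP (z \in C)) => zC; last first.
    by rewrite mulr0 le_max lexx.
  have : enorm z ^+ 2 <= m%:R * c ^+ 2.
    rewrite sqr_enorm; apply: (@le_trans _ _ (\sum_(i < m) c ^+ 2)).
      apply: ler_sum => i _; move: zC; rewrite inE => /(_ i).
      move=> zi.
      by rewrite -[leLHS]real_normK ?num_real// ler_pXn2r// nnegrE// ltW.
    by rewrite sumr_const card_ord mulr_natl.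
  have : m%:R * c ^+ 2 <= 1 / 2.
    rewrite /c exprVn ler_pdivrMr ?exprn_gt0// -(natr1 m).
    by have : (0 : R) <= m%:R by []; set x : R := m%:R => x0; nra.
  by move=> h1 h2; rewrite mulr1 le_max; apply/orP; right; lra.
Qed.

Lemma lebesgue_wedge_diff b T s r : 0 < T -> 0 < s <= 1 -> 0 < r ->
  lebt m.+2 (wedge b T 1 r `\` wedge b T s r) =
  ((r ^+ m.+2 * T * (1 - s ^+ m))%:E * \int[lebt m]_z paraboloid z)%E.
Proof.
move=> T0 s01 r0; have K0 := integral_paraboloid_gt0; have Koo := integral_paraboloid_lty.
have KE : (\int[lebt m]_z paraboloid z \is a fin_num)%E by rewrite ge0_fin_numE// ltW.
have sub : wedge b T s r `<=` wedge b T 1 r.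
  apply: cons_pairP => x; apply: cons_pairP => y z; rewrite !wedge_cons => -[? _ ?]; split => //.
  by rewrite expr1n mul1r lerDr sqr_ge0.
rewrite measureD; [|exact: measurable_wedge..|]; last first.
  rewrite -[X in (X < _)%E]/(lebt m.+2 (wedge b T 1 r)) lebesgue_wedge_scale// ?ltr01 ?lexx//.
  by rewrite -(fineK KE) -EFinM ltry.
rewrite (setIidr sub).
rewrite -[LHS]/(lebt m.+2 (wedge b T 1 r) - lebt m.+2 (wedge b T s r))%E.
rewrite !lebesgue_wedge_scale// ?ltr01 ?lexx// -(fineK KE) -!EFinM -EFinB; congr EFin.
by rewrite expr1n; ring.
Qed.

End wedge.

Lemma le_scaled_lebesgue (R : realType) n k (A B : set (n.-tuple R)) :
  measurable A -> measurable B -> A `<=` B ->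
  (k%:R%:E * lebesgue_tuple n A <= k%:R%:E * lebesgue_tuple n B)%E.
Proof.
by move=> mA mB AB; apply: lee_wpmul2l => //; apply: le_measure; rewrite ?inE.
Qed.

Lemma measurable_dS (R : realType) n : measurable (@dS R n).
Proof.
rewrite (_ : dS = (fun w => minkowski w w) @^-1` [set 1]).
  apply: (@measurable_preimage _ _ _ (measurableTypeR R) (fun w => minkowski w w : measurableTypeR R)) => //.
  exact: measurable_minkowski.
by [].
Qed.

(** * The gain of a finite step *)

Section variation.
Context {R : realType} {m : nat}.
Local Notation leb := (@lebesgue_measure R).
Local Notation lebt := (@lebesgue_tuple R).
Implicit Types (b : bool) (T s r : R) (z : m.-tuple R) (u v w : m.+2.-tuple R) (tau : set (m.+2.-tuple R)).

Definition planar (x y : R) : m.+2.-tuple R := cons_pair (x, cons_pair (y, [tuple of nseq m 0])).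

Lemma minkowski_planar x y x' y' z :
  minkowski (planar x y) (cons_pair (x', cons_pair (y', z))) = y * y' - x * x'.
Proof.
rewrite minkowski_cons big_ord_recl !tnth_cons_pair0 big1 ?addr0; first by rewrite addrC.
move=> i _; rewrite tnth_cons_pairS [X in X * _](_ : _ = 0) ?mul0r//.
by rewrite (tnth_nth 0) /= nth_nseq if_same.
Qed.

Lemma minkowski_cons2 x y z :
  minkowski (cons_pair (x, cons_pair (y, z))) (cons_pair (x, cons_pair (y, z))) =
  y ^+ 2 + enorm z ^+ 2 - x ^+ 2.
Proof.
rewrite minkowski_cons_sqr [enorm (cons_pair _) ^+ 2]sqr_enorm big_ord_recl tnth_cons_pair0.
by under eq_bigr do rewrite tnth_cons_pairS; rewrite -sqr_enorm.
Qed.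

(* A wall through the inner wedge is separated from the wall of [planar h 1]:
   the difference of suitable multiples of their normals is future timelike. *)
Lemma wedge_dominated h T s x y z : 0 < h < 1 -> 0 < s < 1 -> 0 < T ->
  2 * T <= h ^+ 2 - s ^+ 2 -> 0 <= x <= T * y -> 0 < y ->
  enorm z ^+ 2 <= s ^+ 2 * (y ^+ 2 + enorm z ^+ 2) ->
  forall p, future p -> 0 < minkowski p (planar h 1) ->
  0 < minkowski p (cons_pair (x, cons_pair (y, z))).
Proof.
move=> /andP[h0 h1] /andP[s0 s1] T0 Ths /andP[x0 xT] y0 zs p Fp ph.
(* With P = [planar h 1] and k the square of P, the square of y P - k w is -k (h^2 y^2 - 2 h x y - k
   |z|^2 + k x^2). Here 2 h x y < 2 T y^2 and k |z|^2 <= s^2 y^2, so the bound on 2 T makes it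
   negative. *)
set w := cons_pair (x, _); set k := 1 - h ^+ 2.
have k0 : 0 < k by rewrite /k; nra.
have Fq : future (comb y (planar h 1) (- k) w).
  split.
    rewrite !(minkowski_combl, minkowski_combr) (minkowskiC w (planar h 1)) !minkowski_planar.
    rewrite /w minkowski_cons2.
    move: zs; set q := enorm z ^+ 2 => zs.
    have q0 : 0 <= q by exact: sqr_ge0.
    have -> : y * (y * (1 * 1 - h * h) + - k * (1 * y - h * x)) +
        - k * (y * (1 * y - h * x) + - k * (y ^+ 2 + q - x ^+ 2)) =
        - (k * (h ^+ 2 * y ^+ 2 - 2 * h * x * y - k * q + k * x ^+ 2)).
      by rewrite /k; ring.
    rewrite oppr_lt0 mulr_gt0//.
    have kq : k * q <= s ^+ 2 * y ^+ 2 by rewrite /k; nra.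
    have xy : x * y <= T * y ^+ 2 by rewrite expr2 mulrA ler_wpM2r// ltW.
    have y2 : 0 < y ^+ 2 by rewrite exprn_gt0.
    have Ty : 0 < T * y ^+ 2 by exact: mulr_gt0.
    have hxy : h * (x * y) < T * y ^+ 2.
      by apply: le_lt_trans (_ : h * (T * y ^+ 2) < _); [rewrite ler_wpM2l// ltW|rewrite gtr_pMl].
    have Thy : 2 * T * y ^+ 2 <= (h ^+ 2 - s ^+ 2) * y ^+ 2 by rewrite ler_wpM2r// ltW.
    have kx : 0 <= k * x ^+ 2 by rewrite mulr_ge0// ?sqr_ge0// ltW.
    by rewrite -!mulrA; lra.
  rewrite tnth_comb !tnth_cons_pair0.
  have kx : k * x <= x by rewrite /k; nra.
  have Th : T < h by nra.
  have : T * y < h * y by rewrite ltr_pM2r.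
  by rewrite mulNr mulrC; lra.
have := minkowski_future Fp Fq.
rewrite minkowski_combr mulNr subr_lt0 => pq.
by rewrite -(pmulr_rgt0 _ k0); apply: lt_trans pq; exact: mulr_gt0.
Qed.

(** The wedge without truncation: invariant under positive scaling, hence a set of walls. *)
Definition sector b T (s : R) : set (m.+2.-tuple R) :=
  [set w | half_open b (tnth w ord0) (T * tnth w (lift ord0 ord0)) /\
    \sum_(i < m) tnth w (lift ord0 (lift ord0 i)) ^+ 2 <=
      s ^+ 2 * (\sum_(i < m.+1) tnth w (lift ord0 i) ^+ 2)].

Lemma sector_cons b T s x y z : sector b T s (cons_pair (x, cons_pair (y, z))) <->
  half_open b x (T * y) /\ enorm z ^+ 2 <= s ^+ 2 * (y ^+ 2 + enorm z ^+ 2).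
Proof.
rewrite /sector /= big_ord_recl tnth_cons_pair0 tnth_cons_pairS tnth_cons_pair0 sqr_enorm.
have E i : tnth (cons_pair (x, cons_pair (y, z))) (lift ord0 (lift ord0 i)) = tnth z i.
  by rewrite !tnth_cons_pairS.
by under eq_bigr do rewrite E.
Qed.

Lemma measurable_sector b T s : measurable (sector b T s).
Proof.
have -> : sector b T s = \bigcup_(k in [set: nat]) wedge b T s k%:R.
  apply/seteqP; split => w; last by move=> [k _ [? ? _]].
  move=> [h1 h2]; set S := \sum_(i < m.+1) tnth w (lift ord0 i) ^+ 2.
  have S0 : 0 <= S by apply: sumr_ge0 => i _; exact: sqr_ge0.
  exists (Num.bound S).+1 => //; split => //; apply: (@le_trans _ _ (Num.bound S).+1%:R).
    apply: ltW; apply: lt_le_trans (archi_boundP S0) _.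
    by rewrite ler_nat.
  by rewrite -natrX ler_nat expnS expn1 leq_pmull.
by apply: bigcup_measurable => k _; exact: measurable_wedge.
Qed.

Lemma sector_scale b T s c w : 0 < c -> sector b T s (scale_tuple c w) <-> sector b T s w.
Proof.
move=> c0; move: w; apply: cons_pairP => x; apply: cons_pairP => y z.
rewrite !scale_tuple_cons !sector_cons enorm_scale !exprMn real_normK ?num_real//.
by rewrite -mulrDr [T * (c * y)]mulrCA [s ^+ 2 * (c ^+ 2 * _)]mulrCA
    ler_pM2l ?exprn_gt0// half_openM.
Qed.

Lemma dS_scale w : 0 < minkowski w w -> dS (scale_tuple (Num.sqrt (minkowski w w))^-1 w).
Proof.
move=> w0; rewrite /dS /= minkowski_scalel minkowski_scaler mulrA -expr2 exprVn.
by rewrite sqr_sqrtr ?ltW// mulVf// gt_eqF.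
Qed.

Lemma dS_measure_cone (A : set (m.+2.-tuple R)) : measurable A ->
  dS_measure A = (m.+2%:R%:E * lebt m.+2 (dS_cone A))%E.
Proof. by move=> mA; rewrite dS_measureE// dS_borel_measureE. Qed.

(** The Minkowski square is at most the squared spatial norm, and positive on the wedge because T <
    1; so the wedge of radius 1 lies in the cone over the sector. *)
Lemma dS_measure_sector_ge b T s : 0 < T < 1 -> 0 < s <= 1 ->
  ((m.+2%:R * (T * s ^+ m))%:E * \int[lebt m]_z paraboloid z <=
   dS_measure (@dS R m.+1 `&` sector b T s))%E.
Proof.
move=> /andP[T0 T1] s01.
have mS : measurable (@dS R m.+1 `&` sector b T s).
  by apply: measurableI; [exact: measurable_dS|exact: measurable_sector].
have -> : ((m.+2%:R * (T * s ^+ m))%:E * \int[lebt m]_z paraboloid z =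
    m.+2%:R%:E * lebt m.+2 (wedge b T s 1))%E.
  by rewrite lebesgue_wedge// muleA -EFinM.
rewrite (dS_measure_cone mS).
apply: le_scaled_lebesgue.
- exact: measurable_wedge.
- exact: measurable_dS_cone.
apply: cons_pairP => x; apply: cons_pairP => y z; rewrite wedge_cons expr1n => -[xy zs yz].
set w := cons_pair (x, _).
have [x0 Ty0] := half_open_gt0 xy.
have y0 : 0 < y by rewrite -(pmulr_rgt0 _ T0).
have xTy : x <= T * y by move: xy; case: (b) => /andP[]// _ /ltW.
have xy' : x < y by apply: le_lt_trans xTy _; rewrite gtr_pMl.
have w0 : 0 < minkowski w w <= 1.
  rewrite minkowski_cons2; have := sqr_ge0 (enorm z); have := sqr_ge0 x.
  have : x ^+ 2 < y ^+ 2 by rewrite ltr_pXn2r// nnegrE// ltW.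
  by lra.
split => //; have /andP[w0' _] := w0; split; first exact: dS_scale.
by apply/sector_scale; [rewrite invr_gt0 sqrtr_gt0|apply/sector_cons].
Qed.

(** From x <= T y, the Minkowski square is at least 1 - T^2 times the squared spatial norm, so
    truncating it at 1 keeps the spatial norm below r. The factor r^(m+2) is the price of a finite
    step. *)
Lemma dS_measure_sector_le b T s r : 0 < T < 1 -> 0 < s <= 1 -> 0 < r ->
  1 <= (1 - T ^+ 2) * r ^+ 2 ->
  (dS_measure (@dS R m.+1 `&` (sector b T 1 `\` sector b T s)) <=
   (m.+2%:R * (r ^+ m.+2 * T * (1 - s ^+ m)))%:E * \int[lebt m]_z paraboloid z)%E.
Proof.
move=> /andP[T0 T1] s01 r0 Tr.
have mS : measurable (@dS R m.+1 `&` (sector b T 1 `\` sector b T s)).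
  apply: measurableI; first exact: measurable_dS.
  by apply: measurableD; exact: measurable_sector.
have -> : ((m.+2%:R * (r ^+ m.+2 * T * (1 - s ^+ m)))%:E * \int[lebt m]_z paraboloid z =
    m.+2%:R%:E * lebt m.+2 (wedge b T 1 r `\` wedge b T s r))%E.
  by rewrite lebesgue_wedge_diff// muleA -EFinM.
rewrite (dS_measure_cone mS).
apply: le_scaled_lebesgue.
- exact: measurable_dS_cone.
- by apply: measurableD; exact: measurable_wedge.
apply: cons_pairP => x; apply: cons_pairP => y z.
set w := cons_pair (x, _); move=> [/andP[w0 w1] [_ [S1 Ss]]].
have c0 : 0 < (Num.sqrt (minkowski w w))^-1 by rewrite invr_gt0 sqrtr_gt0.
move: S1 => /(sector_scale _ _ _ _ c0) /sector_cons [xy zs].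
have [x0 Ty0] := half_open_gt0 xy.
have xTy : x <= T * y by move: xy; case: (b) => /andP[]// _ /ltW.
split; last first.
  move=> /wedge_cons[xy' zs' _]; apply: Ss; apply/sector_scale => //.
  exact/sector_cons.
apply/wedge_cons; split => //.
move: w1; rewrite minkowski_cons2 => w1.
have xx : x ^+ 2 <= T ^+ 2 * y ^+ 2 by rewrite -exprMn ler_pXn2r// nnegrE// ltW.
have TT : 0 < 1 - T ^+ 2 by rewrite subr_gt0 expr_lt1// ltW.
rewrite -(ler_pM2l TT); apply: le_trans Tr; apply: le_trans w1.
have : 0 <= T ^+ 2 * enorm z ^+ 2 by rewrite mulr_ge0// sqr_ge0.
by move: xx; set q := enorm z ^+ 2; set t := T ^+ 2; set y2 := y ^+ 2; lra.
Qed.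

End variation.

Section variation.
Context {R : realType} {m : nat}.
Local Notation lebt := (@lebesgue_tuple R).
Implicit Types (b : bool) (T s r : R) (z : m.-tuple R) (u v w : m.+2.-tuple R) (tau : set (m.+2.-tuple R)).

Definition opp_tuple n := @scale_tuple R n (-1).

Lemma opp_tupleK n : involutive (@opp_tuple n).
Proof. by move=> y; apply: eq_from_tnth => i; rewrite !tnth_scale_tuple; ring. Qed.

Lemma dS_measure_opp n (A : set (n.+1.-tuple R)) : (0 < n)%N ->
  dS_measure (@opp_tuple n.+1 @^-1` A) = dS_measure A.
Proof.
move=> n0; apply: dS_measure_involution => //.
- exact: measurable_scale_tuple.
- move=> y z; apply: eq_from_tnth => i.
  by rewrite /opp_tuple !(tnth_scale_tuple, tnth_sub_tuple); ring.
- exact: opp_tupleK.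
- move=> c y; apply: eq_from_tnth => i.
  by rewrite /opp_tuple !tnth_scale_tuple; ring.
- by move=> y; rewrite /opp_tuple minkowski_scalel minkowski_scaler; ring.
Qed.

(** For h = tanh r this is the unit vector (sinh r, cosh r, 0, ..., 0). *)
Definition boosted (h : R) : m.+2.-tuple R :=
  scale_tuple (Num.sqrt (1 - h ^+ 2))^-1 (planar h 1).

Lemma sector_coherent b h T s tau u : 0 < h < 1 -> 0 < s < 1 -> 0 < T ->
  2 * T <= h ^+ 2 - s ^+ 2 -> coherent tau -> tau (boosted h) ->
  dS u -> sector b T s u -> tau u.
Proof.
move=> h01 s01 T0 Ths [_ tau1 _ _] tauh; move: u; apply: cons_pairP => x.
apply: cons_pairP => y z uu /sector_cons[xy zs].
have [x0 Ty0] := half_open_gt0 xy; rewrite pmulr_rgt0// in Ty0.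
apply: (tau1 _ _ tauh uu) => p Fp; rewrite minkowski_scaler pmulr_rgt0; last first.
  rewrite invr_gt0 sqrtr_gt0 subr_gt0; case/andP: h01 => h0 h1.
  by rewrite expr_lt1// ltW.
move=> ph; apply: (wedge_dominated h01 s01 T0 Ths) => //.
by rewrite x0; move: xy; case: (b) => /andP[]// _ /ltW.
Qed.

(** The strict inequality leaves room three times: [s] just below [h] keeps s^m > 1/2, then [r] just
    above 1 keeps r^(m+2) (1 - s^m) < s^m, and finally [T] is taken small. *)
Lemma exists_wedge_params h : 0 < h < 1 -> 1 / 2 < h ^+ m ->
  exists s r T, [/\ 0 < s < 1, 0 < T < 1, 0 < r &
    [/\ 2 * T <= h ^+ 2 - s ^+ 2, 1 <= (1 - T ^+ 2) * r ^+ 2 &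
     r ^+ m.+2 * (1 - s ^+ m) < s ^+ m]].
Proof.
move=> /andP[h0 h1] hm.
have [s [s0 sh sm]] : exists s, [/\ 0 < s, s < h & 1 / 2 < s ^+ m].
  have : \forall s \near h^'-, [/\ 0 < s, s < h & 1 / 2 < s ^+ m].
    near=> s; split; near: s.
    - exact: nbhs_left_gt.
    - exact: nbhs_left_lt.
    - have /cvg_at_left_filter cv := @exprn_continuous R m h.
      exact: cvgr_gt cv _ hm.
  by move=> /filter_ex.
have [r r1 rm] : exists2 r, 1 < r & r ^+ m.+2 * (1 - s ^+ m) < s ^+ m.
  have : \forall r \near 1^'+, 1 < r /\ r ^+ m.+2 * (1 - s ^+ m) < s ^+ m.
    near=> r; split; near: r.
    - exact: nbhs_right_gt.
    - have cv : (fun r : R => r ^+ m.+2 * (1 - s ^+ m)) x @[x --> 1^'+] --> 1 ^+ m.+2 * (1 - s ^+ m).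
        by apply: cvgM; [apply/cvg_at_right_filter/exprn_continuous|exact: cvg_cst].
      by apply: cvgr_lt cv _ _; rewrite expr1n mul1r; lra.
  by move=> /filter_ex [r []]; exists r.
have hs : 0 < h ^+ 2 - s ^+ 2 by nra.
have r2 : 0 < r ^+ 2 by rewrite exprn_gt0//; lra.
have r21 : (r ^+ 2)^-1 < 1 by rewrite invf_lt1// exprn_egt1.
have r20 : 0 < (r ^+ 2)^-1 by rewrite invr_gt0.
(* The second bound suffices because T^2 <= T, so that 1 - T^2 >= r^(-2). *)
set T := Num.min ((h ^+ 2 - s ^+ 2) / 2) (1 - (r ^+ 2)^-1).
have T0 : 0 < T by rewrite lt_min divr_gt0//= subr_gt0.
have T1 : T <= 1 - (r ^+ 2)^-1 by rewrite ge_min lexx orbT.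
have T2 : T <= (h ^+ 2 - s ^+ 2) / 2 by rewrite ge_min lexx.
exists s, r, T; split; rewrite ?T0 ?s0//=; [lra|lra|lra|split => //; first by lra].
by rewrite -ler_pdivrMr// mul1r; nra.
Unshelve. all: by end_near.
Qed.

Lemma point_section_origin u : point_section origin u <-> dS u /\ tnth u ord0 < 0.
Proof. by rewrite /point_section /= minkowskiC minkowski_origin oppr_gt0. Qed.

(** The quantifiers matter: [c] and [g] precede [tau], so the gain can serve as the tolerance when a
    nearly minimizing point is chosen. *)
Lemma variation h : 0 < h < 1 -> 1 / 2 < h ^+ m ->
  exists c g, [/\ 0 < c, hyperboloid g & forall tau, coherent tau -> tau (boosted h) ->
    (dS_measure (tau `+` point_section g) + c%:E <=
     dS_measure (tau `+` point_section origin))%E].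
Proof.
move=> h01 hm; have [s [r [T [s01 T01 r0 [Ths Tr rs]]]]] := exists_wedge_params h01 hm.
have /andP[T0 T1] := T01; have /andP[s0 s1] := s01; have s01' : 0 < s <= 1 by rewrite s0 ltW.
have K0 := @integral_paraboloid_gt0 R m; have Koo := @integral_paraboloid_lty R m.
have KE : (\int[lebt m]_z paraboloid z \is a fin_num)%E by rewrite ge0_fin_numE// ltW.
set K := fine (\int[lebt m]_z paraboloid z)%E.
have {}K0 : 0 < K by rewrite fine_gt0// K0.
(* On each side of the step, [good] is a lower bound for the crossed walls that are forced and [bad]
   an upper bound for the remaining ones; after cancellation [bad < good] is r^(m+2) (1 - s^m) <
   s^m. *)
set good := m.+2%:R * (T * s ^+ m) * K.
set bad := m.+2%:R * (r ^+ m.+2 * T * (1 - s ^+ m)) * K.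
have badgood : bad < good.
  rewrite /bad /good ltr_pM2r// ltr_pM2l// mulrAC [ltLHS]mulrC ltr_pM2l//.
have goodP b : (good%:E <= dS_measure (@dS R m.+1 `&` sector b T s))%E.
  by apply: le_trans (dS_measure_sector_ge b T01 s01'); rewrite /good [leLHS]EFinM fineK.
have badP b : (dS_measure (@dS R m.+1 `&` (sector b T 1 `\` sector b T s)) <= bad%:E)%E.
  by apply: le_trans (dS_measure_sector_le b T01 s01' r0 Tr) _; rewrite /bad [leRHS]EFinM fineK.
have Fg : future (planar 1 T : m.+2.-tuple R).
  split; last by rewrite /planar tnth_cons_pair0.
  by rewrite minkowski_planar subr_lt0 -!expr2 expr1n expr_lt1// ltW.
pose e : m.+2.-tuple R := planar 1 T.
pose g := scale_tuple (Num.sqrt (- minkowski e e))^-1 e.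
have gP x y z : point_section g (cons_pair (x, cons_pair (y, z))) <->
    dS (cons_pair (x, cons_pair (y, z))) /\ x < T * y.
  rewrite /point_section /= minkowski_scalel pmulr_rgt0; last first.
    by case: Fg => [gg _]; rewrite invr_gt0 sqrtr_gt0 oppr_gt0.
  by rewrite minkowski_planar mul1r subr_gt0.
exists (good - bad + (good - bad)), g; split; [lra|exact: future_hyperboloid|].
move=> tau ct th; have [tdS _ tauN _] := ct.
have tauS b u : dS u -> sector b T s u -> tau u.
  exact: sector_coherent h01 s01 T0 Ths ct th.
have oP x y z : point_section origin (cons_pair (x, cons_pair (y, z))) <->
    dS (cons_pair (x, cons_pair (y, z))) /\ x < 0.
  exact: point_section_origin.
set A := tau `+` point_section origin; set B := tau `+` point_section g.
(* [P1] consists of the walls chosen by [g] and not by [origin], [P2] of those chosen by [origin]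
   and not by [g]; with s = 1 the angular condition is void. On [P2] the forced vectors are
   opposites of members of [tau], hence outside [tau]. Outside both sets the two point sections
   agree. *)
pose P1 := @sector R m true T 1.
pose P2 := @opp_tuple m.+2 @^-1` (@sector R m false T 1).
have mP1 : dS_measurable P1 by apply: measurable_dS_measurable; exact: measurable_sector.
have mP2 : dS_measurable P2.
  apply: measurable_dS_measurable; apply: measurable_preimage.
    exact: measurable_scale_tuple.
  exact: measurable_sector.
rewrite (dS_measure_split A mP1) (dS_measure_split B mP1).
rewrite (dS_measure_split (A `\` P1) mP2) (dS_measure_split (B `\` P1) mP2).
have sP1 x y z : P1 (cons_pair (x, cons_pair (y, z))) <-> 0 <= x < T * y.
  rewrite /P1 sector_cons /half_open; split; first by case.
  by split => //; rewrite expr1n mul1r lerDr sqr_ge0.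
have sP2 x y z : P2 (cons_pair (x, cons_pair (y, z))) <-> T * y <= x < 0.
  rewrite /P2 /opp_tuple /= !scale_tuple_cons sector_cons /half_open !mulN1r oppr_gt0.
  rewrite mulrN lerN2 andbC; split; first by case.
  by split => //; rewrite expr1n mul1r lerDr sqr_ge0.
have A1 : (good%:E <= dS_measure (A `&` P1))%E.
  apply: le_trans (goodP true) _; apply: le_dS_measure.
  apply: cons_pairP => x; apply: cons_pairP => y z [uu us].
  have /sector_cons[/andP[x0 xT] _] := us.
  split; last by apply/sP1; rewrite x0.
  left; split; first exact: tauS uu us.
  by move/oP => [_]; rewrite ltNge x0.
have B1 : (dS_measure (B `&` P1) <= bad%:E)%E.
  apply: le_trans _ (badP true); apply: le_dS_measure.
  apply: cons_pairP => x; apply: cons_pairP => y z [[[Bu nBu]|[Bu nBu]] Pu].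
    have /sP1/andP[x0 xT] := Pu; exfalso; apply: nBu; apply/gP; split => //; exact: tdS.
  have /gP[uu _] := Bu; split => //; split => // su; apply: nBu.
  exact: tauS uu su.
have A2 : (good%:E <= dS_measure ((A `\` P1) `&` P2))%E.
  apply: le_trans (goodP false) _; rewrite -dS_measure_opp//; apply: le_dS_measure.
  apply: cons_pairP => x; apply: cons_pairP => y z [uu us].
  have uu' : dS (cons_pair (x, cons_pair (y, z))) by rewrite -[cons_pair _]opp_tupleK; exact: dS_opp.
  have tN := tauS _ _ uu us.
  have Pu : P2 (cons_pair (x, cons_pair (y, z))).
    case: us => h1 _; split => //.
    by rewrite expr1n mul1r [leRHS]big_ord_recl lerDr sqr_ge0.
  have /sP2/andP[xT x0] := Pu.
  split => //; split; last by move=> /sP1/andP[]; rewrite leNgt x0.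
  right; split; first exact/oP.
  by move=> tu; exact: tauN tu tN.
have B2 : (dS_measure ((B `\` P1) `&` P2) <= bad%:E)%E.
  apply: le_trans _ (badP false); rewrite -[leRHS]dS_measure_opp//; apply: le_dS_measure.
  apply: cons_pairP => x; apply: cons_pairP => y z [[[[Bu nBu]|[Bu nBu]] _] Pu].
    have uu := tdS _ Bu; split; first exact: dS_opp.
    by split => // su; apply: tauN Bu _; exact: tauS (dS_opp uu) su.
  have /sP2/andP[xT x0] := Pu.
  by move: Bu => /gP[_]; rewrite ltNge xT.
have AB : (dS_measure ((B `\` P1) `\` P2) <= dS_measure ((A `\` P1) `\` P2))%E.
  apply: le_dS_measure.
  apply: cons_pairP => x; apply: cons_pairP => y z [[Bu nP1] nP2]; split => //; split => //.
  have H : x < T * y <-> x < 0.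
    split => xx; rewrite ltNge; apply/negP => xx'.
      by apply: nP1; apply/sP1; rewrite xx' xx.
    by apply: nP2; apply/sP2; rewrite xx' xx.
  case: Bu => -[].
    by move=> tu gu; left; split => // /oP[uu /H xx]; apply: gu; apply/gP.
  by move=> /gP[uu /H xx] tu; right; split => //; apply/oP.
apply: (@le_trans _ _ (bad%:E + (bad%:E + dS_measure ((A `\` P1) `\` P2)) +
    (good - bad + (good - bad))%:E)%E).
  by apply: leeD => //; apply: leeD => //; exact: leeD.
apply: (@le_trans _ _ (good%:E + (good%:E + dS_measure ((A `\` P1) `\` P2)))%E); last first.
  by apply: leeD => //; exact: leeD.
rewrite !addeA -!EFinD addeAC -EFinD; apply: leeD => //.
by rewrite lee_fin; lra.
Qed.

End variation.

(** * Sections with bounded time coordinate *)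

Section band.
Context {R : realType} {n : nat}.
Implicit Types (u v w : n.+1.-tuple R) (tau : set (n.+1.-tuple R)).

Definition band (a b : R) : set (n.+1.-tuple R) := [set u | a <= tnth u ord0 <= b].

Lemma measurable_band a b : measurable (band a b).
Proof.
rewrite (_ : band a b = (fun u => tnth u ord0) @^-1` `[a, b]).
  apply: (@measurable_preimage _ _ _ (measurableTypeR R) (fun u : n.+1.-tuple R => tnth u ord0 : measurableTypeR R)) => //.
  exact: measurable_tnth.
by apply/seteqP; split => u; rewrite /= in_itv.
Qed.

Lemma ltr_sinh : {homo (@sinh R) : r r' / r < r'}.
Proof.
move=> r r' rr'; rewrite ltr_pM2r ?invr_gt0//; apply: ltrB.
  by rewrite ltr_expR.
by rewrite ltr_expR ltrN2.
Qed.

Lemma ler_sinh : {mono (@sinh R) : r r' / r <= r'}.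
Proof. exact: le_mono ltr_sinh. Qed.

Lemma sinh0 : sinh 0 = 0 :> R.
Proof. by rewrite /sinh oppr0 subrr mul0r. Qed.

Lemma dS_measure_band a b :
  dS_measure (band (sinh a) (sinh b)) =
  (radial_measure n.-1 `[a, b]%classic * @sphere_measure R n setT)%E.
Proof.
rewrite dS_measureE; last exact: measurable_band.
rewrite /dS_borel_measure /pushforward (_ : _ @^-1` _ = `[a, b]%classic `*` setT).
  exact: product_measure2E.
apply/seteqP; split => -[r w]; rewrite /band /= in_itv /=.
  by rewrite !ler_sinh.
by rewrite !ler_sinh => -[].
Qed.

(** If [u] = (x, y) with x < -S is not in [tau], the closed half-space of [u] is chosen. The open
    half-space of the opposite vector misses the wall, so time is lowered from -x to some s > S: the
    vector (s, -k y), with [k] putting it on [dS], has an open half-space containing the closed one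
    and thus lies in [tau], against the bound S. *)
Lemma coherent_symmetric_bound tau (S : R) : 0 <= S -> coherent tau ->
  (forall u, tau u -> tnth u ord0 <= S) ->
  forall u, dS u -> ~ tau u -> - S <= tnth u ord0.
Proof.
move=> S0 [_ _ _ t3] tS; apply: cons_pairP => x y uu tu; rewrite tnth_cons_pair0.
rewrite leNgt; apply/negP => xS.
have [s sS sx] : exists2 s, S < s & s < - x by exists ((S - x) / 2); lra.
have s0 : 0 < s by lra.
pose k := Num.sqrt ((1 + s ^+ 2) / (1 + x ^+ 2)).
have s21 : 0 < 1 + s ^+ 2 by rewrite ltr_pwDl// sqr_ge0.
have x21 : 0 < 1 + x ^+ 2 by rewrite ltr_pwDl// sqr_ge0.
have k0 : 0 < k by rewrite sqrtr_gt0 divr_gt0.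
have kE : k ^+ 2 = (1 + s ^+ 2) / (1 + x ^+ 2) by rewrite sqr_sqrtr// divr_ge0// ltW.
have yE : enorm y ^+ 2 = 1 + x ^+ 2.
  by move: uu; rewrite /dS /= minkowski_cons_sqr => /eqP; rewrite subr_eq => /eqP.
have kx : s < k * - x.
  rewrite -(@ltr_pXn2r _ 2)// ?nnegrE ?mulr_ge0 ?ltW//; last by rewrite (lt_trans s0).
  rewrite exprMn kE sqrrN mulrAC ltr_pdivlMr//.
  have : s ^+ 2 < x ^+ 2 by rewrite -[ltRHS]sqrrN ltr_pXn2r// ?nnegrE// ltW//; lra.
  by lra.
have tv : tau (cons_pair (s, scale_tuple (- k) y)).
  apply: (t3 _ _ uu tu).
    rewrite /dS /= minkowski_cons_sqr enorm_scale exprMn real_normK ?num_real// sqrrN kE yE.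
    by rewrite divfK ?gt_eqF//; ring.
  apply: cons_pairP => p q [_]; rewrite tnth_cons_pair0 => p0.
  rewrite !minkowski_cons.
  under [in X in _ -> X]eq_bigr do rewrite tnth_scale_tuple mulrCA.
  rewrite -mulr_sumr; set A := \sum_(i < n) _; rewrite addrC subr_le0 => Apx.
  have : - (k * (p * x)) <= - k * A by rewrite mulNr lerN2 ler_wpM2l// ltW.
  have : p * s < p * (k * - x) by rewrite ltr_pM2l.
  by lra.
by have := tS _ tv; rewrite tnth_cons_pair0; lra.
Qed.

Lemma dS_measure_coherent tau (r : R) : (0 < n)%N -> 0 <= r ->
  coherent tau -> dS_measurable tau ->
  (forall u, tau u -> tnth u ord0 <= sinh r) ->
  (dS_measure (tau `+` point_section origin) <=
   radial_measure n.-1 `[0%R, r]%classic * @sphere_measure R n setT)%E.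
Proof.
move=> n0 r0 ct mt tS; have [tdS t1 _ _] := ct.
have S0 : 0 <= sinh r by rewrite -sinh0 ler_sinh.
have oo : minkowski origin (origin : n.+1.-tuple R) != 0 by rewrite minkowski_origin tnth_origin0 oppr_eq0 oner_eq0.
have LL := reflection_lorentz oo; set L := reflection origin in LL.
have [_ _ LK _ LM] := LL.
have L0 u : tnth (L u) ord0 = - tnth u ord0.
  by rewrite tnth_comb !minkowski_origin tnth_origin0; field.
have LMl p u : minkowski p (L u) = minkowski p u + 2 * tnth u ord0 * tnth p ord0.
  by rewrite minkowski_combr !minkowski_origin tnth_origin0; field.
pose D := tau `&` [set u | 0 <= tnth u ord0].
pose E := [set u | [/\ dS u, tnth u ord0 < 0 & ~ tau u]].
have mD : dS_measurable D.
  apply: caratheodory_measurable_setI => //; apply: measurable_dS_measurable.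
  apply: measurable_le => //; exact: measurable_tnth.
apply: (@le_trans _ _ (dS_measure D + dS_measure E)%E).
  apply: le_trans (dS_measureU _ _); apply: le_dS_measure => u [[tu ou]|[ou tu]].
    left; split => //=; rewrite leNgt; apply/negP => u0; apply: ou.
    by split; [exact: tdS|rewrite minkowskiC minkowski_origin oppr_gt0].
  right; case: ou => uu; rewrite minkowskiC minkowski_origin oppr_gt0 => u0.
  by split.
rewrite -(dS_measure_lorentz E n0 LL) -dS_measure_band sinh0.
(* When the time coordinate of [u] is nonnegative, reflecting time increases its product with every
   future vector; so the half-space of [L u] contains that of [u], and [tau u] gives [tau (L u)]. *)
have DE u : D u -> (L @^-1` E) u -> False.
  move=> [tu /= u0] [uu _]; apply; apply: (t1 u) => // p [_ p0] pu.
  by rewrite LMl ltr_pwDl// mulr_ge0 ?mulr_ge0// ltW.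
apply: (@le_trans _ _ (dS_measure (D `|` L @^-1` E))).
  (* Additivity over two disjoint pieces: measurability of [tau] enters here, through [D]. *)
  rewrite (dS_measure_split (D `|` L @^-1` E) mD); apply: leeD; apply: le_dS_measure.
    by move=> u Du; split => //; left.
  by move=> u Eu; split; [right|move=> /DE /(_ Eu)].
apply: le_dS_measure => u [[tu /= u0]|[uu u0 tu]]; rewrite /band /=.
  by rewrite u0 tS.
rewrite L0 oppr_lt0 in u0; rewrite ltW//=.
by have := coherent_symmetric_bound S0 ct tS uu tu; rewrite L0 lerN2.
Qed.

End band.

(** * Nearly minimizing points *)

Section near_minimum.
Context {R : realType} {m : nat}.
Implicit Types (u v w : m.+2.-tuple R) (tau : set (m.+2.-tuple R)).

Lemma dS_boosted h : 0 < h < 1 -> dS (boosted h : m.+2.-tuple R).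
Proof.
move=> /andP[h0 h1]; have h2 : 0 < 1 - h ^+ 2 by rewrite subr_gt0 expr_lt1// ltW.
rewrite /dS /= minkowski_scalel minkowski_scaler mulrA -expr2 exprVn sqr_sqrtr ?ltW//.
by rewrite minkowski_planar !mulr1 -expr2 mulVf// gt_eqF.
Qed.

(** On future vectors (p, q, z) the half-space of (sinh r', cosh r', 0, ..., 0) is q / p > tanh r',
    which grows as r' decreases. *)
Lemma coherent_boosted tau (t r : R) : 0 < r -> coherent tau ->
  sinh r < t -> tau (planar t (Num.sqrt (1 + t ^+ 2))) -> tau (boosted (tanh r)).
Proof.
move=> r0 [_ t1 _ _] rt tt.
have tanh0 : tanh 0 = 0 :> R by rewrite /tanh sinh0 mul0r.
have h0 : 0 < tanh r by rewrite -tanh0 tanh_mono.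
have h1 := tanh_lt1 r; have h2 : 0 < 1 - tanh r ^+ 2 by rewrite subr_gt0 expr_lt1// ltW.
have s0 : 0 < sinh r by rewrite sinhE mulr_gt0// cosh_gt0.
have t0 := lt_trans s0 rt.
have t21 : 0 < 1 + t ^+ 2 by rewrite ltr_pwDl// sqr_ge0.
have ht : tanh r * Num.sqrt (1 + t ^+ 2) < t.
  have : (tanh r * Num.sqrt (1 + t ^+ 2)) ^+ 2 < t ^+ 2.
    have : sinh r ^+ 2 < t ^+ 2 by rewrite ltr_pXn2r// nnegrE ltW.
    rewrite {1}sinhE exprMn -[cosh r ^+ 2]invrK -onem_tanh2 ltr_pdivrMr// => th.
    rewrite exprMn sqr_sqrtr ?(ltW t21)//; lra.
  by rewrite ltr_pXn2r// nnegrE ?(ltW t0)// mulr_ge0 ?sqrtr_ge0// ltW.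
apply: (t1 _ _ tt); first by apply: dS_boosted; rewrite h0.
apply: cons_pairP => p; apply: cons_pairP => q z [_]; rewrite tnth_cons_pair0 => p0.
rewrite minkowskiC minkowski_planar minkowski_scaler => pq.
rewrite mulr_gt0 ?invr_gt0 ?sqrtr_gt0// minkowskiC minkowski_planar mul1r subr_gt0.
have sq0 : 0 < Num.sqrt (1 + t ^+ 2) by rewrite sqrtr_gt0.
rewrite -(ltr_pM2l sq0); rewrite subr_gt0 in pq; apply: lt_trans pq.
by rewrite mulrA [ltLHS]mulrC [ltRHS]mulrC ltr_pM2l// mulrC.
Qed.

Lemma exists_near_point tau r : 0 < r -> 1 / 2 < tanh r ^+ m ->
  coherent tau -> dS_measurable tau ->
  (dS_measure (tau `+` point_section origin) < +oo)%E ->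
  exists2 x, hyperboloid x & (dS_measure (tau `+` point_section x) <=
    radial_measure m `[0%R, r]%classic * @sphere_measure R m.+1 setT)%E.
Proof.
move=> r0 rm ct mt Foo.
have tanh0 : tanh 0 = 0 :> R by rewrite /tanh sinh0 mul0r.
have h01 : 0 < tanh r < 1 by rewrite tanh_lt1 andbT -tanh0 tanh_mono.
have [c [g [c0 Ig var]]] := variation h01 rm.
pose F x := dS_measure (tau `+` point_section x).
pose M := ereal_inf [set F x | x in hyperboloid].
have Io : hyperboloid (origin : m.+2.-tuple R) by exact: origin_hyperboloid.
have ME : (M \is a fin_num)%E.
  rewrite ge0_fin_numE.
    by apply: le_lt_trans Foo; apply: ereal_inf_lbound; exists origin.
  by apply: le_ereal_inf_tmp => _ [x _ <-]; exact: dS_measure_ge0.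
(* The tolerance is the gain [c] of [variation]: a step gaining [c] from [x] would land strictly
   below the infimum. *)
have [_ [x Ix <-] Fx] := lb_ereal_inf_adherent c0 ME.
exists x => //; have [L [LL Lo LF]] := exists_lorentz_origin Ix.
have FL y : dS_measure (L @^-1` tau `+` point_section y) = F (L y).
  exact: dS_measure_section.
have c1 := coherent_preimage LL LF ct; have m1 := dS_measurable_lorentz (ltn0Sn m) LL mt.
rewrite -/(F x) -Lo -FL; apply: dS_measure_coherent => //; first exact: ltW.
move=> u tu; rewrite leNgt; apply/negP => ru.
set t := tnth u ord0 in ru; pose v : m.+2.-tuple R := planar t (Num.sqrt (1 + t ^+ 2)).
have uv : minkowski u u = minkowski v v.
  have [tdS _ _ _] := c1; rewrite (tdS _ tu) minkowski_planar -!expr2 sqr_sqrtr ?addrK//.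
  by rewrite addr_ge0// sqr_ge0.
have [L2 [LL2 L2v L2o LF2]] := exists_lorentz_spacelike uv (esym (tnth_cons_pair0 _ _)).
have c2 := coherent_preimage LL2 LF2 c1.
have tv : (L2 @^-1` (L @^-1` tau)) v by rewrite /= L2v.
have := var _ c2 (coherent_boosted r0 c2 ru tv).
have FL2 y : dS_measure (L2 @^-1` (L @^-1` tau) `+` point_section y) = F (L (L2 y)).
  by rewrite -FL; exact: dS_measure_section.
rewrite !FL2 L2o Lo.
move=> /le_lt_trans/(_ Fx); rewrite lteD2rE// ltNge => /negP; apply.
apply: ereal_inf_lbound; exists (L (L2 g)) => //.
by apply: lorentz_hyperboloid => //; exact: lorentz_hyperboloid.
Qed.

End near_minimum.

(** * Point sections belong to the medianization *)

Section membership.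
Context {R : realType} {n : nat}.
Implicit Types (x u v w : n.+1.-tuple R) (tau : set (n.+1.-tuple R)).

Lemma radial_measure_le k (a b c : R) : a <= b ->
  (forall r, a <= r <= b -> `|r| <= c) ->
  (radial_measure k `[a, b]%classic <= (expR c ^+ k * (b - a))%:E)%E.
Proof.
move=> ab H.
apply: (@le_trans _ _ (\int[lebesgue_measure]_(r in `[a, b]%classic) (expR c ^+ k)%:E)%E).
  apply: ge0_le_integral => //=.
  - by move=> r _; rewrite lee_fin exprn_ge0// cosh_ge0.
  - apply/measurable_funTS/measurable_EFinP; apply: measurable_funX; exact: measurable_cosh.
  - move=> r; rewrite in_itv/= => /H; rewrite ler_norml => /andP[ir ri].
    rewrite lee_fin lerXn2r ?nnegrE ?cosh_ge0 ?expR_ge0//.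
    rewrite ler_pdivrMr// mulr_natr mulr2n lerD// ler_expR//.
    by rewrite lerNl.
rewrite integral_cst//= lebesgue_measure_itv/= lte_fin; case: ifPn => _.
  by rewrite -EFinB -EFinM.
by rewrite mule0 lee_fin mulr_ge0 ?exprn_ge0 ?expR_ge0// subr_ge0.
Qed.

Lemma radial_measure_lty k (a b : R) : (radial_measure k `[a, b]%classic < +oo)%E.
Proof.
have [ab|ba] := leP a b; last by rewrite set_itv_ge -?ltNge// measure0.
apply: le_lt_trans (ltry _); apply: (@radial_measure_le k a b (`|a| + `|b|)) => // r.
move=> /andP[ar rb]; rewrite ler_norml; have := ler_norm b; have := ler_norm (- a).
by rewrite normrN; have := normr_ge0 b; have := normr_ge0 a; move=> *; apply/andP; split; lra.
Qed.

Lemma dS_measure_band_lty (a : R) : 0 <= a -> (dS_measure (@band R n (- a) a) < +oo)%E.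
Proof.
(* Chosen so that e^b = 2 a + 1 and e^(-b) <= 1, whence sinh b >= a. *)
move=> a0; pose b := ln (2 * a + 1).
have a1 : 0 < 2 * a + 1 by lra.
have eb : expR b = 2 * a + 1 by rewrite lnK.
have eNb : expR (- b) <= 1.
  by rewrite expRN eb invf_le1//; lra.
have ab : a <= sinh b by rewrite /sinh ler_pdivlMr// eb; lra.
have sN : sinh (- b) = - sinh b by rewrite /sinh opprK; field.
apply: (@le_lt_trans _ _ (dS_measure (@band R n (sinh (- b)) (sinh b)))).
  by apply: le_dS_measure => u /andP[h1 h2]; apply/andP; split; [rewrite sN; lra|lra].
rewrite dS_measure_band; apply: lte_mul_pinfty => //.
- by rewrite ge0_fin_numE// radial_measure_lty.
- exact: sphere_measure_lty.
Qed.

Lemma hyperboloid_cauchy_schwarz x u : hyperboloid x -> dS u ->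
  (minkowski x u + tnth x ord0 * tnth u ord0) ^+ 2 <=
  (tnth x ord0 ^+ 2 - 1) * (tnth u ord0 ^+ 2 + 1).
Proof.
move: x u; apply: cons_pairP => a p; apply: cons_pairP => b q.
rewrite /hyperboloid /dS /= !minkowski_cons_sqr !tnth_cons_pair0 minkowski_cons.
move=> [pp _] qq; have -> : a ^+ 2 - 1 = enorm p ^+ 2 by lra.
have -> : b ^+ 2 + 1 = enorm q ^+ 2 by lra.
rewrite [X in X ^+ 2](_ : _ = \sum_(i < n) tnth p i * tnth q i); last by ring.
by rewrite !sqr_enorm; exact: cauchy_schwarz.
Qed.

(** For finiteness: where the sections of [x] and [origin] differ, the time coordinate t of [u] and
    the product of [x] and [u] have a nonnegative product. With a the time coordinate of [x],
    spatial Cauchy-Schwarz then gives a^2 t^2 <= (a^2 - 1)(t^2 + 1) for t <> 0, so t^2 < a^2, and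
    the difference lies in a band of finite measure. *)
Lemma point_section_medianization x : hyperboloid x -> medianization (point_section x).
Proof.
move=> Ix; have [_ x0] := Ix; split.
- by move=> u [].
- apply: measurable_dS_measurable; apply: measurableI; first exact: measurable_dS.
  by apply: measurable_lt => //; exact: measurable_minkowski.
- move=> h k xh [v vv kE] hk.
  have hx : h x.
    case: xh => [[u [uu [_ xu]] ->]|[u [uu xu] ->]]; first by split.
    by split => // -[_ ux]; apply: xu.
  have := hk _ hx; case: kE => ->.
    by move=> [_ xv]; left; exists v.
  by move=> [_ xv]; right; exists v => //; split => // -[_ xv']; apply: xv.
- apply: le_lt_trans (dS_measure_band_lty (ltW x0)); apply: le_dS_measure => u H.
  have [uu xu] : dS u /\ 0 <= tnth u ord0 * (minkowski x u + tnth x ord0 * tnth u ord0) -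
      tnth x ord0 * tnth u ord0 ^+ 2.
    have -> : tnth u ord0 * (minkowski x u + tnth x ord0 * tnth u ord0) -
      tnth x ord0 * tnth u ord0 ^+ 2 = tnth u ord0 * minkowski x u by ring.
    case: H => -[[uu]].
      move=> xu ou; split => //; rewrite mulr_ge0// ?(ltW xu)// leNgt; apply/negP => u0.
      by apply: ou; split => //; rewrite minkowskiC minkowski_origin oppr_gt0.
    rewrite minkowskiC minkowski_origin oppr_gt0 => u0 xu; split => //.
    rewrite mulr_le0// ?(ltW u0)// leNgt; apply/negP => xu'; exact: xu.
  have := hyperboloid_cauchy_schwarz Ix uu.
  move: xu x0; set C := minkowski x u + _; set a := tnth x ord0; set t := tnth u ord0.
  move=> xu a0 CS; rewrite /band /= -/t -ler_norml -(@ler_pXn2r _ 2)// ?nnegrE ?(ltW a0)//.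
  rewrite real_normK ?num_real// leNgt; apply/negP => ta.
  have a2 : 0 < a ^+ 2 by rewrite exprn_gt0.
  have t2 : 0 < t ^+ 2 by exact: lt_trans ta.
  have : (a * t ^+ 2) ^+ 2 <= (t * C) ^+ 2.
    have at0 : 0 <= a * t ^+ 2 by rewrite mulr_ge0// ltW.
    by rewrite ler_pXn2r// ?nnegrE//; lra.
  rewrite !exprMn [X in X <= _](_ : _ = t ^+ 2 * (a ^+ 2 * t ^+ 2)); last by ring.
  rewrite ler_pM2l// => aC; move: (le_trans aC CS).
  by set X := a ^+ 2 in ta *; set Y := t ^+ 2 in ta *; lra.
Qed.

End membership.

(** * The bound *)

Section constants.
Context {R : realType}.

Lemma sphere_measureT n : @sphere_measure R n setT = (sphere_volume n)%:E.
Proof. by rewrite /sphere_volume fineK// ge0_fin_numE// sphere_measure_lty. Qed.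

Lemma sphere_volume_ratio n : (0 < n)%N ->
  sphere_volume n.+1 / sphere_volume n =
  Num.sqrt pi * (Gamma (n%:R / 2) / Gamma (n.+1%:R / 2)) :> R.
Proof.
move=> n0; have V := @sphere_volume_gt0 R _ n0; have V1 := @sphere_volume_gt0 R _ (ltn0Sn n).
have spi : 0 < Num.sqrt pi :> R by rewrite sqrtr_gt0 pi_gt0.
have E := @sphere_volume_Gamma R _ n0; have E1 := @sphere_volume_Gamma R _ (ltn0Sn n).
have G1 : Gamma (n.+1%:R / 2) != 0 :> R.
  by apply/eqP => G0; move/eqP: E1; rewrite G0 mulr0 eq_sym mulf_eq0 pnatr_eq0/= gt_eqF// exprn_gt0.
move: E1; rewrite exprS mulrCA -E => E1.
apply: (mulIf G1); apply: (mulIf (lt0r_neq0 V)).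
rewrite mulrAC divfK ?gt_eqF// E1; field.
exact: G1.
Qed.

Lemma tanh_artanh_root m : (0 < m)%N ->
  0 < artanh (2 `^ (- m%:R^-1)) :> R /\ tanh (artanh (2 `^ (- m%:R^-1))) ^+ m = 1 / 2 :> R.
Proof.
move=> m0; set t : R := 2 `^ (- m%:R^-1).
have t0 : 0 < t by exact: powR_gt0.
have tm : t ^+ m = 1 / 2.
  rewrite -powR_mulrn ?ltW// -powRrM mulNr mulVf ?pnatr_eq0 ?gt_eqF ?ltr0n//.
  by rewrite powR_inv1// div1r.
have t1 : t < 1.
  by rewrite -(@ltr_pXn2r _ m)// ?nnegrE ?ltW// tm expr1n; lra.
have tK : tanh (artanh t) = t by apply: artanhK; rewrite t1 andbT; lra.
split; last by rewrite tK.
by rewrite -tanh_mono tK /tanh sinh0 mul0r.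
Qed.

(** Right continuity in quantitative form, from cosh r <= e^(a+1) on the added interval; it replaces
    the limit of r towards the critical radius. *)
Lemma radial_measureD k (a d : R) : 0 <= a -> 0 <= d <= 1 ->
  (radial_measure k `[0%R, (a + d)%R]%classic <=
   radial_measure k `[0%R, a]%classic + (expR (a + 1) ^+ k * d)%:E)%E.
Proof.
move=> a0 /andP[d0 d1].
apply: (@le_trans _ _ (radial_measure k (`[0%R, a]%classic `|` `[a, (a + d)%R]%classic))).
  apply: le_measure; rewrite ?inE //.
    by apply: measurableU; exact: measurable_itv.
  move=> r; rewrite /= !in_itv /= => /andP[r0 ra].
  by have [h|h] := leP r a; [left; rewrite r0|right; rewrite ra ltW].
apply: le_trans (measureU2 _ _ _) _; rewrite ?measurable_itv//.
apply: leeD => //.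
have -> : expR (a + 1) ^+ k * d = expR (a + 1) ^+ k * (a + d - a) by ring.
apply: radial_measure_le; first by lra.
by move=> r /andP[ar rad]; rewrite ger0_norm; lra.
Qed.

End constants.

Theorem theorem1p5 (R : realType) (n : nat) (n_ge2 : (2 <= n)%N) :
  let M := @medianization R n in
  let I := @hyperboloid R n in
  let supinf := ereal_sup [set ereal_inf [set dist_med tau (point_section x)
                                         | x in I] | tau in M] in
  hausdorff_dist dist_med [set point_section x | x in I] M = supinf /\
  (supinf <=
    (Num.sqrt pi * ((n%:R - 1) / 2) *
     (Gamma ((n%:R - 1) / 2) / Gamma (n%:R / 2)) *
     \int[lebesgue_measure]_(r in `[0%R, artanh (2 `^ (- (n%:R - 1)^-1))])
        cosh r ^+ n.-1)%:E)%E.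
Proof.
case: n n_ge2 => [//|m]; rewrite ltnS => m0 M I supinf.
have Vm := @sphere_volume_gt0 R _ m0; have Vm1 := @sphere_volume_gt0 R _ (ltn0Sn m).
have distC (tau tau' : set (m.+2.-tuple R)) : dist_med tau tau' = dist_med tau' tau.
  by rewrite /dist_med setYC.
have dist_ge0 (tau tau' : set (m.+2.-tuple R)) : (0 <= dist_med tau tau')%E.
  apply: mule_ge0; last exact: dS_measure_ge0.
  by rewrite lee_fin divr_ge0// mulr_ge0// ltW.
have Io : I origin by exact: origin_hyperboloid.
split.
  (* The supremum over the point sections is at most 0 because they belong to [M] themselves; the
     other one is [supinf] by symmetry of [dist_med]. *)
  rewrite /hausdorff_dist max_r.
    congr ereal_sup; apply: eq_imagel => tau _; rewrite image_comp.
    by congr ereal_inf; apply: eq_imagel => x _; rewrite /= distC.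
  apply: (@le_trans _ _ 0%E).
    apply: ge_ereal_sup => _ [_ [x Ix <-] <-]; apply: ge_ereal_inf.
    exists (dist_med (point_section x) (point_section x)).
      by exists (point_section x) => //; exact: point_section_medianization.
    by rewrite /dist_med /setY setDv setU0 /dS_measure measure0 mule0.
  apply: (@le_trans _ _ (ereal_inf
    [set dist_med a (point_section origin) | a in [set point_section x | x in I]])); last first.
    apply: ereal_sup_ubound; exists (point_section origin) => //.
    exact: point_section_medianization.
  by apply: le_ereal_inf_tmp => _ [a _ <-]; exact: dist_ge0.
have -> : m.+1%:R - 1 = m%:R :> R by rewrite -natr1 addrK.
have [] := @tanh_artanh_root R _ m0; set r0 := artanh _ => r00 r0m.
have Jfin : (radial_measure m `[0%R, r0]%classic \is a fin_num)%E.
  by rewrite ge0_fin_numE// radial_measure_lty.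
set J := (\int[lebesgue_measure]_(r in `[0%R, r0]) _).
have JE : radial_measure m `[0%R, r0]%classic = J%:E by rewrite -[LHS](fineK Jfin).
set k : R := m%:R / (2 * sphere_volume m).
have k0 : 0 <= k by rewrite divr_ge0// mulr_ge0// ltW.
have -> : Num.sqrt pi * (m%:R / 2) * (Gamma (m%:R / 2) / Gamma (m.+1%:R / 2)) * J =
    k * (J * sphere_volume m.+1).
  transitivity (sphere_volume m.+1 / sphere_volume m * (m%:R / 2) * J).
    by rewrite sphere_volume_ratio//; ring.
  by rewrite /k; field; rewrite gt_eqF.
apply: ge_ereal_sup => _ [tau [tdS mt adm Foo] <-].
have ct := admissible_coherent tdS adm.
apply/lee_addgt0Pr => e e0.
set C : R := k * expR (r0 + 1) ^+ m * sphere_volume m.+1.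
have C0 : 0 <= C by rewrite mulr_ge0 ?(ltW Vm1)// mulr_ge0// exprn_ge0// expR_ge0.
(* [radial_measureD] asks for d <= 1; the denominator [C + 1] is positive knowing only 0 <= C. *)
pose d := Num.min 1 (e / (C + 1)).
have d0 : 0 < d by rewrite lt_min ltr01 divr_gt0// ltr_wpDl.
have d1 : d <= 1 by rewrite ge_min lexx.
have dC : d * C <= e.
  have : d <= e / (C + 1) by rewrite ge_min lexx orbT.
  by rewrite ler_pdivlMr ?ltr_wpDl//; lra.
(* At [r0] itself the power equals 1/2, while the moving argument needs a strict inequality. *)
have rd : 1 / 2 < tanh (r0 + d) ^+ m.
  have tanh_ge0 r : 0 < r -> 0 <= tanh r.
    by move=> r1; rewrite ltW// -[ltLHS](_ : tanh 0 = 0) ?tanh_mono// /tanh sinh0 mul0r.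
  by rewrite -r0m ltr_pXn2r// ?nnegrE ?tanh_mono ?ltrDl// tanh_ge0// addr_gt0.
have [x Ix Fx] := exists_near_point (addr_gt0 r00 d0) rd ct mt Foo.
apply: ge_ereal_inf; exists (dist_med tau (point_section x)); first by exists x.
apply: (@le_trans _ _ (k%:E * ((J + expR (r0 + 1) ^+ m * d) * sphere_volume m.+1)%:E)%E).
  apply: lee_wpmul2l => //; apply: le_trans Fx _.
  rewrite sphere_measureT EFinM; apply: lee_wpmul2r; first by rewrite lee_fin ltW.
  by rewrite EFinD -JE; apply: radial_measureD; rewrite ?(ltW r00) ?(ltW d0).
rewrite -EFinM -EFinD lee_fin mulrDl mulrDr lerD2l.
by apply: le_trans dC; rewrite le_eqVlt; apply/orP; left; apply/eqP; rewrite /C; ring.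
Qed.
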